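(* Let $n>2$ and let $g_0$ be the round metric on $S^n$. Let $G$ be a discrete group acting freely on $S^n$ by isometries of $g_0$, such that the quotient $S^n/G$ is a smooth manifold and $S^n\to S^n/G$ is a smooth covering map; equip $S^n/G$ with the metric induced by $g_0$. Suppose that $S^n/G$ with this metric admits a Killing vector field of nonzero constant length. Then the functional $\Lambda_1(g)=\lambda_1(g)\,\mathrm{vol}(S^n,g)^{2/n}$ is not bounded above on the set of $G$-invariant Riemannian metrics $g$ on $S^n$; that is, for every $C>0$ there exists a $G$-invariant Riemannian metric $g$ on $S^n$ with $\Lambda_1(g)>C$. (Equivalently, $\lambda_1$ is not bounded above on the set of $G$-invariant metrics of any fixed volume.)
   Context: For a Riemannian metric $g$ on a closed connected manifold $M$ of dimension $n$, with Levi-Civita connection $\nabla$ and Laplacian $\triangle=\nabla^i\nabla_i$, $\lambda_1(g)$ denotes the smallest $\lambda>0$ for which there is a function $u\in C^\infty(M)$, not identically zero, with $\triangle u+\lambda u=0$. The eigenfunctions are not required to be $G$-invariant. A metric $g$ is $G$-invariant if every element of $G$ acts as an isometry of $g$. A vector field $Y$ is Killing if $\nabla_iY_j+\nabla_jY_i=0$. *)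

(* Defs.v *)
From HB Require Import structures.
From mathcomp Require Import all_boot all_order all_algebra.
From mathcomp Require Import all_classical all_reals all_analysis.
From mathcomp Require Import ring.

Set Implicit Arguments.
Unset Strict Implicit.
Unset Printing Implicit Defensive.

Import Order.TTheory GRing.Theory Num.Theory.
Import numFieldNormedType.Exports.

Local Open Scope classical_set_scope.
Local Open Scope ring_scope.

Definition pd (R : realType) (n : nat) (a : 'I_n) (f : 'rV[R]_n -> R) :
    'rV[R]_n -> R :=
  fun y => 'D_(delta_mx 0 a) f y.

(* Only meaningful for [U] open. *)
Fixpoint Ck (R : realType) (n k : nat) (U : set 'rV[R]_n)
    (f : 'rV[R]_n -> R) : Prop :=
  (forall y, U y -> {for y, continuous f}) /\
  (if k is k'.+1 then
     forall a : 'I_n, (forall y, U y -> derivable f y (delta_mx 0 a)) /\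
       Ck k' U (pd a f)
   else True).

Definition smooth (R : realType) (n : nat) (U : set 'rV[R]_n)
    (f : 'rV[R]_n -> R) : Prop :=
  forall k, Ck k U f.

(* Lebesgue integral over R^n of a nonnegative Borel function, as an iterated
   integral (Tonelli). *)
Fixpoint lebesgue_int (R : realType) (n : nat) :
    ('rV[R]_n -> \bar R) -> \bar R :=
  match n return ('rV[R]_n -> \bar R) -> \bar R with
  | 0 => fun f => f 0
  | n'.+1 => fun f => (\int[@lebesgue_measure R]_x
      lebesgue_int (fun v : 'rV[R]_n' => f (row_mx (x%:M : 'M[R]_1) v)))%E
  end.

(* A topological space with finitely many coordinate systems: [chart i] is a
   homeomorphism from the open set [dom i] onto an open subset of R^n, with
   inverse [param i]; their values elsewhere are irrelevant.  Closed manifolds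
   always have finite atlases. *)
Record atlas (R : realType) (n : nat) := Atlas {
  space :> topologicalType;
  nchart : nat;
  dom : 'I_nchart -> set space;
  chart : 'I_nchart -> space -> 'rV[R]_n;
  param : 'I_nchart -> 'rV[R]_n -> space }.

Arguments dom {R n} a i _.
Arguments chart {R n} a i _.
Arguments param {R n} a i _.

Definition target (R : realType) (n : nat) (M : atlas R n)
    (i : 'I_(nchart M)) : set 'rV[R]_n :=
  chart M i @` dom M i.

Arguments target {R n} M i _.

Definition transition (R : realType) (n : nat) (M : atlas R n)
    (i j : 'I_(nchart M)) : 'rV[R]_n -> 'rV[R]_n :=
  fun y => chart M j (param M i y).

Arguments transition {R n} M i j _.

Record smooth_manifold (R : realType) (n : nat) (M : atlas R n) : Prop := {
  manifold_hausdorff : hausdorff_space M;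
  manifold_cover : \bigcup_i dom M i = setT;
  manifold_dom : forall i, open (dom M i);
  manifold_target : forall i, open (target M i);
  manifold_paramK : forall i x, dom M i x -> param M i (chart M i x) = x;
  manifold_chart_cont : forall i x, dom M i x -> {for x, continuous (chart M i)};
  manifold_param_cont :
    forall i y, target M i y -> {for y, continuous (param M i)};
  manifold_transition : forall i j (a : 'I_n),
    smooth [set y | target M i y /\ dom M j (param M i y)]
           (fun y => transition M i j y 0 a) }.

(* Only meaningful for [W] open. *)
Definition smooth_map_on (R : realType) (m n : nat) (M : atlas R m)
    (N : atlas R n) (W : set M) (F : M -> N) : Prop :=
  (forall x, W x -> {for x, continuous F}) /\
  forall i j (a : 'I_n),
    smooth [set y | [/\ target M i y, W (param M i y)
                      & dom N j (F (param M i y))]]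
           (fun y => chart N j (F (param M i y)) 0 a).

Definition smooth_fun (R : realType) (n : nat) (M : atlas R n)
    (u : M -> R) : Prop :=
  forall i, smooth (target M i) (fun y => u (param M i y)).

(* Each point has an open neighborhood [V] whose preimage is a disjoint union
   of open sets, each mapped diffeomorphically onto [V]. *)
Definition smooth_covering (R : realType) (n : nat) (M N : atlas R n)
    (p : M -> N) : Prop :=
  [/\ smooth_map_on setT p,
      (forall q, exists x, p x = q)
    & forall q, exists2 V : set N, open V /\ V q &
        exists2 sheets : set (set M),
          [/\ (forall W, sheets W -> open W), trivIset sheets id
            & p @^-1` V = \bigcup_(W in sheets) W] &
          forall W, sheets W -> exists2 s : N -> M, smooth_map_on V s &
            (forall q', V q' -> W (s q') /\ p (s q') = q') /\
            (forall x, W x -> s (p x) = x)].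

(* [g i y a b] is the component g_ab at the point [param i y], in chart [i]. *)
Definition tensor2 (R : realType) (n : nat) (M : atlas R n) :=
  'I_(nchart M) -> 'rV[R]_n -> 'M[R]_n.

(* [Y i y 0 a] is the component Y^a at the point [param i y], in chart [i]. *)
Definition vector_components (R : realType) (n : nat) (M : atlas R n) :=
  'I_(nchart M) -> 'rV[R]_n -> 'rV[R]_n.

(* [F^* h = g].  The library's Jacobian acts on row vectors from the right:
   ['J F y a b] is the derivative of F^b in the direction a. *)
Definition pullback_eq (R : realType) (m n : nat) (M : atlas R m)
    (N : atlas R n) (F : M -> N) (h : tensor2 N) (g : tensor2 M) : Prop :=
  forall i j y, target M i y -> dom N j (F (param M i y)) ->
    let Fij := fun z => chart N j (F (param M i z)) in
    g i y = 'J Fij y *m h j (Fij y) *m ('J Fij y)^T.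

(* The first field is the transformation law between charts. *)
Record riemannian_metric (R : realType) (n : nat) (M : atlas R n)
    (g : tensor2 M) : Prop := {
  metric_tensor : pullback_eq (@idfun M) g g;
  metric_smooth : forall i a b, smooth (target M i) (fun y => g i y a b);
  metric_sym : forall i y, target M i y -> (g i y)^T = g i y;
  metric_pos : forall i y (v : 'rV[R]_n), target M i y -> v != 0 ->
    0 < (v *m g i y *m v^T) 0 0 }.

Record vector_field (R : realType) (n : nat) (M : atlas R n)
    (Y : vector_components M) : Prop := {
  field_tensor : forall i j y, target M i y -> dom M j (param M i y) ->
    Y j (transition M i j y) = Y i y *m 'J (transition M i j) y;
  field_smooth : forall i a, smooth (target M i) (fun y => Y i y 0 a) }.

Definition riemannian_isometry (R : realType) (n : nat) (M : atlas R n) (g : tensor2 M)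
    (F : M -> M) : Prop :=
  [/\ smooth_map_on setT F,
      (exists F' : M -> M, [/\ smooth_map_on setT F', cancel F F'
                             & cancel F' F])
    & pullback_eq F g g].

(* Gamma^c_ab *)
Definition christoffel (R : realType) (n : nat) (g : 'rV[R]_n -> 'M[R]_n)
    (c a b : 'I_n) (y : 'rV[R]_n) : R :=
  2^-1 * \sum_l invmx (g y) c l *
    (pd a (fun z => g z l b) y + pd b (fun z => g z a l) y
     - pd l (fun z => g z a b) y).

(* nabla_a w_b *)
Definition covariant_derivative (R : realType) (n : nat)
    (g : 'rV[R]_n -> 'M[R]_n) (w : 'rV[R]_n -> 'rV[R]_n) (a b : 'I_n)
    (y : 'rV[R]_n) : R :=
  pd a (fun z => w z 0 b) y - \sum_c christoffel g c a b y * w y 0 c.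

Definition laplacian (R : realType) (n : nat) (g : 'rV[R]_n -> 'M[R]_n)
    (f : 'rV[R]_n -> R) (y : 'rV[R]_n) : R :=
  \sum_a \sum_b invmx (g y) a b *
    covariant_derivative g (fun z => \row_c pd c f z) a b y.

Definition killing (R : realType) (n : nat) (M : atlas R n) (g : tensor2 M)
    (Y : vector_components M) : Prop :=
  forall i y (a b : 'I_n), target M i y ->
    let Yflat := fun z => Y i z *m g i z in
    covariant_derivative (g i) Yflat a b y
    + covariant_derivative (g i) Yflat b a y = 0.

Definition has_constant_length (R : realType) (n : nat) (M : atlas R n)
    (g : tensor2 M) (Y : vector_components M) (c : R) : Prop :=
  forall i y, target M i y -> Num.sqrt ((Y i y *m g i y *m (Y i y)^T) 0 0) = c.

Definition laplace_eigenvalue (R : realType) (n : nat) (M : atlas R n) (g : tensor2 M)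
    (lam : R) : Prop :=
  exists u : M -> R, [/\ smooth_fun u, (exists x, u x != 0) &
    forall i y, target M i y ->
      laplacian (g i) (fun z => u (param M i z)) y + lam * u (param M i y) = 0].

Definition is_lambda1 (R : realType) (n : nat) (M : atlas R n) (g : tensor2 M)
    (lam : R) : Prop :=
  [/\ 0 < lam, laplace_eigenvalue g lam &
    forall mu, 0 < mu -> laplace_eigenvalue g mu -> lam <= mu].

(* The value is 0 if there is no smallest positive eigenvalue. *)
Definition lambda1 (R : realType) (n : nat) (M : atlas R n) (g : tensor2 M) : R :=
  xget 0 [set lam | is_lambda1 g lam].

(* The charts cut [M] into the pieces [dom i] minus the preceding domains, and
   each piece is measured with the density sqrt(det g). *)
Definition volume (R : realType) (n : nat) (M : atlas R n) (g : tensor2 M) :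
    \bar R :=
  (\sum_(i < nchart M) lebesgue_int (fun y : 'rV[R]_n =>
    if y \in chart M i @` (dom M i `\` \bigcup_(j in [set j : 'I_(nchart M) | (j < i)%N]) dom M j)
    then (Num.sqrt (\det (g i y)))%:E else 0))%E.

Definition Lambda1 (R : realType) (n : nat) (M : atlas R n) (g : tensor2 M) : R :=
  lambda1 g * (fine (volume g)) `^ (2 / n%:R).

Definition sphere_set (R : realType) (n : nat) : set 'rV[R]_n.+1 :=
  [set x | \sum_k x 0 k ^+ 2 = 1].

Arguments sphere_set : clear implicits.

(* Stereographic projection from the pole (s, 0, .., 0), where s is 1 or -1,
   and its inverse. *)
Definition stereo (R : realType) (n : nat) (s : R) (x : 'rV[R]_n.+1) : 'rV[R]_n :=
  (1 - s * x 0 0)^-1 *: (\row_k x 0 (lift ord0 k)).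

Definition stereo_inv (R : realType) (n : nat) (s : R) (y : 'rV[R]_n) :
    'rV[R]_n.+1 :=
  let r := \sum_k y 0 k ^+ 2 in
  (r + 1)^-1 *: row_mx ((s * (r - 1))%:M : 'M[R]_1) (2 *: y).

Definition pole (R : realType) (i : 'I_2) : R := (-1) ^+ i.

Arguments pole : clear implicits.

Lemma stereo_inv_sphere (R : realType) (n : nat) (i : 'I_2) (y : 'rV[R]_n) :
  stereo_inv (pole R i) y \in sphere_set R n.
Proof.
rewrite inE /sphere_set /= /stereo_inv; set r := \sum_k y 0 k ^+ 2.
have r1 : r + 1 != 0.
  by rewrite gt_eqF// ltr_wpDl// sumr_ge0// => k _; exact: sqr_ge0.
have s2 : pole R i ^+ 2 = 1 by rewrite /pole -exprM mulnC exprM sqrrN !expr1n.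
rewrite big_ord_recl (_ : ord0 = lshift n ord0 :> 'I_(1 + n)); last exact: val_inj.
rewrite mxE row_mxEl mxE eqxx mulr1n.
under eq_bigr => k _.
  rewrite (_ : lift _ _ = rshift 1 k :> 'I_(1 + n)); last exact: val_inj.
  rewrite mxE row_mxEr mxE exprMn exprMn.
  over.
rewrite -mulr_sumr -mulr_sumr -/r exprMn exprMn s2; field.
exact: r1.
Qed.

Definition sphere (R : realType) (n : nat) : atlas R n :=
  @Atlas R n (set_type (sphere_set R n)) 2
    (fun i => [set x : set_type (sphere_set R n) |
                (set_val x : 'rV[R]_n.+1) 0 0 != pole R i])
    (fun i x => stereo (pole R i) (set_val x))
    (fun i y => exist _ (stereo_inv (pole R i) y) (stereo_inv_sphere i y)).

Arguments sphere : clear implicits.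

(* The metric induced by the Euclidean one on R^(n+1). *)
Definition round (R : realType) (n : nat) : tensor2 (sphere R n) :=
  fun i y => let J := 'J (stereo_inv (n := n) (pole R i)) y in J *m J^T.

Arguments round : clear implicits.

Definition is_action (G : groupType) (T : Type) (act : G -> T -> T) : Prop :=
  (forall x, act 1%g x = x) /\
  (forall a b x, act (a * b)%g x = act a (act b x)).

Definition free_action (G : groupType) (T : Type) (act : G -> T -> T) : Prop :=
  forall a x, act a x = x -> a = 1%g.

Definition invariant_metric (R : realType) (n : nat) (M : atlas R n)
    (G : Type) (act : G -> M -> M) (g : tensor2 M) : Prop :=
  riemannian_metric g /\ forall a, riemannian_isometry g (act a).

(* [p] identifies [N] with the orbit space of the action on [M]. *)
Definition orbit_space (M N G : Type) (act : G -> M -> M) (p : M -> N) : Prop :=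
  (forall q, exists x, p x = q) /\
  (forall x x', p x = p x' <-> exists a, x' = act a x).

(* Main.v *)
From HB Require Import structures.
Require Import Defs.
From mathcomp Require Import all_boot all_order all_algebra.
From mathcomp Require Import all_classical all_reals all_analysis.
From mathcomp Require Import measurable_realfun.
From mathcomp Require Import ring lra.

Set Implicit Arguments.
Unset Strict Implicit.
Unset Printing Implicit Defensive.

Import Order.TTheory GRing.Theory Num.Theory.
Import numFieldNormedType.Exports.

Local Open Scope classical_set_scope.
Local Open Scope ring_scope.

(** A Killing field of the round sphere is [x |-> x *m A] with [A] skew.  If the
    field comes from a Killing field of constant length [c] on the quotient, then
    [A *m A^T] is the scalar [c ^+ 2], so that [J = c^-1 *: A] is a complex structure
    and the flow of the field is that of a Hopf fibration
    ([killing_complex_structure]).  The metric [berger J a b] divides the round one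
    by [a] orthogonally to the Hopf fibres and by [b] along them.  It is made of the
    round metric and of the one-form dual to the field; this one-form is pulled back
    from the quotient, so the group preserves the metric ([pullback_berger]).  For
    [b = a / a ^+ n] the volume does not depend on [a] ([volume_berger]), whereas for
    [b <= a] the first eigenvalue is [a * n%:R + (b - a)] ([lambda1_berger]), which is
    at least [a * (n - 1)] and so becomes as large as one wishes.

    The eigenvalue.  Functions on the sphere are read on the punctured ambient space,
    constant along rays, where the Laplacian becomes the operator [berger_op] with
    quadratic coefficients ([laplacian_berger]).  The coordinate functions are
    eigenfunctions for the announced value.  Let [F] be an eigenfunction for a smaller
    positive eigenvalue, let [v] be a unit vector, and let [z] be the complex
    coordinate in the complex line of [v].  On the monomials in [z] and its conjugate
    the operator is triangular, with no diagonal entry equal to that eigenvalue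
    ([op_zz_re], [gap_eigenvalue_ge]).  Hence, the operator being symmetric
    ([riemann_sum_green]), [F] is orthogonal to all of them ([moment_zz]), in
    particular to the powers of [2 + Re z].  These concentrate where [Re z] is largest,
    that is, in the direction of [v]; therefore [F v = 0] ([spectral_gap_point]).
    As [v] is arbitrary, [F] vanishes.  The only facts about integration
    used here are linearity, monotonicity and the vanishing of the integral of a
    derivative, so that limits of Riemann sums over a grid suffice.

    The complex structure.  Composing a chart of the quotient with the projection
    along rays gives a map [Q] on the punctured ambient space, and Koszul's formula
    expresses the Christoffel symbols of the quotient through the second derivatives
    of [Q] ([lift_connectionE]).  It follows that the Killing field lifts to a Killing
    field of flat space ([lift_field_killing]); the second derivatives of such a field
    vanish ([flat_killing]). *)

(** * Partial derivatives *)

Section OneVariable.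
Variable R : realType.
Implicit Types (V : normedModType R).

Lemma is_derive_line V (f : V -> R) (y v : V) (s : R) :
  derivable f (y + s *: v) v ->
  is_derive s (1 : R) (fun t : R => f (y + t *: v)) ('D_v f (y + s *: v)).
Proof.
move=> df.
have E : (fun h : R => h^-1 *: (f (y + (h *: (1 : R) + s) *: v) - f (y + s *: v)))
  = (fun h : R => h^-1 *: (f (h *: v + (y + s *: v)) - f (y + s *: v))).
  apply/funext => h; do 3 f_equal.
  by rewrite [h *: 1]mulr1 scalerDl addrCA.
apply: DeriveDef; first by rewrite /derivable /= E.
by rewrite /derive /= E.
Qed.

(** The range of [s] is symmetric so that [h] may have either sign. *)
Lemma mvt_line V (f : V -> R) (y v : V) (h : R) :
  (forall s, `|s| <= `|h| -> derivable f (y + s *: v) v) ->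
  exists2 s, `|s| <= `|h| & f (y + h *: v) - f y = h * 'D_v f (y + s *: v).
Proof.
move=> df; pose g := fun t : R => f (y + t *: v).
have dg s : `|s| <= `|h| -> is_derive s (1 : R) g ('D_v f (y + s *: v)).
  by move=> /df; exact: is_derive_line.
have cg a b : (forall s, s \in `[a, b]%R -> `|s| <= `|h|) -> {within `[a, b], continuous g}.
  move=> ab; apply: derivable_within_continuous => s /ab/dg.
  by move=> [].
have [h0|h0] := leP 0 h.
  have ab s : s \in `[0, h]%R -> `|s| <= `|h|.
    by rewrite in_itv/= => /andP[s0 sh]; rewrite !ger0_norm.
  have [||c c1 c2] := @MVT_segment R g (fun s => 'D_v f (y + s *: v)) 0 h h0.
  - by move=> s s1; apply: dg; apply: ab; exact: subset_itv_oo_cc.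
  - exact: cg.
  exists c; first exact: ab.
  by rewrite -[LHS]/(g h - f y) -[in f y](addr0 y) -[in y + 0](scale0r v) -/(g 0) c2 subr0 mulrC.
have ab s : s \in `[h, 0]%R -> `|s| <= `|h|.
  by rewrite in_itv/= => /andP[s0 sh]; rewrite !ler0_norm// ?lerN2// ltW.
have [||c c1 c2] := @MVT_segment R g (fun s => 'D_v f (y + s *: v)) h 0 (ltW h0).
- by move=> s s1; apply: dg; apply: ab; exact: subset_itv_oo_cc.
- exact: cg.
exists c; first exact: ab.
have -> : f y = g 0 by rewrite /g scale0r addr0.
by rewrite -[f _]/(g h); move: c2; rewrite sub0r mulrN => /eqP; rewrite eq_sym eqr_oppLR opprB [h * _]mulrC => /eqP.
Qed.

End OneVariable.

Lemma continuous_sum_at (R : realType) (T : topologicalType) (I : Type) (s : seq I)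
    (F : I -> T -> R) (y : T) :
  (forall i, {for y, continuous (F i)}) ->
  {for y, continuous (fun z => \sum_(i <- s) F i z)}.
Proof.
move=> cF; elim: s => [|i s IH].
  rewrite (_ : (fun _ => _) = cst 0); first exact: cvg_cst.
  by apply/funext => z; rewrite big_nil.
rewrite (_ : (fun _ => _) = (F i \+ (fun z => \sum_(i <- s) F i z))).
  by apply: cvgD => //; exact: cF.
by apply/funext => z; rewrite big_cons.
Qed.

Section RowVectors.
Variables (R : realType) (n : nat).
Implicit Types (f g : 'rV[R]_n -> R) (y h : 'rV[R]_n).

Lemma coord_le_norm h (c : 'I_n) : `|h 0 c| <= `|h|.
Proof.
rewrite [leRHS]/Num.Def.normr/= mx_normrE.
exact: (le_bigmax _ (fun i : 'I_1 * 'I_n => `|h i.1 i.2|) (ord0, c)).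
Qed.

Lemma norm_le_coord h (e : R) : 0 <= e -> (forall c, `|h 0 c| <= e) -> `|h| <= e.
Proof.
move=> e0 he; rewrite [leLHS]/Num.Def.normr/= mx_normrE.
by rewrite (bigmax_le _ e0)//= => -[i c] _ /=; rewrite (ord1 i).
Qed.

Lemma norm_lt_coord h (e : R) : 0 < e -> (forall c, `|h 0 c| < e) -> `|h| < e.
Proof.
move=> e0 he; rewrite [ltLHS]/Num.Def.normr/= mx_normrE.
by rewrite (bigmax_lt _ e0)//= => -[i c] _ /=; rewrite (ord1 i).
Qed.

(** These vectors join [0] to [h] by steps along the axes, on each of which a single
    partial derivative of a function matters. *)
Definition partial_step h (j : nat) : 'rV[R]_n := \row_c (if (c < j)%N then h 0 c else 0).

Lemma partial_stepS h (j : 'I_n) :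
  partial_step h j.+1 = partial_step h j + h 0 j *: delta_mx 0 j.
Proof.
apply/rowP => c; rewrite !mxE eqxx/= ltnS leq_eqVlt.
have [->|cj] := eqVneq c j; first by rewrite eqxx/= ltnn add0r mulr1.
by rewrite (negbTE (_ : (c != j :> nat)))//= mulr0 addr0.
Qed.

Lemma partial_step0 h : partial_step h 0 = 0.
Proof. by apply/rowP => c; rewrite !mxE. Qed.

Lemma partial_step_full h : partial_step h n = h.
Proof. by apply/rowP => c; rewrite !mxE ltn_ord. Qed.

Lemma partial_step_line h (j : 'I_n) (s : R) : `|s| <= `|h 0 j| ->
  `|partial_step h j + s *: delta_mx 0 j| <= `|h|.
Proof.
move=> sh; apply: norm_le_coord => // c; rewrite !mxE eqxx/=.
have [->|cj] := eqVneq c j.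
  by rewrite ltnn add0r mulr1 (le_trans sh)// coord_le_norm.
by rewrite mulr0 addr0; case: ifP => _; rewrite ?normr0// coord_le_norm.
Qed.

(** The candidate for the differential of a function with partial derivatives [p]. *)
Definition gradient_form (p : 'I_n -> R) h := \sum_c h 0 c * p c.

Lemma gradient_form_linear p : linear (gradient_form p).
Proof.
move=> k u v; rewrite /gradient_form scaler_sumr -big_split/=.
by apply: eq_bigr => c _; rewrite !mxE mulrDl -mulrA.
Qed.

HB.instance Definition _ p :=
  GRing.isLinear.Build R 'rV[R]_n R _ (gradient_form p) (gradient_form_linear p).

Lemma gradient_form_continuous p : continuous (gradient_form p).
Proof.
move=> x; rewrite /gradient_form.
apply: continuous_sum_at => c.
apply: (@continuousM R _ (fun h : 'rV[R]_n => h 0 c) (fun=> p c) x).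
  exact: coord_continuous.
exact: cst_continuous.
Qed.

(** The increment from [y] to [y + h] is the sum of the increments along the partial
    steps; on each of them the mean value theorem gives a partial derivative at a
    point close to [y], which is close to its value at [y]. *)
Lemma is_diff_gradient f y :
  (\forall z \near y, forall c, derivable f z (delta_mx 0 c)) ->
  (forall c, {for y, continuous (pd c f)}) ->
  is_diff y f (gradient_form (fun c => pd c f y)).
Proof.
move=> df cf; pose L := gradient_form (fun c => pd c f y).
have key : f \o shift y = cst (f y) + (L : _ -> _) +o_ (0 : 'rV[R]_n) id.
  apply/eqaddoP => _/posnumP[e].
  have e1 : 0 < e%:num / (n%:R + 1) by rewrite divr_gt0// ltr_wpDl.
  have : \forall z \near y, (forall c, derivable f z (delta_mx 0 c)) /\
      forall c, `|pd c f z - pd c f y| <= e%:num / (n%:R + 1).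
    near=> z; split; first by near: z.
    near: z; apply: filter_forall => c.
    move/cvgrPdist_le: (cf c) => /(_ _ e1); apply: filterS => z.
    by rewrite distrC.
  move=> /nbhs_ballP[d /= d0 dP]; apply/nbhs_ballP; exists d => //= h.
  rewrite -ball_normE /= sub0r normrN => hd; rewrite !fctE /=.
  have inb x : `|x| <= `|h| -> ball y d (y + x).
    by move=> xh; rewrite -ball_normE/= opprD addrA subrr sub0r normrN (le_lt_trans xh).
  pose P j := y + partial_step h j.
  have step (j : 'I_n) : exists2 s : R, `|s| <= e%:num / (n%:R + 1) &
      f (P j.+1) - f (P j) = h 0 j * (pd j f y + s).
    have [s sh|s sh] := @mvt_line R _ f (P j) (delta_mx 0 j) (h 0 j).
      by have /dP[+ _] := inb _ (partial_step_line sh); rewrite addrA; exact.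
    rewrite /P partial_stepS addrA => ->.
    have /dP[_ /(_ j) H] := inb _ (partial_step_line sh).
    exists (pd j f (y + (partial_step h j + s *: delta_mx 0 j)) - pd j f y) => //.
    by rewrite [pd j f y + _]addrC subrK /pd addrA.
  have -> : h + y = P n by rewrite /P partial_step_full addrC.
  have -> : f (P n) - (f y + L h) = \sum_(j < n) (f (P j.+1) - f (P j) - h 0 j * pd j f y).
    rewrite sumrB -(big_mkord xpredT (fun j => f (P j.+1) - f (P j))) telescope_sumr//.
    by rewrite /P partial_step0 addr0 opprD addrA.
  apply: (le_trans (ler_norm_sum _ _ _)).
  apply: (@le_trans _ _ (\sum_(j < n) `|h| * (e%:num / (n%:R + 1)))).
    apply: ler_sum => j _; have [s s1 ->] := step j.
    by rewrite -mulrBr addrAC subrr add0r normrM ler_pM// coord_le_norm.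
  rewrite sumr_const card_ord -[leLHS]mulr_natr -mulrA [leRHS]mulrC ler_wpM2l//.
  by rewrite mulrAC ler_pdivrMr ?ltr_wpDl// ler_wpM2l// lerDl.
apply: DiffDef.
  apply/diff_locallyP; rewrite (diff_unique _ key); last exact: gradient_form_continuous.
  by split; [exact: gradient_form_continuous|].
by apply: (diff_unique _ key); exact: gradient_form_continuous.
Unshelve. all: by end_near. Qed.

End RowVectors.

Section ChainRule.
Variable R : realType.
Implicit Types V W : normedModType R.

Lemma derive_line V W (f : V -> W) (y v : V) :
  'D_v f y = 'D_1 (fun h : R => f (h *: v + y)) 0.
Proof.
rewrite /derive; set g1 := fun h => h^-1 *: _; set g2 := fun h => h^-1 *: _.
suff -> : g1 = g2 by [].
by rewrite funeqE /g1 /g2 => h /=; rewrite addr0 scale0r add0r [_%:A]mulr1.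
Qed.

Lemma is_derive_comp V (U : normedModType R) W (f : V -> W) (phi : U -> V) (y v : U) :
  differentiable f (phi y) -> derivable phi y v ->
  is_derive y v (f \o phi) ('d f (phi y) ('D_v phi y)).
Proof.
move=> df dphi; pose g := fun h : R => phi (h *: v + y).
have g0 : g 0 = phi y by rewrite /g scale0r add0r.
have dg : differentiable g 0 by apply/derivable1_diffP; move/derivable1P: dphi.
have dfg : differentiable (f \o g) 0 by apply: differentiable_comp => //; rewrite g0.
apply: DeriveDef; first by apply/derivable1P; move/derivable1_diffP: dfg.
rewrite derive_line -[LHS]/('D_1 (f \o g) 0) deriveE// diff_comp//; last by rewrite g0.
by rewrite /= g0 (derive_line phi) deriveE.
Qed.

Lemma differentiable_row V (m : nat) (phi : V -> 'rV[R]_m) (y : V) :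
  (forall c, differentiable (fun z => phi z 0 c) y) -> differentiable phi y.
Proof.
move=> dphi.
rewrite (_ : phi = \sum_(c < m) (fun z => phi z 0 c *: (delta_mx 0 c : 'rV[R]_m))).
  by apply: differentiable_sum => c; apply: differentiableZl.
by apply/funext => z; rewrite fct_sumE; exact: row_sum_delta.
Qed.

Lemma continuous_row (T : topologicalType) (m : nat) (phi : T -> 'rV[R]_m) (y : T) :
  (forall c, {for y, continuous (fun z => phi z 0 c)}) -> {for y, continuous phi}.
Proof.
move=> cphi; apply/cvgrPdist_lt => e e0.
near=> z; apply: norm_lt_coord => // c; rewrite !mxE.
move: c; near: z; apply: filter_forall => c.
by move/cvgrPdist_lt: (cphi c) => /(_ _ e0).
Unshelve. all: by end_near. Qed.

End ChainRule.

Section PartialDerivatives.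
Variables (R : realType) (n : nat).
Implicit Types (f g : 'rV[R]_n -> R) (y : 'rV[R]_n) (a : 'I_n).
Local Notation e_ a := (delta_mx 0 a : 'rV[R]_n).

Lemma pdD f g y a : derivable f y (e_ a) -> derivable g y (e_ a) ->
  pd a (fun z => f z + g z) y = pd a f y + pd a g y.
Proof. exact: deriveD. Qed.

Lemma pdB f g y a : derivable f y (e_ a) -> derivable g y (e_ a) ->
  pd a (fun z => f z - g z) y = pd a f y - pd a g y.
Proof. exact: deriveB. Qed.

Lemma pdM f g y a : derivable f y (e_ a) -> derivable g y (e_ a) ->
  pd a (fun z => f z * g z) y = pd a f y * g y + f y * pd a g y.
Proof.
move=> df dg; have := deriveM df dg; rewrite /pd => ->.
by rewrite addrC [X in X + _ = _]mulrC.
Qed.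

Lemma derivableZ' (c : R) f y a : derivable f y (e_ a) ->
  derivable (fun z => c * f z) y (e_ a).
Proof. by move=> df; exact: derivableZ. Qed.

Lemma pdZ (c : R) f y a : derivable f y (e_ a) ->
  pd a (fun z => c * f z) y = c * pd a f y.
Proof. by move=> df; exact: deriveZ. Qed.

Lemma pd_cst (c : R) y a : pd a (fun=> c) y = 0.
Proof. exact: derive_cst. Qed.

Lemma derivable_sum' (I : Type) (s : seq I) (F : I -> 'rV[R]_n -> R) y a :
  (forall i, derivable (F i) y (e_ a)) ->
  derivable (fun z => \sum_(i <- s) F i z) y (e_ a).
Proof.
move=> dF; elim: s => [|i s IH].
  rewrite (_ : (fun _ => _) = cst 0); first exact: derivable_cst.
  by apply/funext => z; rewrite big_nil.
rewrite (_ : (fun _ => _) = F i \+ (fun z => \sum_(i <- s) F i z)).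
  exact: derivableD.
by apply/funext => z; rewrite big_cons.
Qed.

Lemma pd_sum (I : Type) (s : seq I) (F : I -> 'rV[R]_n -> R) y a :
  (forall i, derivable (F i) y (e_ a)) ->
  pd a (fun z => \sum_(i <- s) F i z) y = \sum_(i <- s) pd a (F i) y.
Proof.
move=> dF; elim: s => [|i s IH].
  rewrite big_nil -[RHS](pd_cst 0 y a); congr (pd a _ y).
  by apply/funext => z; rewrite big_nil.
rewrite big_cons -IH -pdD//; last exact: derivable_sum'.
by congr (pd a _ y); apply/funext => z; rewrite big_cons.
Qed.

Lemma derivable_coord y c a : derivable (fun z : 'rV[R]_n => z 0 c) y (e_ a).
Proof. exact/diff_derivable/differentiable_coord. Qed.

Lemma pd_coord y c a : pd a (fun z : 'rV[R]_n => z 0 c) y = (a == c)%:R.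
Proof.
rewrite /pd /derive.
have -> : (fun h : R => h^-1 *: (((h *: e_ a + y) 0 c : R) - y 0 c)) =
          (fun h : R => h^-1 * (h * (a == c)%:R)).
  by apply/funext => h; rewrite !mxE eqxx/= addrK eq_sym.
apply: lim_near_cst => //; near=> h; rewrite mulKf//.
by near: h; exact: nbhs_dnbhs_neq.
Unshelve. all: by end_near. Qed.

Lemma pdV f y a : f y != 0 -> derivable f y (e_ a) ->
  pd a (fun z => (f z)^-1) y = - pd a f y * ((f y)^-1 * (f y)^-1).
Proof.
move=> f0 df; rewrite /pd [LHS](deriveV f0 df) /=.
by rewrite [_ *: _]mulrC expr2 invfM mulrN mulNr.
Qed.

Lemma pd_comp m (f : 'rV[R]_m -> R) (phi : 'rV[R]_n -> 'rV[R]_m) y a :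
  is_diff (phi y) f (gradient_form (fun c => pd c f (phi y))) ->
  (forall c, derivable (fun z => phi z 0 c) y (e_ a)) ->
  is_derive y (e_ a) (fun z => f (phi z))
    (\sum_c pd c f (phi y) * pd a (fun z => phi z 0 c) y).
Proof.
move=> df dphi.
have dp : derivable phi y (e_ a) by apply/derivable_mxP => i j; rewrite (ord1 i).
have := is_derive_comp (@ex_diff _ _ _ _ _ _ _ df) dp.
rewrite (@diff_val _ _ _ _ _ _ _ df) /gradient_form derive_mx//.
congr (is_derive _ _ _ _); apply: eq_bigr => c _.
by rewrite mxE mulrC.
Qed.

Lemma pd_sqrt f y a : 0 < f y -> derivable f y (e_ a) ->
  is_derive y (e_ a) (fun z => Num.sqrt (f z)) (pd a f y * (2 * Num.sqrt (f y))^-1).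
Proof.
move=> f0 df; have ds := is_derive1_sqrt f0.
have dd : differentiable Num.sqrt (f y) by apply/derivable1_diffP; exact: (@ex_derive _ _ _ _ _ _ _ ds).
have := is_derive_comp dd df.
congr (is_derive _ _ _ _).
rewrite -[X in 'd _ _ X](mulr1 ('D_(e_ a) f y)) -[X in 'd _ _ X]/('D_(e_ a) f y *: (1 : R)).
by rewrite linearZ /= -deriveE// (@derive_val _ _ _ _ _ _ _ ds).
Qed.

(** Carrying derivability along with the value lets a derivative be computed by
    composing the lemmas below. *)
Definition has_pd f y a (d : R) := derivable f y (e_ a) /\ pd a f y = d.

Lemma has_pdP f y a : derivable f y (e_ a) -> has_pd f y a (pd a f y).
Proof. by []. Qed.

Lemma has_pd_eq f y a d d' : has_pd f y a d -> d = d' -> has_pd f y a d'.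
Proof. by move=> ? <-. Qed.

Lemma has_pd_cst c y a : has_pd (fun=> c) y a 0.
Proof. by split; [exact: derivable_cst|exact: pd_cst]. Qed.

Lemma has_pd_coord y c a : has_pd (fun z : 'rV[R]_n => z 0 c) y a (a == c)%:R.
Proof. by split; [exact: derivable_coord|exact: pd_coord]. Qed.

Lemma has_pdD f g y a d d' : has_pd f y a d -> has_pd g y a d' ->
  has_pd (fun z => f z + g z) y a (d + d').
Proof. by move=> [df <-] [dg <-]; split; [exact: derivableD|exact: pdD]. Qed.

Lemma has_pdB f g y a d d' : has_pd f y a d -> has_pd g y a d' ->
  has_pd (fun z => f z - g z) y a (d - d').
Proof. by move=> [df <-] [dg <-]; split; [exact: derivableB|exact: pdB]. Qed.

Lemma has_pdM f g y a d d' : has_pd f y a d -> has_pd g y a d' ->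
  has_pd (fun z => f z * g z) y a (d * g y + f y * d').
Proof. by move=> [df <-] [dg <-]; split; [exact: derivableM|exact: pdM]. Qed.

Lemma has_pdZ c f y a d : has_pd f y a d -> has_pd (fun z => c * f z) y a (c * d).
Proof. by move=> [df <-]; split; [exact: derivableZ'|exact: pdZ]. Qed.

Lemma has_pd_sum (I : Type) (s : seq I) (F : I -> 'rV[R]_n -> R) (d : I -> R) y a :
  (forall i, has_pd (F i) y a (d i)) ->
  has_pd (fun z => \sum_(i <- s) F i z) y a (\sum_(i <- s) d i).
Proof.
move=> dF; have dF' i : derivable (F i) y (e_ a) by have [] := dF i.
split; first exact: derivable_sum'.
by rewrite pd_sum//; apply: eq_bigr => i _; have [] := dF i.
Qed.

Lemma has_pdV f y a d : f y != 0 -> has_pd f y a d ->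
  has_pd (fun z => (f z)^-1) y a (- d / f y ^+ 2).
Proof.
move=> f0 [df <-]; split; first exact: derivableV.
by rewrite pdV// expr2 invfM.
Qed.

Lemma near_eq_pd f g y a : (\near y, f y = g y) -> pd a f y = pd a g y.
Proof. exact: near_eq_derive. Qed.

End PartialDerivatives.

(** * Functions of class C^k *)

Section CkTheory.
Variable R : realType.

Lemma Ck_continuous n k (U : set 'rV[R]_n) f y :
  Ck k U f -> U y -> {for y, continuous f}.
Proof. by case: k => [|k] [cf _]; exact: cf. Qed.

Lemma Ck_derivable n k (U : set 'rV[R]_n) f y (a : 'I_n) :
  Ck k.+1 U f -> U y -> derivable f y (delta_mx 0 a).
Proof. by move=> [_ /(_ a)[df _]]; exact: df. Qed.

Arguments Ck_derivable {n k U f y} a _ _.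

Lemma Ck_pd n k (U : set 'rV[R]_n) f (a : 'I_n) : Ck k.+1 U f -> Ck k U (pd a f).
Proof. by move=> [_ /(_ a)[]]. Qed.

Arguments Ck_pd {n k U f} a _.

Lemma CkW n k (U : set 'rV[R]_n) f : Ck k.+1 U f -> Ck k U f.
Proof.
elim: k f => [|k IH] f Cf.
  by split => // y; exact: (Ck_continuous Cf).
split => [y|a]; first exact: (Ck_continuous Cf).
by split => [y|]; [exact: (Ck_derivable a Cf)|exact/IH/Ck_pd].
Qed.

Lemma Ck_le n k l (U : set 'rV[R]_n) f : (k <= l)%N -> Ck l U f -> Ck k U f.
Proof.
move=> /subnKC <-; elim: (l - k)%N => [|d IH]; first by rewrite addn0.
by rewrite addnS => /CkW.
Qed.

Lemma Ck_sub n k (U V : set 'rV[R]_n) f : V `<=` U -> Ck k U f -> Ck k V f.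
Proof.
move=> VU; elim: k f => [|k IH] f Cf; split => //.
- by move=> y /VU; exact: (Ck_continuous Cf).
- by move=> y /VU; exact: (Ck_continuous Cf).
- move=> a; split; last exact/IH/Ck_pd.
  by move=> y /VU; exact: (Ck_derivable a Cf).
Qed.

Lemma near_open_eq n (U : set 'rV[R]_n) (f g : 'rV[R]_n -> R) y :
  open U -> (forall z, U z -> f z = g z) -> U y -> \near y, f y = g y.
Proof.
move=> oU fg Uy; apply: (@filterS _ _ _ U); last exact: open_nbhs_nbhs.
by move=> z /fg.
Qed.

Lemma near_eq_continuous n (f g : 'rV[R]_n -> R) (y : 'rV[R]_n) :
  (\near y, f y = g y) -> {for y, continuous f} -> {for y, continuous g}.
Proof.
move=> fg cf; rewrite /prop_for /continuous_at -(nbhs_singleton fg).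
exact: cvg_trans (near_eq_cvg fg) cf.
Qed.

Lemma Ck_ext n k (U : set 'rV[R]_n) f g : open U ->
  (forall y, U y -> f y = g y) -> Ck k U f -> Ck k U g.
Proof.
move=> oU; elim: k f g => [|k IH] f g fg Cf; split => //.
- move=> y Uy; have := Ck_continuous Cf Uy.
  by apply: near_eq_continuous; exact: near_open_eq fg Uy.
- move=> y Uy; have := Ck_continuous Cf Uy.
  by apply: near_eq_continuous; exact: near_open_eq fg Uy.
- move=> a; split=> [y Uy|].
    have := Ck_derivable a Cf Uy; apply: near_eq_derivable.
    exact: near_open_eq fg Uy.
  apply: IH (Ck_pd a Cf) => y Uy; apply: near_eq_pd.
  exact: near_open_eq fg Uy.
Qed.

(** The neighborhoods need not be open: being [Ck] is a condition at each point. *)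
Lemma Ck_local n k (U : set 'rV[R]_n) f :
  (forall y, U y -> exists2 V : set 'rV[R]_n, V y & Ck k V f) -> Ck k U f.
Proof.
elim: k f => [|k IH] f H; split => //.
- by move=> y /H[V Vy CV]; exact: (Ck_continuous CV).
- by move=> y /H[V Vy CV]; exact: (Ck_continuous CV).
- move=> a; split => [y /H[V Vy CV]|]; first exact: (Ck_derivable a CV).
  by apply: IH => y /H[V Vy CV]; exists V => //; exact: Ck_pd.
Qed.

Lemma Ck_cst n k (U : set 'rV[R]_n) (c : R) : Ck k U (fun=> c).
Proof.
elim: k c => [|k IH] c; split => //.
- by move=> y _; exact: cst_continuous.
- by move=> y _; exact: cst_continuous.
- move=> a; split => [y _|]; first exact: derivable_cst.
  by rewrite (_ : pd a _ = fun=> 0)//; apply/funext => y; rewrite pd_cst.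
Qed.

Lemma Ck_coord n k (U : set 'rV[R]_n) (c : 'I_n) : Ck k U (fun y => y 0 c).
Proof.
case: k => [|k]; split => //.
- by move=> y _; exact: coord_continuous.
- by move=> y _; exact: coord_continuous.
- move=> a; split => [y _|]; first exact: derivable_coord.
  rewrite (_ : pd a _ = fun=> (a == c)%:R); first exact: Ck_cst.
  by apply/funext => y; rewrite pd_coord.
Qed.

Lemma Ck_add n k (U : set 'rV[R]_n) f g : open U ->
  Ck k U f -> Ck k U g -> Ck k U (fun y => f y + g y).
Proof.
move=> oU; elim: k f g => [|k IH] f g Cf Cg; split => //.
- by move=> y Uy; apply: continuousD; [exact: (Ck_continuous Cf)|exact: (Ck_continuous Cg)].
- by move=> y Uy; apply: continuousD; [exact: (Ck_continuous Cf)|exact: (Ck_continuous Cg)].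
- move=> a; split => [y Uy|].
    by apply: derivableD; [exact: (Ck_derivable a Cf)|exact: (Ck_derivable a Cg)].
  apply: Ck_ext (IH _ _ (Ck_pd a Cf) (Ck_pd a Cg)) => // y Uy.
  by rewrite pdD//; [exact: (Ck_derivable a Cf)|exact: (Ck_derivable a Cg)].
Qed.

Lemma Ck_mul n k (U : set 'rV[R]_n) f g : open U ->
  Ck k U f -> Ck k U g -> Ck k U (fun y => f y * g y).
Proof.
move=> oU; elim: k f g => [|k IH] f g Cf Cg; split => //.
- by move=> y Uy; apply: continuousM; [exact: (Ck_continuous Cf)|exact: (Ck_continuous Cg)].
- by move=> y Uy; apply: continuousM; [exact: (Ck_continuous Cf)|exact: (Ck_continuous Cg)].
- move=> a; split => [y Uy|].
    by apply: derivableM; [exact: (Ck_derivable a Cf)|exact: (Ck_derivable a Cg)].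
  have H := Ck_add oU (IH _ _ (Ck_pd a Cf) (CkW Cg)) (IH _ _ (CkW Cf) (Ck_pd a Cg)).
  apply: Ck_ext H => // y Uy.
  by rewrite pdM//; [exact: (Ck_derivable a Cf)|exact: (Ck_derivable a Cg)].
Qed.

Lemma Ck_scale n k (U : set 'rV[R]_n) (c : R) f : open U ->
  Ck k U f -> Ck k U (fun y => c * f y).
Proof. by move=> oU; apply: Ck_mul => //; exact: Ck_cst. Qed.

Lemma Ck_opp n k (U : set 'rV[R]_n) f : open U ->
  Ck k U f -> Ck k U (fun y => - f y).
Proof.
move=> oU /(Ck_scale (-1) oU); congr (Ck _ _ _).
by apply/funext => y; rewrite mulN1r.
Qed.

Lemma Ck_sub_fun n k (U : set 'rV[R]_n) f g : open U ->
  Ck k U f -> Ck k U g -> Ck k U (fun y => f y - g y).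
Proof. by move=> oU Cf Cg; apply: Ck_add => //; exact: Ck_opp. Qed.

Lemma Ck_sum n k (U : set 'rV[R]_n) (I : Type) (s : seq I) (F : I -> 'rV[R]_n -> R) :
  open U -> (forall i, Ck k U (F i)) -> Ck k U (fun y => \sum_(i <- s) F i y).
Proof.
move=> oU CF; elim: s => [|i s IH].
  rewrite (_ : (fun _ => _) = fun=> 0); first exact: Ck_cst.
  by apply/funext => z; rewrite big_nil.
rewrite (_ : (fun _ => _) = (fun z => F i z + \sum_(i <- s) F i z)).
  exact: Ck_add.
by apply/funext => z; rewrite big_cons.
Qed.

Lemma Ck_exp n k (U : set 'rV[R]_n) f (d : nat) : open U ->
  Ck k U f -> Ck k U (fun y => f y ^+ d).
Proof.
move=> oU Cf; elim: d => [|d IH].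
  rewrite (_ : (fun _ => _) = fun=> 1); first exact: Ck_cst.
  by apply/funext => z; rewrite expr0.
rewrite (_ : (fun _ => _) = (fun z => f z * f z ^+ d)); first exact: Ck_mul.
by apply/funext => z; rewrite exprS.
Qed.

Lemma Ck_inv n k (U : set 'rV[R]_n) f : open U -> (forall y, U y -> f y != 0) ->
  Ck k U f -> Ck k U (fun y => (f y)^-1).
Proof.
move=> oU f0; elim: k f f0 => [|k IH] f f0 Cf; split => //.
- by move=> y Uy; apply: continuousV; [exact: f0|exact: (Ck_continuous Cf)].
- by move=> y Uy; apply: continuousV; [exact: f0|exact: (Ck_continuous Cf)].
- move=> a; split => [y Uy|].
    by apply: derivableV; [exact: f0|exact: (Ck_derivable a Cf)].
  have IHf := IH f f0 (CkW Cf).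
  apply: Ck_ext (Ck_mul oU (Ck_opp oU (Ck_pd a Cf)) (Ck_mul oU IHf IHf)) => // y Uy.
  by rewrite pdV//; [exact: f0|exact: (Ck_derivable a Cf)].
Qed.

Lemma Ck_sqrt n k (U : set 'rV[R]_n) f : open U -> (forall y, U y -> 0 < f y) ->
  Ck k U f -> Ck k U (fun y => Num.sqrt (f y)).
Proof.
move=> oU f0; elim: k f f0 => [|k IH] f f0 Cf; split => //.
- move=> y Uy; apply: continuous_comp; first exact: (Ck_continuous Cf).
  exact: sqrt_continuous.
- move=> y Uy; apply: continuous_comp; first exact: (Ck_continuous Cf).
  exact: sqrt_continuous.
- move=> a; have dS y (Uy : U y) := pd_sqrt (f0 y Uy) (Ck_derivable a Cf Uy).
  split => [y Uy|]; first exact: (@ex_derive _ _ _ _ _ _ _ (dS y Uy)).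
  have IHf := IH f f0 (CkW Cf).
  have H2 y : U y -> 2 * Num.sqrt (f y) != 0.
    by move=> Uy; rewrite mulf_neq0// sqrtr_eq0 -ltNge f0.
  apply: Ck_ext (Ck_mul oU (Ck_pd a Cf) (Ck_inv oU H2 (Ck_scale 2 oU IHf))) => // y Uy.
  by rewrite {2}/pd (@derive_val _ _ _ _ _ _ _ (dS y Uy)).
Qed.

Lemma Ck_diff n k (U : set 'rV[R]_n) f y : open U -> Ck k.+1 U f -> U y ->
  is_diff y f (gradient_form (fun c => pd c f y)).
Proof.
move=> oU Cf Uy; apply: is_diff_gradient.
  apply: (@filterS _ _ _ U); last exact: open_nbhs_nbhs.
  by move=> z Uz c; exact: Ck_derivable Cf Uz.
by move=> c; exact: Ck_continuous (Ck_pd c Cf) Uy.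
Qed.

Lemma Ck_pd_comp m n k (U : set 'rV[R]_n) (V : set 'rV[R]_m) f (phi : 'rV[R]_n -> 'rV[R]_m) y a :
  open V -> Ck k.+1 V f -> V (phi y) ->
  (forall c, Ck k.+1 U (fun z => phi z 0 c)) -> U y ->
  is_derive y (delta_mx 0 a) (fun z => f (phi z))
    (\sum_c pd c f (phi y) * pd a (fun z => phi z 0 c) y).
Proof.
move=> oV Cf Vy Cphi Uy; apply: pd_comp; first exact: (Ck_diff oV Cf Vy).
by move=> c; exact: Ck_derivable (Cphi c) Uy.
Qed.

Lemma Ck_comp m n k (U : set 'rV[R]_n) (V : set 'rV[R]_m) f (phi : 'rV[R]_n -> 'rV[R]_m) :
  open U -> open V -> Ck k V f -> (forall c, Ck k U (fun z => phi z 0 c)) ->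
  (forall y, U y -> V (phi y)) -> Ck k U (fun z => f (phi z)).
Proof.
move=> oU oV + + UV; elim: k f => [|k IH] f Cf Cphi.
  split => // y Uy; apply: continuous_comp.
    by apply: continuous_row => c; exact: Ck_continuous (Cphi c) Uy.
  exact: Ck_continuous Cf (UV y Uy).
split => [y Uy|a].
  apply: continuous_comp.
    by apply: continuous_row => c; exact: Ck_continuous (Cphi c) Uy.
  exact: Ck_continuous Cf (UV y Uy).
have D y (Uy : U y) := Ck_pd_comp a oV Cf (UV y Uy) Cphi Uy.
split => [y Uy|]; first exact: (@ex_derive _ _ _ _ _ _ _ (D y Uy)).
have := Ck_sum (index_enum _) oU (fun c =>
  Ck_mul oU (IH _ (Ck_pd c Cf) (fun d => CkW (Cphi d))) (Ck_pd a (Cphi c))).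
apply: Ck_ext => // y Uy.
by rewrite /pd (@derive_val _ _ _ _ _ _ _ (D y Uy)).
Qed.

(** The mean value theorem along the first axis, then along the second one.  The left
    side does not change when the axes are exchanged, which gives [pd_comm]. *)
Lemma second_difference n (U : set 'rV[R]_n) f y a b (d h : R) :
  Ck 2 U f -> ball y d `<=` U -> `|h| < d / 2 ->
  exists2 z, `|z - y| <= 2 * `|h| &
    f (y + h *: delta_mx 0 a + h *: delta_mx 0 b) - f (y + h *: delta_mx 0 a)
    - (f (y + h *: delta_mx 0 b) - f y) = h * (h * pd b (pd a f) z).
Proof.
move=> Cf dU hd; have bU (s t : R) : `|s| <= `|h| -> `|t| <= `|h| ->
    `|s *: delta_mx 0 a + t *: delta_mx 0 b : 'rV[R]_n| <= 2 * `|h| /\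
    U (y + s *: delta_mx 0 a + t *: delta_mx 0 b).
  move=> sh th; have H : `|s *: delta_mx 0 a + t *: delta_mx 0 b : 'rV[R]_n| <= 2 * `|h|.
    have d1 (c : 'I_n) : `|delta_mx 0 c : 'rV[R]_n| <= 1.
      apply: norm_le_coord => // c'; rewrite mxE eqxx/=.
      by case: eqP => _; rewrite ?normr1 ?normr0.
    apply: (le_trans (ler_normD _ _)); rewrite !normrZ mulr2n mulrDl !mul1r lerD//.
      by rewrite (le_trans _ sh)// ler_piMr.
    by rewrite (le_trans _ th)// ler_piMr.
  split => //; apply: dU; rewrite -ball_normE/= -addrA opprD addrA subrr sub0r normrN.
  by apply: (le_lt_trans H); rewrite mulrC -ltr_pdivlMr.
pose g z := f (z + h *: delta_mx 0 b) - f z.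
have dg s : `|s| <= `|h| ->
    is_derive (y + s *: delta_mx 0 a) (delta_mx 0 a) g
      (pd a f (y + s *: delta_mx 0 a + h *: delta_mx 0 b) - pd a f (y + s *: delta_mx 0 a)).
  move=> sh; have [_ U1] := bU s h sh (lexx _).
  have [_ U2] := bU s 0 sh ltac:(by rewrite normr0).
  rewrite scale0r addr0 in U2.
  have D1 := Ck_derivable a Cf U1; have D2 := Ck_derivable a Cf U2.
  apply: is_deriveB; last exact/derivableP.
  have -> : pd a f (y + s *: delta_mx 0 a + h *: delta_mx 0 b) =
    'D_(delta_mx 0 a) (fun z => f (z + h *: delta_mx 0 b)) (y + s *: delta_mx 0 a).
    rewrite /pd /derive; set g1 := fun h => h^-1 *: _; set g2 := fun h => h^-1 *: _.
    by suff -> : g1 = g2 by []; rewrite funeqE /g1 /g2 => t /=; rewrite addrA.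
  apply/derivableP; move: D1; rewrite /derivable.
  set g1 := fun h => h^-1 *: _; set g2 := fun h => h^-1 *: _.
  by suff -> : g1 = g2 by []; rewrite funeqE /g1 /g2 => t /=; rewrite addrA.
have [s sh E1] := @mvt_line R _ g y (delta_mx 0 a) h
  (fun s sh => @ex_derive _ _ _ _ _ _ _ (dg s sh)).
rewrite (@derive_val _ _ _ _ _ _ _ (dg s sh)) in E1.
have [t th E2] := @mvt_line R _ (pd a f) (y + s *: delta_mx 0 a) (delta_mx 0 b) h
  (fun t th => Ck_derivable b (Ck_pd a Cf) (bU s t sh th).2).
exists (y + s *: delta_mx 0 a + t *: delta_mx 0 b).
  by rewrite -(addrA y) [y + _]addrC addrK; exact: (bU s t sh th).1.
by rewrite /g in E1; rewrite E1 E2.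
Qed.

Lemma eq_of_close_values n (F G : 'rV[R]_n -> R) y (d : R) : 0 < d ->
  {for y, continuous F} -> {for y, continuous G} ->
  (forall h, 0 < h -> h < d -> exists z1 z2,
     [/\ `|z1 - y| <= 2 * h, `|z2 - y| <= 2 * h & F z1 = G z2]) ->
  F y = G y.
Proof.
move=> d0 cF cG close; apply/eqP; rewrite -subr_eq0 -normr_eq0 eq_le normr_ge0 andbT.
apply/ler_addgt0Pr => e e0; rewrite add0r.
have e2 : 0 < e / 2 by rewrite divr_gt0.
move/cvgrPdist_lt: cF => /(_ _ e2) NF; move/cvgrPdist_lt: cG => /(_ _ e2) NG.
have : nbhs y ([set t | `|F y - F t| < e / 2] `&` [set t | `|G y - G t| < e / 2]).
  exact: filterI NF NG.
move=> /nbhs_ballP[d' /= d'0 dP].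
pose h := Num.min (d / 2) (d' / 4).
have h0 : 0 < h by rewrite lt_min !divr_gt0.
have hd : h < d.
  by rewrite (@le_lt_trans _ _ (d / 2)) ?ge_min ?lexx// ltr_pdivrMr// mulr_natr mulr2n ltrDl.
have hd' : 2 * h < d'.
  rewrite (@le_lt_trans _ _ (2 * (d' / 4)))//; last by lra.
  by rewrite ler_wpM2l// ge_min lexx orbT.
have [z1 [z2 [nz1 nz2 E]]] := close h h0 hd.
have inb z : `|z - y| <= 2 * h -> ball y d' z.
  by move=> zh; rewrite -ball_normE/= distrC (le_lt_trans zh).
have [H1 _] := dP _ (inb _ nz1); have [_ H2] := dP _ (inb _ nz2).
rewrite (_ : _ - _ = (F y - F z1) - (G y - G z2)); last by rewrite E; ring.
by rewrite (le_trans (ler_normB _ _))// [leRHS]splitr lerD// ltW.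
Qed.

(** Both mixed derivatives are values, near [y], of the same second difference
    quotient. *)
Lemma pd_comm n (U : set 'rV[R]_n) f y a b :
  open U -> Ck 2 U f -> U y -> pd a (pd b f) y = pd b (pd a f) y.
Proof.
move=> oU Cf Uy.
have cab := Ck_continuous (Ck_pd a (Ck_pd b Cf)) Uy.
have cba := Ck_continuous (Ck_pd b (Ck_pd a Cf)) Uy.
have /nbhs_ballP[d /= d0 dU] : nbhs y U by exact: open_nbhs_nbhs.
apply: (@eq_of_close_values _ _ _ _ (d / 2) _ cab cba); first by rewrite divr_gt0.
move=> h h0 hd; have nh : `|h| = h by rewrite gtr0_norm.
rewrite -nh in hd.
have [z1 nz1 E1] := second_difference a b Cf dU hd.
have [z2 nz2 E2] := second_difference b a Cf dU hd.
rewrite nh in nz1 nz2; exists z2, z1; split; [exact: nz2|exact: nz1|].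
have hn : h != 0 by rewrite gt_eqF.
apply: (mulfI hn); apply: (mulfI hn).
refine (etrans (esym E2) (etrans _ E1)).
by rewrite [in f (y + _ + _)]addrAC; ring.
Qed.

End CkTheory.

(** * Stereographic projection *)

Lemma pdE (R : realType) (n : nat) (a : 'I_n) f (y : 'rV[R]_n) :
  pd a f y = 'D_(delta_mx 0 a) f y.
Proof. by []. Qed.

(* Unification should never unfold derivatives down to limits. *)
#[local] Opaque pd jacobian diff derive.

Section SquaredNorm.
Variables (R : realType) (n : nat).
Implicit Types x y : 'rV[R]_n.

Definition sqn x : R := \sum_k x 0 k ^+ 2.

Lemma sqn_ge0 x : 0 <= sqn x.
Proof. by apply: sumr_ge0 => k _; exact: sqr_ge0. Qed.

Lemma sqnE x : sqn x = (x *m x^T) 0 0.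
Proof. by rewrite mxE; apply: eq_bigr => k _; rewrite mxE expr2. Qed.

Lemma sqn_eq0 x : (sqn x == 0) = (x == 0).
Proof.
apply/idP/eqP => [/eqP|->]; last by rewrite /sqn big1// => k _; rewrite mxE expr0n.
move/psumr_eq0P => x0; apply/rowP => k; rewrite mxE; apply/eqP.
by rewrite -sqrf_eq0 x0// => i _; exact: sqr_ge0.
Qed.

Lemma sqn_gt0 x : x != 0 -> 0 < sqn x.
Proof. by move=> x0; rewrite lt_def sqn_eq0 x0 sqn_ge0. Qed.

Lemma sqnZ c x : sqn (c *: x) = c ^+ 2 * sqn x.
Proof. by rewrite /sqn mulr_sumr; apply: eq_bigr => k _; rewrite mxE exprMn. Qed.

Lemma Ck_sqn k U : open U -> Ck k U sqn.
Proof. by move=> oU; apply: Ck_sum => // i; apply: Ck_exp => //; exact: Ck_coord. Qed.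

Lemma has_pd_sqn a y : has_pd sqn y a (2 * y 0 a).
Proof.
have -> : sqn = fun z => \sum_k z 0 k * z 0 k.
  by apply/funext => z; apply: eq_bigr => k _; rewrite expr2.
have H := has_pd_sum (index_enum 'I_n)
  (fun k => has_pdM (has_pd_coord y k a) (has_pd_coord y k a)).
apply: has_pd_eq H _; rewrite (bigD1 a)//= eqxx mul1r mulr1 big1 => [|k ka].
  by rewrite addr0 mulr2n mulrDl mul1r.
by rewrite eq_sym (negbTE ka) mul0r mulr0 addr0.
Qed.

End SquaredNorm.

Lemma jacobianE (R : realType) (m n : nat) (f : 'rV[R]_m -> 'rV[R]_n) y a b :
  differentiable f y -> 'J f y a b = pd a (fun z => f z 0 b) y.
Proof.
move=> df; have D : derivable f y (delta_mx 0 a) by exact: diff_derivable.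
have := congr1 (fun A : 'rV_n => A 0 b) (derive_mx D); rewrite mxE pdE => <-.
by rewrite deriveEjacobian// -rowE [in RHS]mxE.
Qed.

Lemma jacobian_comp (R : realType) (m n p : nat) (f : 'rV[R]_m -> 'rV[R]_n)
    (g : 'rV[R]_n -> 'rV[R]_p) y :
  differentiable f y -> differentiable g (f y) ->
  'J (fun z => g (f z)) y = 'J f y *m 'J g (f y).
Proof.
move=> df dg; have dgf : differentiable (g \o f) y by exact: differentiable_comp.
apply/row_matrixP => i; rewrite !rowE mulmxA.
rewrite -(deriveEjacobian (delta_mx 0 i) dgf) -(deriveEjacobian (delta_mx 0 i) df).
rewrite -(deriveEjacobian ('D_(delta_mx 0 i) f y) dg).
by rewrite (deriveE _ dgf) (deriveE _ df) (deriveE _ dg) diff_comp.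
Qed.

Lemma near_eq_jacobian (R : realType) (m n : nat) (f g : 'rV[R]_m -> 'rV[R]_n) y :
  (\near y, f y = g y) -> differentiable f y -> differentiable g y ->
  'J f y = 'J g y.
Proof.
move=> fg df dg; apply/matrixP => a b.
apply: etrans (jacobianE a b df) (etrans _ (esym (jacobianE a b dg))).
by apply: near_eq_pd; apply: filterS fg => z ->.
Qed.

Section Stereographic.
Variables (R : realType) (n : nat).
Implicit Types (y : 'rV[R]_n) (x : 'rV[R]_n.+1) (i : 'I_2).
Local Notation sigma i := (@stereo_inv R n (pole R i)).

Lemma pole_sq i : pole R i ^+ 2 = 1.
Proof. by rewrite /pole -exprM mulnC exprM sqrrN !expr1n. Qed.

Lemma sqn1_neq0 y : sqn y + 1 != 0.
Proof. by rewrite gt_eqF// ltr_wpDl// sqn_ge0. Qed.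

Lemma stereo_inv_head i y :
  sigma i y 0 0 = pole R i * (sqn y - 1) / (sqn y + 1).
Proof.
rewrite /stereo_inv -/(sqn y) (_ : 0 = lshift n ord0 :> 'I_(1 + n)); last exact: val_inj.
by rewrite mxE row_mxEl mxE eqxx mulr1n mulrC.
Qed.

Lemma stereo_inv_tail i y (k : 'I_n) :
  sigma i y 0 (lift ord0 k) = 2 * y 0 k / (sqn y + 1).
Proof.
rewrite /stereo_inv -/(sqn y) (_ : lift _ _ = rshift 1 k :> 'I_(1 + n)); last exact: val_inj.
by rewrite mxE row_mxEr mxE mulrC.
Qed.

Lemma sqn_stereo_inv i y : sqn (sigma i y) = 1.
Proof. by have := stereo_inv_sphere i y; rewrite inE. Qed.

Lemma Ck_stereo_inv k i (c : 'I_n.+1) : Ck k setT (fun y => sigma i y 0 c).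
Proof.
have oT : open [set: 'rV[R]_n] by exact: openT.
have Cs : Ck k setT (fun y : 'rV[R]_n => sqn y) by exact: Ck_sqn.
have C1 : Ck k setT (fun y : 'rV[R]_n => (sqn y + 1)^-1).
  apply: Ck_inv => // [y _|]; first exact: sqn1_neq0.
  by apply: Ck_add => //; exact: Ck_cst.
case: (unliftP 0 c) => [j|] -> /=.
  rewrite (_ : (fun _ => _) = fun y => 2 * y 0 j * (sqn y + 1)^-1).
    by apply: Ck_mul => //; apply: Ck_scale => //; exact: Ck_coord.
  by apply/funext => y; rewrite stereo_inv_tail.
rewrite (_ : (fun _ => _) = fun y => pole R i * (sqn y - 1) * (sqn y + 1)^-1).
  by apply: Ck_mul => //; apply: Ck_scale => //; apply: Ck_sub_fun => //; exact: Ck_cst.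
by apply/funext => y; rewrite stereo_inv_head.
Qed.

Lemma differentiable_Ck m p k (U : set 'rV[R]_m) (f : 'rV[R]_m -> 'rV[R]_p) (y : 'rV[R]_m) :
  open U -> (forall c, Ck k.+1 U (fun z => f z 0 c)) -> U y -> differentiable f y.
Proof.
move=> oU Cf Uy; apply: differentiable_row => c.
exact: (@ex_diff _ _ _ _ _ _ _ (Ck_diff oU (Cf c) Uy)).
Qed.

Lemma differentiable_stereo_inv i y : differentiable (sigma i) y.
Proof.
apply: (@differentiable_Ck _ _ 0 setT) => // [|c]; first exact: openT.
exact: Ck_stereo_inv.
Qed.

Lemma derivable_stereo_inv i y (c : 'I_n.+1) (a : 'I_n) :
  derivable (fun y => sigma i y 0 c) y (delta_mx 0 a).
Proof. by have := @Ck_derivable R n 0 setT _ y a (Ck_stereo_inv 1 i c); exact. Qed.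

Lemma has_pd_sqn1V a y :
  has_pd (fun z => (sqn z + 1)^-1) y a (- (2 * y 0 a) / (sqn y + 1) ^+ 2).
Proof.
apply: has_pdV; first exact: sqn1_neq0.
by have := has_pdD (has_pd_sqn a y) (has_pd_cst 1 y a); rewrite addr0.
Qed.

Lemma pd_stereo_inv_head i y (a : 'I_n) :
  pd a (fun y => sigma i y 0 0) y = pole R i * (4 * y 0 a) / (sqn y + 1) ^+ 2.
Proof.
have := sqn1_neq0 y => y0.
have -> : (fun y => sigma i y 0 0) =
    fun z => pole R i * ((sqn z - 1) * (sqn z + 1)^-1).
  by apply/funext => z; rewrite stereo_inv_head mulrA.
have [_ ->] := has_pdZ (pole R i) (has_pdM
  (has_pdB (has_pd_sqn a y) (has_pd_cst 1 y a)) (has_pd_sqn1V a y)).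
by move: (pole R i) (sqn y) (y 0 a) y0 => p q z q0; field.
Qed.

Lemma pd_stereo_inv_tail i y (a k : 'I_n) :
  pd a (fun y => sigma i y 0 (lift ord0 k)) y =
  2 * (a == k)%:R / (sqn y + 1) - 4 * y 0 a * y 0 k / (sqn y + 1) ^+ 2.
Proof.
have := sqn1_neq0 y => y0.
have -> : (fun y => sigma i y 0 (lift ord0 k)) =
    fun z => 2 * (z 0 k * (sqn z + 1)^-1).
  by apply/funext => z; rewrite stereo_inv_tail mulrA.
have [_ ->] := has_pdZ 2 (has_pdM (has_pd_coord y k a) (has_pd_sqn1V a y)).
by move: (sqn y) (y 0 a) (y 0 k) (a == k)%:R y0 => q z t d q0; field.
Qed.

(** The square of [2 / (1 + |y|^2)], by which stereographic coordinates are conformal. *)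
Definition conformal_factor y : R := 4 / (sqn y + 1) ^+ 2.

Lemma conformal_factor_gt0 y : 0 < conformal_factor y.
Proof. by rewrite divr_gt0// exprn_gt0// ltr_wpDl// sqn_ge0. Qed.

Lemma jac_sigma i y (a : 'I_n) c :
  'J (sigma i) y a c = pd a (fun y => sigma i y 0 c) y.
Proof. by apply: jacobianE; exact: differentiable_stereo_inv. Qed.

Lemma stereo_inv_conformal i y :
  'J (sigma i) y *m ('J (sigma i) y)^T = (conformal_factor y)%:M.
Proof.
have y0 := sqn1_neq0 y.
have E (q da db ya yb yk : R) : q != 0 ->
    (2 * da / q - 4 * ya * yk / q ^+ 2) * (2 * db / q - 4 * yb * yk / q ^+ 2) =
    4 / q ^+ 2 * (da * db) - 8 / q ^+ 3 * ya * (db * yk) - 8 / q ^+ 3 * yb * (da * yk)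
    + 16 / q ^+ 4 * ya * yb * yk ^+ 2.
  by move=> q0; field.
apply/matrixP => a b; rewrite !mxE big_ord_recl.
rewrite [(_^T) _ _]mxE !jac_sigma !pd_stereo_inv_head.
under eq_bigr => k _.
  rewrite [(_^T) _ _]mxE !jac_sigma !pd_stereo_inv_tail.
  rewrite (E _ _ _ _ _ _ y0).
  over.
rewrite big_split/= !sumrB -!mulr_sumr -/(sqn y).
have dl (c : 'I_n) (f : 'I_n -> R) : \sum_k (c == k)%:R * f k = f c.
  rewrite (bigD1 c)//= eqxx mul1r big1 ?addr0// => k kc.
  by rewrite eq_sym (negbTE kc) mul0r.
have E2 (p q ya yb d : R) : q + 1 != 0 -> p ^+ 2 = 1 ->
    p * (4 * ya) / (q + 1) ^+ 2 * (p * (4 * yb) / (q + 1) ^+ 2) +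
    (4 / (q + 1) ^+ 2 * d - 8 / (q + 1) ^+ 3 * ya * yb - 8 / (q + 1) ^+ 3 * yb * ya
     + 16 / (q + 1) ^+ 4 * ya * yb * q) = 4 / (q + 1) ^+ 2 * d.
  move=> q0 p1; rewrite (_ : p * _ / _ * _ = p ^+ 2 * (16 * ya * yb / (q + 1) ^+ 4)).
    by rewrite p1; field.
  by field.
rewrite !dl /conformal_factor E2//; last exact: pole_sq.
by rewrite eq_sym mulr_natr.
Qed.

Lemma stereo_inv_normal i y : 'J (sigma i) y *m (sigma i y)^T = 0.
Proof.
apply/matrixP => a j; rewrite ord1 [RHS]mxE mxE.
have D (c : 'I_n.+1) := has_pdP (@derivable_stereo_inv i y c a).
have [_ E] := has_pd_sum (index_enum _) (fun c => has_pdM (D c) (D c)).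
have : pd a (fun z => \sum_c sigma i z 0 c * sigma i z 0 c) y = 0.
  rewrite -[RHS](pd_cst 1 y a); congr (pd a _ y); apply/funext => z.
  by rewrite -[RHS](sqn_stereo_inv i z); apply: eq_bigr => c _; rewrite expr2.
rewrite E big_split/= => E0.
have {E0} : \sum_c pd a (fun z => sigma i z 0 c) y * sigma i y 0 c = 0.
  move: E0; under [X in _ + X]eq_bigr => c _ do rewrite mulrC.
  by move/eqP; rewrite -mulr2n mulrn_eq0/= => /eqP.
move=> E0; rewrite -[RHS]E0.
by apply: eq_bigr => c _; rewrite jac_sigma [(_^T) _ _]mxE.
Qed.

(** The rows of [s] and [J] form an orthogonal frame, so that the square matrix made
    of them has a right inverse, which is then a left inverse too. *)
Lemma orthogonal_frame (J : 'M[R]_(n, 1 + n)) (s : 'rV[R]_(1 + n)) (q : R) :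
  q != 0 -> s *m s^T = 1%:M -> J *m s^T = 0 -> J *m J^T = q%:M ->
  q^-1 *: (J^T *m J) = 1%:M - s^T *m s.
Proof.
move=> q0 ss Js JJ.
have sJ : s *m J^T = 0 by rewrite -[LHS]trmxK trmx_mul trmxK Js trmx0.
pose A : 'M[R]_(1 + n) := col_mx s (q^-1 *: J).
pose B : 'M[R]_(1 + n) := row_mx s^T J^T.
have AB : A *m B = 1%:M.
  rewrite /A /B mul_col_row -!scalemxAl ss sJ Js JJ scaler0.
  by rewrite scale_scalar_mx mulVf// -scalar_mx_block.
have := mulmx1C AB; rewrite /A /B mul_row_col -scalemxAr => <-.
by rewrite addrC addKr.
Qed.

(** Both sides are the orthogonal projection onto the tangent space. *)
Lemma stereo_inv_projection i y :
  (conformal_factor y)^-1 *: (('J (sigma i) y)^T *m 'J (sigma i) y)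
  = 1%:M - (sigma i y)^T *m sigma i y.
Proof.
apply: orthogonal_frame.
- by rewrite gt_eqF// conformal_factor_gt0.
- by apply/matrixP => a b; rewrite !ord1 -sqnE sqn_stereo_inv mxE eqxx.
- exact: stereo_inv_normal.
- exact: stereo_inv_conformal.
Qed.

End Stereographic.

(** * The sphere, and functions that are constant on rays *)

Section SphereCharts.
Variables (R : realType) (n : nat).
Implicit Types (y : 'rV[R]_n) (x : 'rV[R]_n.+1) (i : 'I_2).
Local Notation sigma i := (@stereo_inv R n (pole R i)).
Local Notation S := (sphere R n).

Lemma sqn_head_tail x : sqn x = x 0 0 ^+ 2 + \sum_k x 0 (lift ord0 k) ^+ 2.
Proof. by rewrite /sqn big_ord_recl. Qed.

Lemma stereo_coord (s : R) x (k : 'I_n) :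
  stereo s x 0 k = (1 - s * x 0 0)^-1 * x 0 (lift ord0 k).
Proof. by rewrite /stereo !mxE. Qed.

Lemma pole_neq i x : x 0 0 != pole R i -> 1 - pole R i * x 0 0 != 0.
Proof.
apply: contraNneq => H; apply/eqP.
have : pole R i * (1 - pole R i * x 0 0) = 0 by rewrite H mulr0.
by rewrite mulrBr mulrA -expr2 pole_sq mul1r mulr1 => /eqP; rewrite subr_eq0 eq_sym => /eqP.
Qed.

Lemma stereoK i x : sqn x = 1 -> x 0 0 != pole R i ->
  sigma i (stereo (pole R i) x) = x.
Proof.
move=> x1 /pole_neq w0; set w := 1 - _ in w0.
have p2 := pole_sq R i.
have r : sqn (stereo (pole R i) x) = (1 + pole R i * x 0 0) / w.
  rewrite /sqn; under eq_bigr => k _ do rewrite stereo_coord exprMn.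
  rewrite -mulr_sumr -/w.
  have -> : \sum_(k < n) x 0 (lift ord0 k) ^+ 2 = w * (1 + pole R i * x 0 0).
    transitivity (1 - pole R i ^+ 2 * x 0 0 ^+ 2); last by rewrite /w; ring.
    by rewrite p2 mul1r -x1 sqn_head_tail addrAC subrr add0r.
  by field.
have r1 : sqn (stereo (pole R i) x) + 1 = 2 / w by rewrite r /w; field.
have r2 : sqn (stereo (pole R i) x) - 1 = 2 * (pole R i * x 0 0) / w.
  by rewrite r /w; field.
apply/rowP => c; case: (unliftP 0 c) => [k|] ->.
  by rewrite stereo_inv_tail r1 stereo_coord -/w; field.
rewrite stereo_inv_head r1 r2.
transitivity (pole R i ^+ 2 * x 0 0); first by field.
by rewrite p2 mul1r.
Qed.

Lemma stereo_inv_not_pole i y : sigma i y 0 0 != pole R i.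
Proof.
rewrite stereo_inv_head; apply/eqP => /eqP.
have y0 := sqn1_neq0 y.
rewrite -subr_eq0 (_ : _ - _ = - (2 * pole R i) / (sqn y + 1)); last by field.
rewrite mulf_eq0 oppr_eq0 mulf_eq0 pnatr_eq0/= invr_eq0 (negbTE y0) orbF.
by rewrite /pole signr_eq0.
Qed.

Lemma stereo_invK i y : stereo (pole R i) (sigma i y) = y.
Proof.
have y0 := sqn1_neq0 y; have p2 := pole_sq R i.
have w : 1 - pole R i * sigma i y 0 0 = 2 / (sqn y + 1).
  rewrite stereo_inv_head (_ : pole R i * _ = pole R i ^+ 2 * ((sqn y - 1) / (sqn y + 1))).
    by rewrite p2; field.
  by ring.
apply/rowP => k; rewrite stereo_coord w stereo_inv_tail; field.
exact: y0.
Qed.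

Lemma set_val_param i y : set_val (param S i y) = sigma i y.
Proof. by []. Qed.

Lemma dom_param i y : dom S i (param S i y).
Proof. exact: stereo_inv_not_pole. Qed.

Lemma chart_param i y : chart S i (param S i y) = y.
Proof. exact: stereo_invK. Qed.

Lemma target_sphere i y : target S i y.
Proof. by exists (param S i y); [exact: dom_param|exact: chart_param]. Qed.

Lemma sphere_ext (p q : S) : set_val p = set_val q -> p = q.
Proof. by move=> pq; apply: val_inj; move: pq; rewrite set_valE. Qed.

Lemma sqn_sphere (p : S) : sqn (set_val p) = 1.
Proof. by have := set_valP p. Qed.

Lemma param_chart i (p : S) : dom S i p -> param S i (chart S i p) = p.
Proof. by move=> dp; apply: sphere_ext; apply: stereoK => //; exact: sqn_sphere. Qed.

Lemma continuous_to_sphere (T : topologicalType) (f : T -> S) t :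
  {for t, continuous (fun z => set_val (f z) : 'rV[R]_n.+1)} -> {for t, continuous f}.
Proof.
move=> cf U [?/= [[W oW <-]]] /= Wsfz /filterS; apply; apply: cf.
exact: open_nbhs_nbhs.
Qed.

Lemma continuous_param i : continuous (param S i).
Proof.
move=> y; apply: continuous_to_sphere.
exact/differentiable_continuous/differentiable_stereo_inv.
Qed.

Lemma open_preimage (T U : topologicalType) (f : T -> U) (A : set T) (B : set U) :
  open A -> open B -> (forall t, A t -> {for t, continuous f}) ->
  open [set t | A t /\ B (f t)].
Proof.
move=> oA oB cf; rewrite openE => t [At Bt].
have NA : nbhs t A by exact: open_nbhs_nbhs.
have NB : nbhs t (f @^-1` B) by apply: (cf t At); exact: open_nbhs_nbhs.
exact: filterI NA NB.
Qed.

Definition nonzero : set 'rV[R]_n.+1 := [set x | x != 0].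

Lemma open_nonzero : open nonzero.
Proof.
rewrite (_ : nonzero = [set x | setT x /\ [set r : R | 0 < r] (sqn x)]).
  apply: open_preimage; [exact: openT|exact: open_gt|].
  by move=> x _; apply: (Ck_continuous (Ck_sqn 0 openT)).
apply/seteqP; split => x /=; first by move=> x0; split => //; exact: sqn_gt0.
by move=> [_]; apply: contraTneq => ->; rewrite (eqP (_ : sqn _ == 0)) ?sqn_eq0// ltxx.
Qed.

Definition normalize x : 'rV[R]_n.+1 := (Num.sqrt (sqn x))^-1 *: x.

Lemma sqn_normalize x : x != 0 -> sqn (normalize x) = 1.
Proof.
by move=> /sqn_gt0 x0; rewrite sqnZ exprVn sqr_sqrtr ?ltW// mulVf// gt_eqF.
Qed.

Lemma normalize1 x : sqn x = 1 -> normalize x = x.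
Proof. by move=> x1; rewrite /normalize x1 sqrtr1 invr1 scale1r. Qed.

Lemma normalizeZ c x : 0 < c -> normalize (c *: x) = normalize x.
Proof.
move=> c0; rewrite /normalize sqnZ sqrtrM ?sqr_ge0// sqrtr_sqr gtr0_norm// scalerA.
by rewrite invfM mulrAC mulVf ?mul1r// gt_eqF.
Qed.

Lemma Ck_inv_norm k : Ck k nonzero (fun x => (Num.sqrt (sqn x))^-1).
Proof.
have oU := open_nonzero.
apply: Ck_inv => //.
  by move=> x x0; rewrite gt_eqF// sqrtr_gt0 sqn_gt0.
by apply: Ck_sqrt => // [x|]; [exact: sqn_gt0|exact: Ck_sqn].
Qed.

Lemma Ck_normalize k c : Ck k nonzero (fun x => normalize x 0 c).
Proof.
have oU := open_nonzero.
rewrite (_ : (fun _ => _) = fun x => (Num.sqrt (sqn x))^-1 * x 0 c).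
  by apply: Ck_mul => //; [exact: Ck_inv_norm|exact: Ck_coord].
by apply/funext => x; rewrite mxE.
Qed.

(** The value at [0], which spans no ray, is irrelevant. *)
Definition radial x : S :=
  if pselect (normalize x \in sphere_set R n) is left h then exist _ (normalize x) h
  else param S ord0 0.

Lemma set_val_radial x : x != 0 -> set_val (radial x) = normalize x.
Proof.
move=> x0; rewrite /radial; case: pselect => //; case.
by rewrite inE; exact: sqn_normalize.
Qed.

Lemma radial_set_val (p : S) : radial (set_val p) = p.
Proof.
have p0 : set_val p != 0 :> 'rV[R]_n.+1.
  by apply/eqP => E; have := sqn_sphere p; rewrite E (eqP (_ : sqn _ == 0)) ?sqn_eq0// => /esym/eqP; rewrite oner_eq0.
by apply: sphere_ext; rewrite set_val_radial// normalize1// sqn_sphere.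
Qed.

Lemma radial_sigma i y : radial (sigma i y) = param S i y.
Proof. by rewrite -(set_val_param i y) radial_set_val. Qed.

Lemma radialZ c x : 0 < c -> radial (c *: x) = radial x.
Proof.
move=> c0; have [->|x0] := eqVneq x 0; first by rewrite scaler0.
apply: sphere_ext; rewrite !set_val_radial ?normalizeZ//.
by rewrite scaler_eq0 negb_or x0 gt_eqF.
Qed.

Lemma continuous_radial x : x != 0 -> {for x, continuous radial}.
Proof.
move=> x0; apply: continuous_to_sphere; apply: continuous_row => c.
apply: (@near_eq_continuous _ _ (fun x => normalize x 0 c)); last first.
  exact: Ck_continuous (Ck_normalize 0 c) x0.
by apply: near_open_eq open_nonzero _ x0 => z z0; rewrite set_val_radial.
Qed.

(** A chart of the sphere, extended to the ambient space so as to be constant on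
    rays. *)
Definition ray_chart i x : 'rV[R]_n := stereo (pole R i) (normalize x).

Definition ray_dom i : set 'rV[R]_n.+1 :=
  [set x | nonzero x /\ [set r : R | r != pole R i] (normalize x 0 0)].

Lemma open_ray_dom i : open (ray_dom i).
Proof.
apply: open_preimage; first exact: open_nonzero.
  exact: open_neq.
by move=> x x0; exact: (Ck_continuous (Ck_normalize 0 0)).
Qed.

Lemma Ck_ray_chart k i (c : 'I_n) : Ck k (ray_dom i) (fun x => ray_chart i x 0 c).
Proof.
have oU := @open_ray_dom i.
have sub : ray_dom i `<=` nonzero by move=> x [].
rewrite (_ : (fun _ => _) =
  fun x => (1 - pole R i * normalize x 0 0)^-1 * normalize x 0 (lift ord0 c)).
  apply: Ck_mul => //; last exact: Ck_sub sub (Ck_normalize _ _).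
  apply: Ck_inv => // [x [_ x0]|]; first exact: pole_neq.
  apply: Ck_sub_fun => //; first exact: Ck_cst.
  by apply: Ck_scale => //; exact: Ck_sub sub (Ck_normalize _ _).
by apply/funext => x; rewrite stereo_coord.
Qed.

Lemma param_ray_chart i x : ray_dom i x -> param S i (ray_chart i x) = radial x.
Proof.
move=> [x0 xp]; rewrite -[RHS](@param_chart i).
  by rewrite /= set_val_radial.
by rewrite /= set_val_radial.
Qed.

Lemma sigma_ray_chart i x : ray_dom i x -> sigma i (ray_chart i x) = normalize x.
Proof. by move=> [x0 xp]; apply: stereoK => //; exact: sqn_normalize. Qed.

Lemma ray_dom_cover x : x != 0 -> exists i, ray_dom i x.
Proof.
move=> x0; have [E|E] := eqVneq (normalize x 0 0) 1.
  exists (lift ord0 ord0); split => //=; rewrite E /pole expr1.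
  by rewrite gt_eqF// (lt_trans _ ltr01)// ltrN10.
by exists ord0; split => //=; rewrite /pole expr0.
Qed.

Lemma ray_dom_sigma i y : ray_dom i (sigma i y).
Proof.
have s1 := sqn_stereo_inv i y; split; last first.
  by rewrite /= normalize1//; exact: stereo_inv_not_pole.
by rewrite /nonzero /= -sqn_eq0 s1 oner_eq0.
Qed.

(** Locally [radial] is a parametrization of the sphere after the smooth map
    [ray_chart i]. *)
Lemma Ck_radial k (B : set S) (g : S -> R) : open B ->
  (forall i, Ck k [set y | setT y /\ B (param S i y)] (fun y => g (param S i y))) ->
  Ck k [set x | nonzero x /\ B (radial x)] (fun x => g (radial x)).
Proof.
move=> oB Cg; apply: Ck_local => x [x0 Bx].
have [i xi] := ray_dom_cover x0.
have oV : open [set x | ray_dom i x /\ B (radial x)].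
  apply: open_preimage => // [|z [z0 _]]; first exact: open_ray_dom.
  exact: continuous_radial.
exists [set x | ray_dom i x /\ B (radial x)]; first by [].
have oW : open [set y | setT y /\ B (param S i y)].
  apply: open_preimage => //; first exact: openT.
  by move=> y _; exact: continuous_param.
have H : Ck k [set x | ray_dom i x /\ B (radial x)] (fun x => g (param S i (ray_chart i x))).
  apply: Ck_comp oV oW (Cg i) _ _ => [c|z [zi Bz]].
    by apply: Ck_sub (Ck_ray_chart k i c) => z [].
  by split => //; rewrite param_ray_chart.
by apply: Ck_ext H => // z [zi _]; rewrite param_ray_chart.
Qed.

End SphereCharts.

(** * Berger metrics and their Laplacian *)

#[local] Opaque pd jacobian diff derive stereo_inv.

Lemma trmx_scale (R : pzRingType) (m n : nat) (k : R) (A : 'M[R]_(m, n)) :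
  (k *: A)^T = k *: A^T.
Proof. by apply/matrixP => i j; rewrite !mxE. Qed.

Section Berger.
Variables (R : realType) (n : nat) (J : 'M[R]_n.+1).
Hypotheses (JT : J^T = - J) (JJ : J *m J = - 1%:M).
Variables (a b : R).
Hypotheses (a0 : 0 < a) (b0 : 0 < b).
Implicit Types (y : 'rV[R]_n) (x : 'rV[R]_n.+1) (i : 'I_2).
Local Notation sigma i := (@stereo_inv R n (pole R i)).
Local Notation S := (sphere R n).
Local Notation D i y := ('J (sigma i) y).
Local Notation q := (@conformal_factor R n).

(** The one-form dual, for the round metric, to the unit field [x |-> x *m J] along the
    Hopf fibres. *)
Definition hopf_form i y : 'rV[R]_n := sigma i y *m J *m (D i y)^T.

(** The round metric divided by [a] orthogonally to the Hopf fibres and by [b] along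
    them. *)
Definition berger : tensor2 S := fun i y =>
  a^-1 *: (D i y *m (D i y)^T) + (b^-1 - a^-1) *: ((hopf_form i y)^T *m hopf_form i y).

Definition berger_inv i y : 'M[R]_n :=
  (a / q y)%:M + ((b - a) / q y ^+ 2) *: ((hopf_form i y)^T *m hopf_form i y).

Lemma skew_quad x : x *m J *m x^T = 0.
Proof.
apply/matrixP => i j; rewrite !ord1 [RHS]mxE; set A := x *m J *m x^T.
have : A^T = - A by rewrite /A !trmx_mul trmxK JT mulmxA mulmxN mulNmx.
move/(congr1 (fun B : 'M[R]_1 => B 0 0)); rewrite !mxE => /eqP.
by rewrite -addr_eq0 -mulr2n mulrn_eq0/= => /eqP.
Qed.

Lemma q_neq0 y : q y != 0. Proof. by rewrite gt_eqF// conformal_factor_gt0. Qed.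

(** [x *m J] is orthogonal to [x], hence fixed by the projection
    [stereo_inv_projection] onto the tangent space. *)
Lemma hopf_form_lift i y : (q y)^-1 *: (hopf_form i y *m D i y) = sigma i y *m J.
Proof.
rewrite /hopf_form -mulmxA scalemxAr stereo_inv_projection mulmxBr mulmx1.
by rewrite mulmxA skew_quad mul0mx subr0.
Qed.

Lemma hopf_form_sqn i y : hopf_form i y *m (hopf_form i y)^T = (q y)%:M.
Proof.
have JJT : J *m J^T = 1%:M by rewrite JT mulmxN JJ opprK.
rewrite {2}/hopf_form !trmx_mul trmxK !mulmxA.
have -> : hopf_form i y *m D i y = q y *: (sigma i y *m J).
  by rewrite -hopf_form_lift scalerA mulfV ?q_neq0// scale1r.
rewrite -2!scalemxAl -(mulmxA _ J J^T) JJT mulmx1.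
apply/matrixP => u v; rewrite !ord1 mxE -sqnE sqn_stereo_inv mxE eqxx.
by rewrite mulr1.
Qed.

Lemma hopf_form_proj i y : (hopf_form i y)^T *m hopf_form i y *m ((hopf_form i y)^T *m hopf_form i y)
  = q y *: ((hopf_form i y)^T *m hopf_form i y).
Proof.
rewrite -mulmxA [hopf_form i y *m (_ *m _)]mulmxA hopf_form_sqn.
by rewrite mul_scalar_mx -scalemxAr.
Qed.

Lemma bergerE i y : berger i y =
  (q y / a)%:M + (b^-1 - a^-1) *: ((hopf_form i y)^T *m hopf_form i y).
Proof. by rewrite /berger stereo_inv_conformal scale_scalar_mx mulrC. Qed.

Lemma berger_mulV i y : berger i y *m berger_inv i y = 1%:M.
Proof.
have qn := q_neq0 y; have an : a != 0 by rewrite gt_eqF.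
have bn : b != 0 by rewrite gt_eqF.
rewrite bergerE /berger_inv mulmxDl !mulmxDr -!scalar_mxM.
rewrite -!scalemxAr -!scalemxAl mul_mx_scalar mul_scalar_mx hopf_form_proj.
rewrite !scalerA -[X in X + _]addr0 -!addrA.
rewrite (_ : q y / a * (a / q y) = 1); last by field; rewrite qn an.
rewrite add0r -!scalerDl [X in _ + X *: _](_ : _ = 0) ?scale0r ?addr0//.
by field; rewrite qn an bn.
Qed.

Lemma berger_unit i y : berger i y \in unitmx.
Proof. by have [] := mulmx1_unit (berger_mulV i y). Qed.

Lemma invmx_berger i y : invmx (berger i y) = berger_inv i y.
Proof.
by rewrite -[LHS]mulmx1 -(berger_mulV i y) mulKmx// berger_unit.
Qed.

Lemma berger_sym i y : (berger i y)^T = berger i y.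
Proof.
by rewrite /berger linearD /= !linearZ /= !trmx_mul !trmxK.
Qed.

Lemma berger_inv_sym i y : (berger_inv i y)^T = berger_inv i y.
Proof.
by rewrite /berger_inv linearD /= tr_scalar_mx linearZ /= trmx_mul trmxK.
Qed.

Lemma hopf_berger_inv i y : hopf_form i y *m berger_inv i y = (b / q y) *: hopf_form i y.
Proof.
have qn := q_neq0 y.
rewrite /berger_inv mulmxDr mul_mx_scalar -scalemxAr mulmxA hopf_form_sqn.
rewrite mul_scalar_mx scalerA -scalerDl; congr (_ *: _); field.
exact: qn.
Qed.

Lemma tr_berger_inv i y : q y * \tr (berger_inv i y) = a * n%:R + (b - a).
Proof.
have qn := q_neq0 y.
rewrite /berger_inv mxtraceD mxtrace_scalar mxtraceZ mxtrace_mulC hopf_form_sqn.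
rewrite mxtrace_scalar mulr1n -mulr_natr; field.
exact: qn.
Qed.

(** The inverse metric pushed forward to the unit sphere of the ambient space
    ([berger_inv_push]), extended to be homogeneous of degree [2]. *)
Definition principal_symbol x : 'M[R]_n.+1 :=
  a *: ((sqn x)%:M - x^T *m x) + (b - a) *: ((x *m J)^T *m (x *m J)).

Lemma berger_inv_push i y :
  (D i y)^T *m berger_inv i y *m D i y = principal_symbol (sigma i y).
Proof.
have qn := q_neq0 y.
rewrite /principal_symbol sqn_stereo_inv -stereo_inv_projection -hopf_form_lift.
rewrite /berger_inv; move: (hopf_form i y) ('J _ y) (q y) qn => w B p pn.
rewrite mulmxDr mulmxDl mul_mx_scalar -scalemxAl scalerA; congr (_ + _).
have -> : (p^-1 *: (w *m B))^T = p^-1 *: (B^T *m w^T).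
  by rewrite -trmx_mul; apply/matrixP => u v; rewrite !mxE.
rewrite -!scalemxAr -!scalemxAl -?scalemxAr !scalerA.
rewrite !mulmxA; congr (_ *: _).
by rewrite expr2 invfM mulrA.
Qed.

Lemma Ck_jac_sigma k i c e : Ck k setT (fun y => D i y c e).
Proof.
rewrite (_ : (fun _ => _) = pd c (fun y => sigma i y 0 e)).
  exact/Ck_pd/Ck_stereo_inv.
by apply/funext => y; rewrite jac_sigma.
Qed.

Lemma hopf_form_coord i y c :
  hopf_form i y 0 c = \sum_e (\sum_d sigma i y 0 d * J d e) * D i y c e.
Proof.
rewrite /hopf_form mxE; apply: eq_bigr => e _.
by rewrite [(_^T) _ _]mxE mxE.
Qed.

Lemma berger_coord i y c d : berger i y c d =
  a^-1 * (\sum_e D i y c e * D i y d e) +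
  (b^-1 - a^-1) * (hopf_form i y 0 c * hopf_form i y 0 d).
Proof.
rewrite /berger mxE; congr (_ + _); rewrite mxE; congr (_ * _).
  by rewrite mxE; apply: eq_bigr => e _; rewrite [(_^T) _ _]mxE.
by rewrite mxE big_ord1 [(_^T) _ _]mxE.
Qed.

Lemma Ck_hopf_form k i c : Ck k setT (fun y => hopf_form i y 0 c).
Proof.
have oT := @openT 'rV[R]_n.
rewrite (_ : (fun _ => _) = fun y => \sum_e (\sum_d sigma i y 0 d * J d e) * D i y c e).
  apply: Ck_sum => // e; apply: Ck_mul => //; last exact: Ck_jac_sigma.
  apply: Ck_sum => // d; apply: Ck_mul => //; last exact: Ck_cst.
  exact: Ck_stereo_inv.
by apply/funext => y; rewrite hopf_form_coord.
Qed.

Lemma Ck_berger k i c d : Ck k setT (fun y => berger i y c d).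
Proof.
have oT := @openT 'rV[R]_n.
rewrite (_ : (fun _ => _) = fun y => a^-1 * (\sum_e D i y c e * D i y d e) +
  (b^-1 - a^-1) * (hopf_form i y 0 c * hopf_form i y 0 d)).
  apply: Ck_add => //; apply: Ck_scale => //; last by apply: Ck_mul => //; exact: Ck_hopf_form.
  by apply: Ck_sum => // e; apply: Ck_mul => //; exact: Ck_jac_sigma.
by apply/funext => y; rewrite berger_coord.
Qed.

Definition hess_sigma i y c d : 'rV[R]_n.+1 :=
  \row_e pd c (fun z => D i z d e) y.

Lemma hess_sigmaC i y c d : hess_sigma i y c d = hess_sigma i y d c.
Proof.
apply/rowP => e; rewrite !mxE.
have E c' : (fun z => D i z c' e) = pd c' (fun z => sigma i z 0 e).
  by apply/funext => z; rewrite jac_sigma.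
rewrite !E; exact: (@pd_comm R n setT _ y c d openT (@Ck_stereo_inv R n 2 i e) I).
Qed.

Lemma has_pd_jac i y c d e : has_pd (fun z => D i z d e) y c (hess_sigma i y c d 0 e).
Proof.
split; last by rewrite mxE.
by have := @Ck_derivable R n 0 setT _ y c (Ck_jac_sigma 1 i d e); exact.
Qed.

Definition hopf_rot i y : 'M[R]_n := D i y *m J *m (D i y)^T.

Definition hopf_bend i y c d : R := (sigma i y *m J *m (hess_sigma i y c d)^T) 0 0.

Lemma hopf_rot_skew i y c d : hopf_rot i y c d = - hopf_rot i y d c.
Proof.
have : (hopf_rot i y)^T = - hopf_rot i y.
  by rewrite /hopf_rot !trmx_mul trmxK JT mulmxA mulmxN mulNmx.
by move/(congr1 (fun B : 'M[R]_n => B d c)); rewrite !mxE.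
Qed.

Lemma has_pd_hopf_form i y c d :
  has_pd (fun z => hopf_form i z 0 d) y c (hopf_rot i y c d + hopf_bend i y c d).
Proof.
have E : (fun z => hopf_form i z 0 d) =
    fun z => \sum_e (\sum_f J f e * sigma i z 0 f) * D i z d e.
  apply/funext => z; rewrite hopf_form_coord; apply: eq_bigr => e _.
  by congr (_ * _); apply: eq_bigr => f _; rewrite mulrC.
have H := has_pd_sum (index_enum _) (fun e => has_pdM (has_pd_sum (index_enum _)
  (fun f => has_pdZ (J f e) (has_pdP (@derivable_stereo_inv _ _ i y f c))))
  (has_pd_jac i y c d e)).
rewrite E; apply: has_pd_eq H _; rewrite big_split/=; congr (_ + _).
  rewrite /hopf_rot mxE; apply: eq_bigr => e _; rewrite [(_^T) _ _]mxE; congr (_ * _).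
  by rewrite mxE; apply: eq_bigr => f _; rewrite jac_sigma mulrC.
rewrite /hopf_bend mxE; apply: eq_bigr => e _; rewrite [(_^T) _ _]mxE; congr (_ * _).
by rewrite mxE; apply: eq_bigr => f _; rewrite mulrC.
Qed.

Lemma has_pd_berger i y k c d :
  has_pd (fun z => berger i z c d) y k
    (a^-1 * ((hess_sigma i y k c *m (D i y)^T) 0 d + (hess_sigma i y k d *m (D i y)^T) 0 c) +
     (b^-1 - a^-1) *
      ((hopf_rot i y k c + hopf_bend i y k c) * hopf_form i y 0 d +
       hopf_form i y 0 c * (hopf_rot i y k d + hopf_bend i y k d))).
Proof.
have E : (fun z => berger i z c d) = fun z => a^-1 * (\sum_e D i z c e * D i z d e) +
  (b^-1 - a^-1) * (hopf_form i z 0 c * hopf_form i z 0 d).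
  by apply/funext => z; rewrite berger_coord.
have H := has_pdD (has_pdZ a^-1 (has_pd_sum (index_enum _) (fun e =>
    has_pdM (has_pd_jac i y k c e) (has_pd_jac i y k d e))))
  (has_pdZ (b^-1 - a^-1) (has_pdM (has_pd_hopf_form i y k c) (has_pd_hopf_form i y k d))).
rewrite E; apply: has_pd_eq H _; congr (_ * _ + _).
rewrite big_split/= !mxE; congr (_ + _); apply: eq_bigr => e _.
  by rewrite [(_^T) _ _]mxE.
by rewrite [(_^T) _ _]mxE mulrC.
Qed.

(** The left side is the Christoffel symbol with its upper index lowered.  The
    derivatives of the Hopf form enter through a skew part [hopf_rot] and a symmetric
    part [hopf_bend], whence the cancellations. *)
Lemma berger_christoffel_low i y l c d :
  2^-1 * (pd c (fun z => berger i z l d) y + pd d (fun z => berger i z c l) y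
          - pd l (fun z => berger i z c d) y) =
  a^-1 * (hess_sigma i y c d *m (D i y)^T) 0 l +
  (b^-1 - a^-1) * (hopf_form i y 0 d * hopf_rot i y c l +
     hopf_form i y 0 c * hopf_rot i y d l + hopf_form i y 0 l * hopf_bend i y c d).
Proof.
have [_ ->] := has_pd_berger i y c l d.
have [_ ->] := has_pd_berger i y d c l.
have [_ ->] := has_pd_berger i y l c d.
have bC k m : hopf_bend i y k m = hopf_bend i y m k.
  by rewrite /hopf_bend hess_sigmaC.
rewrite (hopf_rot_skew i y l c) (hopf_rot_skew i y l d) (hopf_rot_skew i y d c).
rewrite (bC l c) (bC l d) (bC d c).
rewrite (hess_sigmaC i y l c) (hess_sigmaC i y l d) (hess_sigmaC i y d c).
have E (al be x1 x2 x3 r1 r2 r3 h1 h2 h3 wc wd wl : R) :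
  2^-1 * (al * (x1 + x2) + be * ((r1 + h1) * wd + wl * (r3 + h3)) +
    (al * (x2 + x3) + be * ((- r3 + h3) * wl + wc * (r2 + h2))) -
    (al * (x1 + x3) + be * ((- r1 + h1) * wd + wc * (- r2 + h2)))) =
  al * x2 + be * (wd * r1 + wc * r2 + wl * h3) by field.
exact: E.
Qed.

(** Contracting the second derivatives of the parametrization with the inverse metric
    gives its rough Laplacian: the tangential part of this vector is accounted for by
    the Christoffel symbols, its normal part is the first-order term of the operator. *)
Definition hess_trace i y : 'rV[R]_n.+1 :=
  \sum_c \sum_d berger_inv i y c d *: hess_sigma i y c d.

Lemma mulmx_hess_trace i y p (M : 'M[R]_(n.+1, p)) j :
  (hess_trace i y *m M) 0 j =
  \sum_c \sum_d berger_inv i y c d * (hess_sigma i y c d *m M) 0 j.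
Proof.
rewrite /hess_trace mulmx_suml summxE; apply: eq_bigr => c _.
rewrite mulmx_suml summxE; apply: eq_bigr => d _.
by rewrite -scalemxAl mxE.
Qed.

Lemma sigma_jacT i y : sigma i y *m (D i y)^T = 0.
Proof. by rewrite -[LHS]trmxK trmx_mul trmxK stereo_inv_normal trmx0. Qed.

Lemma hopf_form_jac i y : hopf_form i y *m D i y = q y *: (sigma i y *m J).
Proof. by rewrite -hopf_form_lift scalerA mulfV ?q_neq0// scale1r. Qed.

Lemma hopf_form_rot i y : hopf_form i y *m hopf_rot i y = 0.
Proof.
rewrite /hopf_rot !mulmxA hopf_form_jac -2!scalemxAl -(mulmxA _ J J) JJ.
by rewrite mulmxN mulmx1 mulNmx sigma_jacT oppr0 scaler0.
Qed.

Lemma sum_sym_form (G B : 'M[R]_n) (w : 'rV[R]_n) l : G^T = G ->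
  \sum_c \sum_d G c d * (w 0 d * B c l) = (w *m G *m B) 0 l.
Proof.
move=> GT; rewrite mxE; apply: eq_bigr => c _; rewrite mxE mulr_suml.
by apply: eq_bigr => d _; rewrite -[in LHS]GT mxE; ring.
Qed.

Lemma sum_push (G : 'M[R]_n) (B : 'M[R]_(n, n.+1)) (P : 'I_n.+1 -> 'I_n.+1 -> R) :
  \sum_c \sum_d G c d * (\sum_e (\sum_f P f e * B c f) * B d e) =
  \sum_f \sum_e (B^T *m G *m B) f e * P f e.
Proof.
transitivity (\sum_c \sum_d \sum_f \sum_e B c f * G c d * B d e * P f e).
  apply: eq_bigr => c _; apply: eq_bigr => d _; rewrite mulr_sumr exchange_big/=.
  apply: eq_bigr => e _; rewrite mulr_suml mulr_sumr; apply: eq_bigr => f _.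
  by ring.
under eq_bigr => c _ do rewrite exchange_big/=.
rewrite exchange_big/=; apply: eq_bigr => f _.
under eq_bigr => c _ do rewrite exchange_big/=.
rewrite exchange_big/=; apply: eq_bigr => e _.
rewrite mxE mulr_suml exchange_big/=; apply: eq_bigr => d _.
rewrite mxE !mulr_suml; apply: eq_bigr => c _.
by rewrite mxE.
Qed.

Lemma hess_trace_bend i y : \sum_c \sum_d berger_inv i y c d * hopf_bend i y c d =
  (hess_trace i y *m (sigma i y *m J)^T) 0 0.
Proof.
rewrite mulmx_hess_trace; apply: eq_bigr => c _; apply: eq_bigr => d _.
congr (_ * _); rewrite /hopf_bend !mxE; apply: eq_bigr => e _.
by rewrite [(hess_sigma i y c d)^T e 0]mxE [(sigma i y *m J)^T e 0]mxE mulrC.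
Qed.

(** The terms containing [hopf_rot] drop out because it annihilates the Hopf form.  What
    remains is the tangential part of [hess_trace], lowered with the metric. *)
Lemma berger_christoffel_trace i y k :
  \sum_c \sum_d berger_inv i y c d * christoffel (berger i) k c d y
  = (q y)^-1 * (hess_trace i y *m (D i y)^T) 0 k.
Proof.
have qn := q_neq0 y.
have GT : (berger_inv i y)^T = berger_inv i y := berger_inv_sym i y.
have GC c d : berger_inv i y c d = berger_inv i y d c by rewrite -[in LHS]GT [LHS]mxE.
pose low l c d := a^-1 * (hess_sigma i y c d *m (D i y)^T) 0 l +
  (b^-1 - a^-1) * (hopf_form i y 0 d * hopf_rot i y c l +
     hopf_form i y 0 c * hopf_rot i y d l + hopf_form i y 0 l * hopf_bend i y c d).
have chr c d : christoffel (berger i) k c d y = \sum_l berger_inv i y k l * low l c d.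
  rewrite /christoffel invmx_berger mulr_sumr; apply: eq_bigr => l _.
  by rewrite /low -berger_christoffel_low mulrCA.
pose V : 'rV[R]_n := (q y)^-1 *: (hess_trace i y *m (D i y)^T *m berger i y).
have wGr l : \sum_c \sum_d berger_inv i y c d * (hopf_form i y 0 d * hopf_rot i y c l) = 0.
  rewrite sum_sym_form// hopf_berger_inv -scalemxAl hopf_form_rot scaler0.
  by rewrite mxE.
have wGr' l : \sum_c \sum_d berger_inv i y c d * (hopf_form i y 0 c * hopf_rot i y d l) = 0.
  rewrite exchange_big/= -[RHS](wGr l); apply: eq_bigr => c _.
  by apply: eq_bigr => d _; rewrite GC.
have splitE (G al m be x1 x2 wl h : R) :
    G * (al * m + be * (x1 + x2 + wl * h)) = al * (G * m) + be * (G * x1 + G * x2 + wl * (G * h)).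
  by ring.
have lowE l : \sum_c \sum_d berger_inv i y c d * low l c d = V 0 l.
  rewrite /low.
  under eq_bigr => c _.
    under eq_bigr => d _ do rewrite splitE.
    rewrite big_split/= -mulr_sumr -mulr_sumr !big_split/= -!mulr_sumr; over.
  rewrite big_split/= -mulr_sumr -mulr_sumr !big_split/= -!mulr_sumr.
  rewrite wGr wGr' !add0r -mulmx_hess_trace hess_trace_bend.
  rewrite /V bergerE mulmxDr mul_mx_scalar -scalemxAr mulmxA scalerDr !scalerA.
  have -> : hess_trace i y *m (D i y)^T *m (hopf_form i y)^T =
      q y *: (hess_trace i y *m (sigma i y *m J)^T).
    by rewrite -mulmxA -trmx_mul hopf_form_jac trmx_scale -scalemxAr.
  have coordE (u v p : R) (A w : 'rV[R]_n) (M : 'M[R]_1) :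
      (u *: A + v *: (p *: M *m w)) 0 l = u * A 0 l + v * (p * (M 0 0 * w 0 l)).
    by rewrite -scalemxAl !mxE big_ord1.
  rewrite coordE.
  move: (hopf_form i y 0 l) (_ 0 0) (_ 0 l) (q y) qn => w M M' p pn.
  by field; rewrite pn !gt_eqF.
under eq_bigr => c _ do under eq_bigr => d _ do rewrite chr mulr_sumr.
transitivity (\sum_l berger_inv i y k l * V 0 l).
  under eq_bigr => c _ do rewrite exchange_big/=.
  rewrite exchange_big/=; apply: eq_bigr => l _.
  rewrite -lowE mulr_sumr; apply: eq_bigr => c _.
  by rewrite mulr_sumr; apply: eq_bigr => d _; rewrite mulrCA.
transitivity ((V *m berger_inv i y) 0 k).
  by rewrite [RHS]mxE; apply: eq_bigr => l _; rewrite mulrC GC.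
by rewrite /V -scalemxAl -mulmxA berger_mulV mulmx1 mxE.
Qed.

Lemma laplacianE (g : 'rV[R]_n -> 'M[R]_n) f y : laplacian g f y =
  \sum_c \sum_d invmx (g y) c d *
    (pd c (pd d f) y - \sum_k christoffel g k c d y * pd k f y).
Proof.
apply: eq_bigr => c _; apply: eq_bigr => d _; congr (_ * _).
rewrite /covariant_derivative; congr (_ - _).
  by congr (pd c _ y); apply/funext => z; rewrite mxE.
by apply: eq_bigr => k _; rewrite mxE.
Qed.

(** Differentiating the orthogonality of [sigma] and its derivatives shows that the
    normal part of the second derivatives is minus the round metric. *)
Lemma hess_trace_normal i y :
  (hess_trace i y *m (sigma i y)^T) 0 0 = - (a * n%:R + (b - a)).
Proof.
rewrite mulmx_hess_trace -(tr_berger_inv i y).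
have H c d : (hess_sigma i y c d *m (sigma i y)^T) 0 0 = - (D i y *m (D i y)^T) d c.
  have [_ E] := has_pd_sum (index_enum _) (fun e =>
    has_pdM (has_pd_jac i y c d e) (has_pdP (@derivable_stereo_inv _ _ i y e c))).
  have : pd c (fun z => \sum_e D i z d e * sigma i z 0 e) y = 0.
    rewrite -[RHS](pd_cst 0 y c); congr (pd c _ y); apply/funext => z.
    have := congr1 (fun B : 'M[R]_(n, 1) => B d 0) (stereo_inv_normal i z).
    rewrite !mxE => H0; rewrite -[RHS]H0; apply: eq_bigr => e _.
    by rewrite [(_^T) _ _]mxE.
  rewrite E big_split/= => /eqP; rewrite addr_eq0 => /eqP E0.
  rewrite !mxE; under eq_bigr => e _ do rewrite [(_^T) _ _]mxE.
  rewrite E0; congr (- _); apply: eq_bigr => e _.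
  by rewrite [(_^T) _ _]mxE [D i y c e]jac_sigma.
under eq_bigr => c _ do under eq_bigr => d _ do
  rewrite H stereo_inv_conformal mulrN [(q y)%:M _ _]mxE.
rewrite /mxtrace mulr_sumr -sumrN; apply: eq_bigr => c _.
rewrite (bigD1 c)//= eqxx mulr1n big1 ?addr0 ?[_ * q y]mulrC// => d dc.
by rewrite (negbTE dc) mulr0n mulr0 oppr0.
Qed.

(** The Laplacian of a Berger metric read in the ambient space: all of its first-order
    part is radial. *)
Definition berger_op (F : 'rV[R]_n.+1 -> R) x : R :=
  \sum_d \sum_e principal_symbol x d e * pd d (pd e F) x
  - (a * n%:R + (b - a)) * \sum_e x 0 e * pd e F x.

(** The second derivatives of [F] contribute the pushed-forward inverse metric, and the
    first derivatives the vector [hess_trace] less its tangential part. *)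
Lemma laplacian_berger i (U : set 'rV[R]_n.+1) (F : 'rV[R]_n.+1 -> R) y :
  open U -> Ck 2 U F -> U (sigma i y) ->
  laplacian (berger i) (fun z => F (sigma i z)) y = berger_op F (sigma i y).
Proof.
move=> oU CF Uy; have qn := q_neq0 y.
pose U' := [set z | setT z /\ U (sigma i z)].
have cs z : [set: 'rV[R]_n] z -> {for z, continuous (sigma i)}.
  by move=> _; exact/differentiable_continuous/differentiable_stereo_inv.
have oU' : open U' := open_preimage openT oU cs.
have d1 z d : U' z -> has_pd (fun z => F (sigma i z)) z d
    (\sum_e pd e F (sigma i z) * D i z d e).
  move=> [_ Uz].
  have [dF E] := Ck_pd_comp d oU (CkW CF) Uz (fun c => @Ck_stereo_inv R n 1 i c) I.
  split => //; rewrite pdE E; apply: eq_bigr => e _.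
  by rewrite jac_sigma.
have d2 c d : pd c (pd d (fun z => F (sigma i z))) y =
   \sum_e ((\sum_f pd f (pd e F) (sigma i y) * D i y c f) * D i y d e +
      pd e F (sigma i y) * hess_sigma i y c d 0 e).
  have -> : pd c (pd d (fun z => F (sigma i z))) y =
      pd c (fun z => \sum_e pd e F (sigma i z) * D i z d e) y.
    apply: near_eq_pd; apply: near_open_eq oU' _ _ => // z Uz.
    by have [] := d1 z d Uz.
  have dF e : has_pd (fun z => pd e F (sigma i z)) y c
     (\sum_f pd f (pd e F) (sigma i y) * D i y c f).
    have [dF E] := Ck_pd_comp c oU (Ck_pd e CF) Uy (fun c => @Ck_stereo_inv R n 1 i c) I.
    split => //; rewrite pdE E; apply: eq_bigr => f _.
    by rewrite jac_sigma.
  by have [] := has_pd_sum (index_enum _) (fun e => has_pdM (dF e) (has_pd_jac i y c d e)).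
rewrite laplacianE invmx_berger.
pose pc : 'cV[R]_n.+1 := \col_e pd e F (sigma i y).
have HpcE c d : \sum_e pd e F (sigma i y) * hess_sigma i y c d 0 e = (hess_sigma i y c d *m pc) 0 0.
  by rewrite [RHS]mxE; apply: eq_bigr => e _; rewrite [pc _ _]mxE mulrC.
have DpcE k : \sum_e pd e F (sigma i y) * D i y k e = (D i y *m pc) k 0.
  by rewrite [RHS]mxE; apply: eq_bigr => e _; rewrite [pc _ _]mxE mulrC.
have spcE : \sum_e sigma i y 0 e * pd e F (sigma i y) = (sigma i y *m pc) 0 0.
  by rewrite [RHS]mxE; apply: eq_bigr => e _; rewrite [pc _ _]mxE.
transitivity (\sum_c \sum_d berger_inv i y c d *
     \sum_e (\sum_f pd f (pd e F) (sigma i y) * D i y c f) * D i y d e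
   + \sum_c \sum_d berger_inv i y c d * (hess_sigma i y c d *m pc) 0 0
   - \sum_k (\sum_c \sum_d berger_inv i y c d * christoffel (berger i) k c d y) *
       (D i y *m pc) k 0).
  rewrite -big_split/= [X in _ - X](_ : _ = \sum_c \sum_d berger_inv i y c d *
      \sum_k christoffel (berger i) k c d y * (D i y *m pc) k 0).
    rewrite -sumrB; apply: eq_bigr => c _; rewrite -big_split/= -sumrB.
    apply: eq_bigr => d _; rewrite -mulrDr -mulrBr d2 big_split/= HpcE.
    congr (_ * (_ - _)); apply: eq_bigr => k _; congr (_ * _).
    have Uy' : U' y by [].
    by have [_ ->] := d1 y k Uy'; exact: DpcE.
  under eq_bigr => k _ do rewrite mulr_suml.
  rewrite exchange_big/=; apply: eq_bigr => c _.
  under eq_bigr => k _ do rewrite mulr_suml.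
  rewrite exchange_big/=; apply: eq_bigr => d _.
  by rewrite mulr_sumr; apply: eq_bigr => k _; rewrite mulrA.
under [X in _ - X]eq_bigr => k _ do rewrite berger_christoffel_trace -mulrA.
rewrite -mulr_sumr -mulmx_hess_trace sum_push berger_inv_push /berger_op spcE -addrA.
congr (_ + _).
have -> : \sum_k (hess_trace i y *m (D i y)^T) 0 k * (D i y *m pc) k 0 =
    (hess_trace i y *m (D i y)^T *m (D i y *m pc)) 0 0 by rewrite [RHS]mxE.
have -> : (q y)^-1 * (hess_trace i y *m (D i y)^T *m (D i y *m pc)) 0 0 =
    (hess_trace i y *m ((q y)^-1 *: ((D i y)^T *m D i y)) *m pc) 0 0.
  by rewrite -scalemxAr -scalemxAl [RHS]mxE !mulmxA.
rewrite stereo_inv_projection mulmxBr mulmx1 mulmxBl.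
have subE (A B : 'M[R]_1) : A 0 0 - (A - B) 0 0 = B 0 0 by rewrite !mxE; ring.
rewrite subE mulmxA -mulmxA [LHS]mxE big_ord1 hess_trace_normal.
by rewrite mulNr.
Qed.

End Berger.

(** * Riemann sums *)

Section RiemannSums.
Variables (R : realType) (N : nat).
Implicit Types (f g : 'rV[R]_N -> R) (x : 'rV[R]_N).

Lemma unif_continuous_compact (K : set 'rV[R]_N) f (e : R) : compact K ->
  continuous f -> 0 < e ->
  exists2 d, 0 < d & forall x z, K x -> `|z - x| < d -> `|f z - f x| < e.
Proof.
move=> cK cf e0; have e2 : 0 < e / 2 by rewrite divr_gt0.
have /compact_near_coveringP cover := cK.
pose P (d : R) x := forall z, `|z - x| < d -> `|f z - f x| < e.
have : \forall d \near (0 : R)^'+, K `<=` P d.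
  apply: cover => x Kx.
  move/cvgrPdist_lt: (cf x) => /(_ _ e2) /nbhs_ballP[r /= r0 rP].
  have r2 : 0 < r / 2 by rewrite divr_gt0.
  exists (ball x (r / 2), [set d : R | d < r / 2]).
    split => /=; first by apply: nbhsx_ballx.
    exact: nbhs_right_lt.
  move=> [x' d] /= [bx dr] z zx'.
  have Ex : `|f x - f x'| < e / 2.
    apply: rP; rewrite -ball_normE/= in bx *; apply: lt_trans bx _.
    by rewrite ltr_pdivrMr// mulr_natr mulr2n ltrDl.
  have Ez : `|f x - f z| < e / 2.
    apply: rP; rewrite -ball_normE/= in bx *.
    rewrite (_ : x - z = (x - x') - (z - x')); last by rewrite opprB addrA subrK.
    apply: le_lt_trans (ler_normB _ _) _; rewrite [ltRHS]splitr ltrD//.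
    exact: lt_trans zx' dr.
  rewrite (_ : f z - f x' = (f x - f x') - (f x - f z)); last by ring.
  by apply: le_lt_trans (ler_normB _ _) _; rewrite [ltRHS]splitr ltrD.
move=> H.
have H2 : \forall d \near (0 : R)^'+, K `<=` P d /\ 0 < d.
  near=> d; split; near: d; first exact: H.
  exact: nbhs_right_gt.
have [d [dP d0]] := @filter_ex _ _ (at_right_proper_filter (0 : R)) _ H2.
by exists d => // x z Kx; exact: dP.
Unshelve. all: by end_near. Qed.

Definition grid_point (j : nat) (m : {ffun 'I_N -> 'I_(4 * j)}) : 'rV[R]_N :=
  \row_c ((m c)%:R / j%:R - 2).

(** The Riemann sum over the grid of mesh [1 / j] in the box [-2 <= x_c < 2].
    Its limit stands in for the integral, but only the sums themselves are used, so no
    question of integrability arises. *)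
Definition riemann_sum (j : nat) f : R :=
  j%:R^-1 ^+ N * \sum_(m : {ffun 'I_N -> 'I_(4 * j)}) f (grid_point m).

Lemma riemann_sumD j f g :
  riemann_sum j (fun x => f x + g x) = riemann_sum j f + riemann_sum j g.
Proof. by rewrite /riemann_sum big_split mulrDr. Qed.

Lemma riemann_sumZ j c f : riemann_sum j (fun x => c * f x) = c * riemann_sum j f.
Proof. by rewrite /riemann_sum -mulr_sumr mulrCA. Qed.

Lemma riemann_sum_sum j (I : Type) (s : seq I) (F : I -> 'rV[R]_N -> R) :
  riemann_sum j (fun x => \sum_(i <- s) F i x) = \sum_(i <- s) riemann_sum j (F i).
Proof. by rewrite /riemann_sum exchange_big/= mulr_sumr. Qed.

Lemma riemann_sum_cst j c : (0 < j)%N -> riemann_sum j (fun=> c) = 4 ^+ N * c.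
Proof.
move=> j0; rewrite /riemann_sum sumr_const card_ffun !card_ord -[c *+ _]mulr_natl.
rewrite natrX natrM exprMn mulrA mulrCA -exprMn mulVf ?expr1n ?mulr1//.
by rewrite pnatr_eq0 -lt0n.
Qed.

Lemma riemann_sum_le j f g : (forall x, (forall c, `|x 0 c| <= 2) -> f x <= g x) ->
  riemann_sum j f <= riemann_sum j g.
Proof.
move=> fg; rewrite ler_wpM2l ?exprn_ge0 ?invr_ge0//.
apply: ler_sum => m _; apply: fg => c; rewrite mxE.
have j0 : (0 < j)%N.
  by have := leq_ltn_trans (leq0n _) (ltn_ord (m c)); rewrite muln_gt0.
rewrite ler_norml; apply/andP; split.
  by rewrite lerBrDr addrC subrr divr_ge0.
rewrite lerBlDr ler_pdivrMr ?ltr0n// -natrD -natrM ler_nat.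
by rewrite ltnW// (leq_trans (ltn_ord (m c))).
Qed.

Lemma riemann_sum_norm j f e : (0 < j)%N ->
  (forall x, (forall c, `|x 0 c| <= 2) -> `|f x| <= e) ->
  `|riemann_sum j f| <= 4 ^+ N * e.
Proof.
move=> j0 fe; rewrite -(riemann_sum_cst e j0) ler_norml; apply/andP; split.
  rewrite lerNl -mulN1r -riemann_sumZ; apply: riemann_sum_le => x /fe.
  by rewrite mulN1r ler_norml lerNl => /andP[].
by apply: riemann_sum_le => x /fe; rewrite ler_norml => /andP[].
Qed.

(** Cyclic, hence a bijection of the grid. *)
Definition grid_shift j (c : 'I_N) (m : {ffun 'I_N -> 'I_(4 * j)}) :
    {ffun 'I_N -> 'I_(4 * j)} :=
  [ffun d => if d == c then ordS (m d) else m d].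

Lemma grid_shift_bij j c : bijective (@grid_shift j c).
Proof.
exists (fun m : {ffun 'I_N -> 'I_(4 * j)} =>
  [ffun d => if d == c then ord_pred (m d) else m d]).
  by move=> m; apply/ffunP => d; rewrite !ffunE; case: eqP => // _; rewrite ordSK.
by move=> m; apply/ffunP => d; rewrite !ffunE; case: eqP => // _; rewrite ord_predK.
Qed.

(** Up to a bijection of the grid; the points that the cyclic shift brings back to the
    opposite face contribute zero on both sides. *)
Lemma riemann_sum_shift j c f : (0 < j)%N ->
  (forall x, 2 <= `|x 0 c| -> f x = 0) ->
  riemann_sum j (fun x => f (x + j%:R^-1 *: delta_mx 0 c)) = riemann_sum j f.
Proof.
move=> j0 f0; rewrite /riemann_sum; congr (_ * _).
rewrite [RHS](reindex (@grid_shift j c)); last exact/onW_bij/grid_shift_bij.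
apply: eq_bigr => m _.
have jn : (j%:R : R) != 0 by rewrite pnatr_eq0 -lt0n.
have [mj|mj] := ltnP (m c).+1 (4 * j).
  congr f; apply/rowP => d; rewrite !mxE ffunE eqxx/=.
  case: eqP => [->|_]; last by rewrite mulr0 addr0.
  have -> : ((ordS (m c) : nat)%:R : R) = (m c)%:R + 1 by rewrite /= modn_small// natr1.
  by rewrite mulrDl mul1r mulr1; ring.
have E : (m c).+1 = (4 * j)%N by apply/eqP; rewrite eqn_leq mj ltn_ord.
rewrite !f0//.
  by rewrite mxE ffunE eqxx/= E modnn mul0r sub0r normrN ger0_norm.
rewrite !mxE !eqxx/= mulr1.
have -> : (m c)%:R / j%:R - 2 + j%:R^-1 = (m c).+1%:R / j%:R - 2 :> R.
  by rewrite -[(m c).+1%:R]natr1 mulrDl mul1r; ring.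
by rewrite E natrM mulfK// ger0_norm; lra.
Qed.

Lemma compact_box (r : R) : compact [set x : 'rV[R]_N | forall c, `|x 0 c| <= r].
Proof.
rewrite (_ : [set _ | _] = [set v : 'rV[R]_N | forall c, `[- r, r]%classic (v ord0 c)]).
  apply: (@rV_compact _ _ (fun=> `[- r, r]%classic)) => c.
  exact: segment_compact.
apply/seteqP; split => x /= xr c; have := xr c; rewrite /= in_itv/= ler_norml//.
Qed.

(** By [riemann_sum_shift] the sum of the difference quotient along one grid step is
    zero, and this quotient is uniformly close to the derivative. *)
Lemma riemann_sum_pd c G : (forall x, derivable G x (delta_mx 0 c)) ->
  continuous (pd c G) -> (forall x, 2 <= `|x 0 c| -> G x = 0) ->
  riemann_sum j (pd c G) @[j --> \oo] --> (0 : R).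
Proof.
move=> dG cG G0; apply/cvgrPdist_le => e e0.
have e4 : 0 < e / 4 ^+ N by rewrite divr_gt0// exprn_gt0.
have [d d0 dP] := unif_continuous_compact (@compact_box 2) cG e4.
near=> j; rewrite sub0r normrN.
have j0 : (0 < j)%N by near: j; exact: nbhs_infty_gt.
have jd : j%:R^-1 < d.
  rewrite invf_plt ?posrE ?ltr0n//; near: j.
  exact: nbhs_infty_gtr.
have jn : (j%:R : R) != 0 by rewrite pnatr_eq0 -lt0n.
have -> : riemann_sum j (pd c G) = riemann_sum j (fun x => pd c G x -
    j%:R * (G (x + j%:R^-1 *: delta_mx 0 c) - G x)).
  pose D x := G (x + j%:R^-1 *: delta_mx 0 c) + (-1) * G x.
  have D0 : riemann_sum j D = 0.
    by rewrite riemann_sumD riemann_sumZ riemann_sum_shift// mulN1r subrr.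
  transitivity (riemann_sum j (fun x => pd c G x + (- j%:R) * D x)).
    by rewrite riemann_sumD riemann_sumZ D0 mulr0 addr0.
  congr (riemann_sum j _); apply/funext => x.
  by rewrite /D mulN1r mulNr.
rewrite (le_trans (riemann_sum_norm j0 (e := e / 4 ^+ N) _))//; last first.
  by rewrite mulrC divfK// gt_eqF// exprn_gt0.
move=> x xb; have [s sj ->] := @mvt_line R _ G x (delta_mx 0 c) j%:R^-1 (fun s _ => dG _).
rewrite mulrA divff// mul1r -pdE distrC; apply: ltW; apply: dP => //.
rewrite addrAC subrr add0r normrZ (le_lt_trans _ jd)//.
rewrite (@le_trans _ _ `|s|)//; last by rewrite (le_trans sj)// ger0_norm// invr_ge0.
rewrite ler_piMr//; apply: norm_le_coord => // c'; rewrite mxE eqxx/=.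
by case: eqP => _; rewrite ?normr1 ?normr0.
Unshelve. all: by end_near. Qed.

End RiemannSums.

(** * Lower bounds for Riemann sums, and cut-off functions *)

Section RiemannSumLower.
Variables (R : realType) (N : nat).
Implicit Types (f g : 'rV[R]_N -> R) (x : 'rV[R]_N).

Definition interval_ind (z r t : R) : R := if `|t - z| <= r then 1 else 0.

Lemma count_grid (j : nat) (z r : R) : 0 < r -> -2 <= z -> z + r < 2 ->
  2 / r <= j%:R ->
  r / 2 <= j%:R^-1 * \sum_(m < 4 * j) interval_ind z r (m%:R / j%:R - 2).
Proof.
move=> r0 z2 zr jr.
have j0 : 0 < j%:R :> R by rewrite (lt_le_trans _ jr)// divr_gt0.
have rj : 2 <= r * j%:R by move: jr; rewrite ler_pdivrMr// mulrC.
pose m0 := Num.truncn (j%:R * (z + 2)); pose k := Num.truncn (r * j%:R).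
have /andP[m0l m0u] : m0%:R <= j%:R * (z + 2) < m0.+1%:R.
  have z20 : 0 <= z + 2 by lra.
  by apply: truncn_itv; rewrite mulr_ge0// ltW.
have /andP[kl ku] : k%:R <= r * j%:R < k.+1%:R.
  by apply: truncn_itv; rewrite mulr_ge0 ?ltW.
have mk : (m0 + k <= 4 * j)%N.
  rewrite -(ler_nat R) natrD natrM (le_trans (lerD m0l kl))//.
  by rewrite [r * _]mulrC -mulrDr mulrC ler_wpM2r ?ltW//; lra.
have lo : k%:R <= \sum_(m < 4 * j) interval_ind z r (m%:R / j%:R - 2) :> R.
  rewrite -(big_mkord xpredT (fun m => interval_ind z r (m%:R / j%:R - 2))).
  rewrite (big_cat_nat (n := m0))//=; last exact: leq_trans (leq_addr _ _) mk.
  rewrite (big_cat_nat (m := m0) (n := m0 + k))//= ?leq_addr//.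
  rewrite (le_trans (_ : _ <= \sum_(m0 <= m < m0 + k) 1))//.
    by rewrite sumr_const_nat addKn.
  have ind0 m : 0 <= interval_ind z r m by rewrite /interval_ind; case: ifP.
  rewrite -[leLHS]add0r lerD ?sumr_ge0//.
  rewrite -[leLHS]addr0 lerD ?sumr_ge0//.
  rewrite !big_nat; apply: ler_sum => m /andP[m1 m2].
  rewrite /interval_ind (_ : (_ <= r) = true)//.
  have E : m%:R / j%:R - 2 - z = (m%:R - j%:R * (z + 2)) / j%:R.
    by rewrite mulrBl mulrAC mulfV ?gt_eqF//; ring.
  rewrite E ler_norml ler_pdivrMr// ler_pdivlMr//; apply/andP; split.
    have : (m0%:R : R) <= m%:R by rewrite ler_nat.
    by move: m0u; rewrite -[m0.+1%:R]natr1 mulNr; lra.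
  have : (m%:R : R) + 1 <= m0%:R + k%:R by rewrite natr1 -natrD ler_nat.
  by lra.
rewrite ler_pdivlMl// (le_trans _ lo)//.
by move: ku; rewrite -[k.+1%:R]natr1; lra.
Qed.

(** Over a cube where the function is at least [k], the sum factors into one count of
    grid points for each axis ([count_grid]). *)
Lemma riemann_sum_lower f (z : 'rV[R]_N) (k r : R) (j : nat) :
  0 < r -> (forall c, -2 <= z 0 c /\ z 0 c + r < 2) -> 2 / r <= j%:R -> 0 <= k ->
  (forall x, (forall c, `|x 0 c| <= 2) -> 0 <= f x) ->
  (forall x, (forall c, `|x 0 c - z 0 c| <= r) -> k <= f x) ->
  (r / 2) ^+ N * k <= riemann_sum j f.
Proof.
move=> r0 zr jr k0 f0 fk.
apply: (@le_trans _ _ (riemann_sum j (fun x => k * \prod_c interval_ind (z 0 c) r (x 0 c)))).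
  rewrite riemann_sumZ mulrC ler_wpM2l//.
  rewrite /riemann_sum.
  under eq_bigr => m _ do under eq_bigr => c _ do rewrite mxE.
  rewrite -(bigA_distr_bigA (fun c (i : 'I_(4 * j)) =>
     interval_ind (z 0 c) r (i%:R / j%:R - 2))).
  have -> : (r / 2) ^+ N = \prod_(c < N) (r / 2) by rewrite prodr_const card_ord.
  have -> : (j%:R^-1 : R) ^+ N = \prod_(c < N) j%:R^-1 by rewrite prodr_const card_ord.
  rewrite -big_split/=; apply: ler_prod => c _.
  have [z2 zr2] := zr c.
  by rewrite divr_ge0 ?(ltW r0)//= count_grid.
apply: riemann_sum_le => x xb.
have [/forallP H|] := boolP [forall c, `|x 0 c - z 0 c| <= r].
  by rewrite big1 ?mulr1 ?fk// => c _; rewrite /interval_ind H.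
rewrite negb_forall => /existsP[c /negbTE cH].
by rewrite (bigD1 c)//= /interval_ind cH mul0r mulr0 f0.
Qed.

End RiemannSumLower.

Section Cutoff.
Variables (R : realType) (N : nat).
Implicit Types (x : 'rV[R]_N).

(** A function of class C^1 that vanishes exactly on the nonpositive reals. *)
Definition pos_part_sq (t : R) : R := Num.max 0 t ^+ 2.

Lemma pos_part_sq_le (t : R) : t <= 0 -> pos_part_sq t = 0.
Proof. by move=> t0; rewrite /pos_part_sq max_l// expr0n. Qed.

Lemma pos_part_sq_gt (t : R) : 0 <= t -> pos_part_sq t = t ^+ 2.
Proof. by move=> t0; rewrite /pos_part_sq max_r. Qed.

Lemma is_derive_pos_part_sq (t : R) : is_derive t (1 : R) pos_part_sq (2 * Num.max 0 t).
Proof.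
have [t0|t0|<-] := ltgtP 0 t.
- have D : is_derive t (1 : R) (fun s : R => s ^+ 2) (2 * t).
    by apply: DeriveDef; [exact: exprn_derivable|rewrite exp_derive/= expr1 [_ *: 1]mulr1].
  apply: near_eq_is_derive D; near=> s; rewrite pos_part_sq_gt// ltW//.
  by near: s; exact: lt_nbhsr.
- apply: (@near_eq_is_derive _ _ _ (cst 0)); last first.
    by rewrite mulr0; exact: is_derive_cst.
  near=> s; rewrite pos_part_sq_le// ltW//.
  by near: s; exact: lt_nbhsl.
- rewrite mulr0.
  have C : (h^-1 *: (pos_part_sq (h *: (1 : R) + 0) - pos_part_sq 0)) @[h --> (0 : R)^'] --> (0 : R).
    apply/cvgrPdist_le => e e0; near=> h.
    rewrite sub0r normrN addr0 [h *: 1]mulr1 (pos_part_sq_le (lexx 0)) subr0 normrM normfV.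
    have hn0 : h != 0 by near: h; exact: nbhs_dnbhs_neq.
    rewrite mulrC ler_pdivrMr ?normr_gt0//.
    have he : `|h| <= e by near: h; exact: dnbhs0_le.
    have [h0|h0] := leP 0 h.
      rewrite pos_part_sq_gt// normrX expr2 ler_wpM2r//.
    by rewrite (pos_part_sq_le (ltW h0)) normr0 mulr_ge0// ltW.
  apply: DeriveDef; first by apply/cvg_ex; exists 0.
  exact: cvg_lim.
Unshelve. all: by end_near. Qed.

Definition annulus_poly x : R := (sqn x - 1 / 4) * (9 / 4 - sqn x).

(** Supported in the annulus [1 / 2 <= |x| <= 3 / 2], which lies in the box of the
    Riemann sums and avoids the origin.  The power of [sqn] is a free parameter: the
    operator produces such powers when it acts on monomials. *)
Definition cutoff (k : nat) x : R := sqn x ^+ k * pos_part_sq (annulus_poly x).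

(** The gradient is a multiple of the position vector, as for every function of
    [sqn]. *)
Definition radial_pd (f : 'rV[R]_N -> R) x :=
  exists r, forall c, has_pd f x c (r * x 0 c).

Lemma radial_pdM f g x : radial_pd f x -> radial_pd g x ->
  radial_pd (fun z => f z * g z) x.
Proof.
move=> [r fr] [s gs]; exists (r * g x + f x * s) => c.
by apply: has_pd_eq (has_pdM (fr c) (gs c)) _; ring.
Qed.

Lemma radial_pd_sqnX k x : radial_pd (fun z => sqn z ^+ k) x.
Proof.
elim: k => [|k IH].
  exists 0 => c; rewrite mul0r (_ : (fun _ => _) = fun=> 1); first exact: has_pd_cst.
  by apply/funext => z; rewrite expr0.
rewrite (_ : (fun _ => _) = fun z => sqn z * sqn z ^+ k); last first.
  by apply/funext => z; rewrite exprS.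
by apply: radial_pdM => //; exists 2 => c; exact: has_pd_sqn.
Qed.

Lemma has_pd_annulus x c : has_pd annulus_poly x c ((5 - 4 * sqn x) * x 0 c).
Proof.
have := has_pdM (has_pdB (has_pd_sqn c x) (has_pd_cst (1 / 4) x c))
  (has_pdB (has_pd_cst (9 / 4) x c) (has_pd_sqn c x)).
by move=> /has_pd_eq; apply; field.
Qed.

Lemma has_pd_pos_part_annulus x c :
  has_pd (fun z => pos_part_sq (annulus_poly z)) x c
    (2 * Num.max 0 (annulus_poly x) * ((5 - 4 * sqn x) * x 0 c)).
Proof.
have [d1 E1] := has_pd_annulus x c.
have ds := is_derive_pos_part_sq (annulus_poly x).
have dd : differentiable pos_part_sq (annulus_poly x).
  by apply/derivable1_diffP; exact: (@ex_derive _ _ _ _ _ _ _ ds).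
have [d2 E2] := is_derive_comp dd d1.
split => //; rewrite pdE E2 -pdE E1.
move: ((5 - _) * _) => w.
have {1}-> : w = w *: (1 : R) by rewrite [w *: 1]mulr1.
rewrite linearZ /= -(deriveE _ dd) (@derive_val _ _ _ _ _ _ _ ds).
by rewrite [_ *: _]mulrC.
Qed.

Lemma radial_pd_cutoff k x : radial_pd (cutoff k) x.
Proof.
apply: radial_pdM; first exact: radial_pd_sqnX.
exists (2 * Num.max 0 (annulus_poly x) * (5 - 4 * sqn x)) => c.
by apply: has_pd_eq (has_pd_pos_part_annulus x c) _; ring.
Qed.

Lemma Ck_annulus k : Ck k setT annulus_poly.
Proof.
have oT := @openT 'rV[R]_N; have Cs : Ck k setT (@sqn R N) by exact: Ck_sqn.
by apply: Ck_mul => //; apply: Ck_sub_fun => //; exact: Ck_cst.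
Qed.

Lemma C1_cutoff k : Ck 1 setT (cutoff k).
Proof.
have oT := @openT 'rV[R]_N.
apply: Ck_mul => //; first by apply: Ck_exp => //; exact: Ck_sqn.
have cont (f : 'rV[R]_N -> R) : (forall y c, has_pd f y c (pd c f y)) ->
  True by [].
have cA x : {for x, continuous annulus_poly} by exact: (Ck_continuous (Ck_annulus 0)).
split.
  move=> x _; apply: continuous_comp; first exact: cA.
  apply/differentiable_continuous/derivable1_diffP.
  exact: (@ex_derive _ _ _ _ _ _ _ (is_derive_pos_part_sq _)).
move=> c; split => [x _|]; first by have [] := has_pd_pos_part_annulus x c.
have -> : pd c (fun y => pos_part_sq (annulus_poly y)) =
    fun x => 2 * Num.max 0 (annulus_poly x) * ((5 - 4 * sqn x) * x 0 c).
  by apply/funext => x; have [_ ->] := has_pd_pos_part_annulus x c.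
apply: Ck_mul => //; last first.
  apply: Ck_mul => //; last exact: Ck_coord.
  apply: Ck_sub_fun => //; first exact: Ck_cst.
  by apply: Ck_scale => //; exact: Ck_sqn.
apply: Ck_scale => //; split => // x _.
apply: continuous_max; [exact: cst_continuous|exact: cA].
Qed.

Lemma cutoff_out k x : annulus_poly x <= 0 -> cutoff k x = 0.
Proof. by move=> x0; rewrite /cutoff pos_part_sq_le// mulr0. Qed.

Lemma cutoff_ge0 k x : 0 <= cutoff k x.
Proof. by rewrite mulr_ge0 ?sqr_ge0// exprn_ge0// sqn_ge0. Qed.

Lemma annulus_poly_far x c : 2 <= `|x 0 c| -> annulus_poly x <= 0.
Proof.
move=> x2; have : 4 <= sqn x.
  rewrite /sqn (bigD1 c)//= -[leLHS]addr0 lerD ?sumr_ge0// => [|k _]; last exact: sqr_ge0.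
  by rewrite -real_normK ?num_real//; nra.
by rewrite /annulus_poly; nra.
Qed.

End Cutoff.

(** * Symmetry of the Laplacian *)

Lemma Ck_has_pd (R : realType) (n k : nat) (U : set 'rV[R]_n) f y (a : 'I_n) :
  Ck k.+1 U f -> U y -> has_pd f y a (pd a f y).
Proof. by move=> Cf Uy; apply: has_pdP; exact: Ck_derivable Cf Uy. Qed.

Arguments Ck_has_pd {R n k U f y} a _ _.

Lemma cvg_sum0 (R : realType) (I : Type) (s : seq I) (u : I -> nat -> R) :
  (forall i, u i j @[j --> \oo] --> (0 : R)) ->
  \sum_(i <- s) u i j @[j --> \oo] --> (0 : R).
Proof.
move=> u0; elim: s => [|i s IH].
  by under eq_fun => j do rewrite big_nil; exact: cvg_cst.
under eq_fun => j do rewrite big_cons.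
by have := cvgD (u0 i) IH; rewrite addr0; exact.
Qed.

Section Green.
Variables (R : realType) (n : nat) (J : 'M[R]_n.+1).
Hypotheses (JT : J^T = - J) (JJ : J *m J = - 1%:M).
Variables (a b : R).
Implicit Types (x : 'rV[R]_n.+1).
Local Notation symbol := (principal_symbol J a b).
Local Notation op := (berger_op J a b).
Local Notation nonzero := (@nonzero R n).

Lemma symbolE x c d : symbol x c d =
  a * (sqn x * (c == d)%:R - x 0 c * x 0 d) + (b - a) * ((x *m J) 0 c * (x *m J) 0 d).
Proof.
rewrite /principal_symbol mxE; congr (_ + _); rewrite mxE; congr (_ * _); last first.
  by rewrite mxE big_ord1 [(_^T) _ _]mxE.
rewrite mxE; congr (_ + _); first by rewrite mxE mulr_natr.
by rewrite mxE mxE big_ord1 [(_^T) _ _]mxE.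
Qed.

Lemma symbolC x c d : symbol x c d = symbol x d c.
Proof. by rewrite !symbolE eq_sym; ring. Qed.

Lemma symbol_radial x : x *m symbol x = 0.
Proof.
rewrite /principal_symbol mulmxDr -!scalemxAr mulmxBr mul_mx_scalar !mulmxA.
have -> : x *m (x *m J)^T = 0.
  by rewrite -[LHS]trmxK trmx_mul trmxK skew_quad ?trmx0.
have -> : x *m x^T = (sqn x)%:M.
  by apply/matrixP => i j; rewrite !ord1 -sqnE mxE eqxx.
by rewrite mul_scalar_mx subrr !mul0mx !scaler0 addr0.
Qed.

Lemma has_pd_linear (M : 'M[R]_n.+1) x c d : has_pd (fun z => (z *m M) 0 d) x c (M c d).
Proof.
have E : (fun z : 'rV[R]_n.+1 => (z *m M) 0 d) = fun z => \sum_e M e d * z 0 e.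
  by apply/funext => z; rewrite mxE; apply: eq_bigr => e _; rewrite mulrC.
rewrite E; have := has_pd_sum (index_enum _) (fun e => has_pdZ (M e d) (has_pd_coord x e c)).
move=> /has_pd_eq; apply; rewrite (bigD1 c)//= eqxx mulr1 big1 ?addr0// => e ec.
by rewrite eq_sym (negbTE ec) mulr0.
Qed.

Lemma Ck_linear k (M : 'M[R]_n.+1) d : Ck k setT (fun z => (z *m M) 0 d).
Proof.
have oT := @openT 'rV[R]_n.+1.
have -> : (fun z : 'rV[R]_n.+1 => (z *m M) 0 d) = fun z => \sum_e M e d * z 0 e.
  by apply/funext => z; rewrite mxE; apply: eq_bigr => e _; rewrite mulrC.
by apply: Ck_sum => // e; apply: Ck_scale => //; exact: Ck_coord.
Qed.

Lemma Ck_symbol k c d : Ck k setT (fun x => symbol x c d).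
Proof.
have oT := @openT 'rV[R]_n.+1.
have -> : (fun x => symbol x c d) = fun x =>
    a * (sqn x * (c == d)%:R - x 0 c * x 0 d) + (b - a) * ((x *m J) 0 c * (x *m J) 0 d).
  by apply/funext => x; rewrite symbolE.
apply: Ck_add => //; apply: Ck_scale => //; last by apply: Ck_mul => //; exact: Ck_linear.
apply: Ck_sub_fun => //; apply: Ck_mul => //; [exact: Ck_sqn|exact: Ck_cst|exact: Ck_coord|exact: Ck_coord].
Qed.

Definition symbol_pd x c d : R :=
  a * (2 * x 0 c * (c == d)%:R - (x 0 d + x 0 c * (c == d)%:R)) +
  (b - a) * (J c c * (x *m J) 0 d + (x *m J) 0 c * J c d).

Lemma has_pd_symbol x c d : has_pd (fun z => symbol z c d) x c (symbol_pd x c d).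
Proof.
have E : (fun x => symbol x c d) = fun x =>
    a * (sqn x * (c == d)%:R - x 0 c * x 0 d) + (b - a) * ((x *m J) 0 c * (x *m J) 0 d).
  by apply/funext => z; rewrite symbolE.
have := has_pdD (has_pdZ a (has_pdB
   (has_pdM (has_pd_sqn c x) (has_pd_cst (c == d)%:R x c))
   (has_pdM (has_pd_coord x c c) (has_pd_coord x d c))))
  (has_pdZ (b - a) (has_pdM (has_pd_linear J x c c) (has_pd_linear J x c d))).
rewrite E => /has_pd_eq; apply; rewrite /symbol_pd eqxx.
by rewrite mulr0 addr0 mul1r.
Qed.

Lemma sum_delta (I : finType) (d : I) (f : I -> R) : \sum_c f c * (c == d)%:R = f d.
Proof.
rewrite (bigD1 d)//= eqxx mulr1 big1 ?addr0// => c cd.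
by rewrite (negbTE cd) mulr0.
Qed.

(** The divergence of the coefficients is the first-order part of the operator, which
    is therefore in divergence form. *)
Lemma sum_symbol_pd x d : \sum_c symbol_pd x c d = - (a * n%:R + (b - a)) * x 0 d.
Proof.
have Jcc c : J c c = 0.
  have := congr1 (fun M : 'M[R]_n.+1 => M c c) JT; rewrite !mxE => /eqP.
  by rewrite -addr_eq0 -mulr2n mulrn_eq0/= => /eqP.
have E c : symbol_pd x c d = (a * x 0 c) * (c == d)%:R - a * x 0 d + (b - a) * ((x *m J) 0 c * J c d).
  by rewrite /symbol_pd Jcc; ring.
under eq_bigr => c _ do rewrite E.
rewrite big_split/= sumrB sum_delta sumr_const card_ord -mulr_sumr.
have -> : \sum_c (x *m J) 0 c * J c d = - x 0 d.
  transitivity ((x *m J *m J) 0 d); first by rewrite [RHS]mxE.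
  by rewrite -mulmxA JJ mulmxN mulmx1 mxE.
by rewrite mulrSr -[_ *+ n]mulr_natr; ring.
Qed.

Variables (F m : 'rV[R]_n.+1 -> R).
Hypotheses (CF : Ck 2 nonzero F) (Cm : Ck 2 nonzero m).

Definition flux c x : R :=
  \sum_d symbol x c d * (F x * pd d m x - m x * pd d F x).

Lemma Ck_flux c : Ck 1 nonzero (flux c).
Proof.
have oU := @open_nonzero R n.
apply: Ck_sum => // d; apply: Ck_mul => //.
  exact: Ck_sub (@subsetT _ _) (Ck_symbol 1 c d).
apply: Ck_sub_fun => //; apply: Ck_mul => //.
- exact: CkW CF.
- exact: Ck_pd Cm.
- exact: CkW Cm.
- exact: Ck_pd CF.
Qed.

(** The radial direction is in the kernel of the coefficient matrix. *)
Lemma flux_radial x : \sum_c x 0 c * flux c x = 0.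
Proof.
have := congr1 (fun M : 'rV[R]_n.+1 => (M *m (\col_d (F x * pd d m x - m x * pd d F x))) 0 0)
  (symbol_radial x).
rewrite mul0mx [RHS]mxE -mulmxA => E; rewrite -[RHS]E mxE; apply: eq_bigr => c _.
by congr (_ * _); rewrite mxE; apply: eq_bigr => d _; rewrite [(\col_ _ _) _ _]mxE.
Qed.

Lemma div_flux x : nonzero x ->
  \sum_c pd c (flux c) x = F x * op m x - m x * op F x.
Proof.
move=> x0.
have dF c := (Ck_has_pd c CF x0).
have dm c := (Ck_has_pd c Cm x0).
have ddF c d := (Ck_has_pd c (Ck_pd d CF) x0).
have ddm c d := (Ck_has_pd c (Ck_pd d Cm) x0).
have E c : pd c (flux c) x = \sum_d (symbol_pd x c d * (F x * pd d m x - m x * pd d F x)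
   + (symbol x c d * pd c F x * pd d m x - symbol x c d * pd c m x * pd d F x)
   + (F x * (symbol x c d * pd c (pd d m) x) - m x * (symbol x c d * pd c (pd d F) x))).
  have [_ ->] := has_pd_sum (index_enum _) (fun d => has_pdM (has_pd_symbol x c d)
    (has_pdB (has_pdM (dF c) (ddm c d)) (has_pdM (dm c) (ddF c d)))).
  have E1 (k' k Fx mx md Fd Fc mc mcd Fcd : R) :
    k' * (Fx * md - mx * Fd) + k * (Fc * md + Fx * mcd - (mc * Fd + mx * Fcd)) =
    k' * (Fx * md - mx * Fd) + (k * Fc * md - k * mc * Fd)
    + (Fx * (k * mcd) - mx * (k * Fcd)) by ring.
  by apply: eq_bigr => d _; exact: E1.
under eq_bigr => c _ do rewrite E !big_split/=.
rewrite !big_split/=.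
have -> : \sum_c \sum_d symbol_pd x c d * (F x * pd d m x - m x * pd d F x) =
   - (a * n%:R + (b - a)) * (F x * \sum_d x 0 d * pd d m x - m x * \sum_d x 0 d * pd d F x).
  rewrite exchange_big/= !mulr_sumr -sumrB mulr_sumr; apply: eq_bigr => d _.
  by rewrite -mulr_suml sum_symbol_pd; ring.
have -> : \sum_c \sum_d symbol x c d * pd c F x * pd d m x +
    \sum_c \sum_d - (symbol x c d * pd c m x * pd d F x) = 0.
  rewrite [X in X + _]exchange_big/= -big_split/= big1// => c _.
  rewrite -big_split/= big1// => d _.
  by rewrite symbolC; ring.
rewrite addr0 /berger_op.
have -> : \sum_c \sum_d F x * (symbol x c d * pd c (pd d m) x) =
    F x * \sum_c \sum_d symbol x c d * pd c (pd d m) x.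
  by rewrite mulr_sumr; apply: eq_bigr => c _; rewrite mulr_sumr.
have -> : \sum_c \sum_d - (m x * (symbol x c d * pd c (pd d F) x)) =
    - (m x * \sum_c \sum_d symbol x c d * pd c (pd d F) x).
  rewrite mulr_sumr -sumrN; apply: eq_bigr => c _.
  by rewrite mulr_sumr -sumrN.
have E2 (L Fx mx A B P Q : R) :
  - L * (Fx * A - mx * B) + (Fx * P - mx * Q) = Fx * (P - L * A) - mx * (Q - L * B).
  by ring.
exact: E2.
Qed.

Lemma open_annulus_out : open [set x : 'rV[R]_n.+1 | annulus_poly x < 0].
Proof.
have cA x : setT x -> {for x, continuous (@annulus_poly R n.+1)}.
  by move=> _; exact: (Ck_continuous (Ck_annulus _ _ 0)).
have := open_preimage openT (@open_lt R 0) cA; congr open.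
by apply/seteqP; split => x //= [].
Qed.

Lemma annulus_zero : annulus_poly (0 : 'rV[R]_n.+1) < 0.
Proof.
rewrite /annulus_poly (_ : sqn _ = 0); first by lra.
by apply/eqP; rewrite sqn_eq0.
Qed.

Lemma C1_cut_flux k c : Ck 1 setT (fun x => cutoff k x * flux c x).
Proof.
have oU := @open_nonzero R n.
apply: Ck_local => x _; have [->|x0] := eqVneq x 0.
  exists [set x : 'rV[R]_n.+1 | annulus_poly x < 0]; first exact: annulus_zero.
  apply: Ck_ext open_annulus_out _ (Ck_cst 1 _ 0) => y y0.
  by rewrite cutoff_out ?mul0r// ltW.
exists nonzero => //; apply: Ck_mul => //; last exact: Ck_flux.
exact: Ck_sub (@subsetT _ _) (C1_cutoff _ _ k).
Qed.

(** The operator is symmetric for every rotationally symmetric weight: the flux is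
    tangent to the spheres, so the gradient of the cut-off, being radial, does not
    contribute to the divergence. *)
Lemma riemann_sum_green k :
  riemann_sum j (fun x => cutoff k x * (F x * op m x - m x * op F x)) @[j --> \oo]
  --> (0 : R).
Proof.
have key x : \sum_c pd c (fun x => cutoff k x * flux c x) x =
    cutoff k x * (F x * op m x - m x * op F x).
  have [->|x0] := eqVneq x 0.
    rewrite cutoff_out ?ltW ?annulus_zero// mul0r big1// => c _.
    rewrite -[RHS](pd_cst 0 (0 : 'rV[R]_n.+1) c); apply: near_eq_pd.
    apply: near_open_eq open_annulus_out _ annulus_zero => y y0.
    by rewrite cutoff_out ?mul0r// ltW.
  have [r rE] := radial_pd_cutoff k x.
  rewrite -(div_flux x0) mulr_sumr.
  transitivity (\sum_c (r * (x 0 c * flux c x) + cutoff k x * pd c (flux c) x)).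
    apply: eq_bigr => c _.
    have [_ ->] := has_pdM (rE c) ((Ck_has_pd c (Ck_flux c) x0)).
    by rewrite mulrA.
  by rewrite big_split/= -mulr_sumr flux_radial mulr0 add0r.
have -> : (fun x => cutoff k x * (F x * op m x - m x * op F x)) =
    fun x => \sum_c pd c (fun x => cutoff k x * flux c x) x.
  by apply/funext => x; rewrite key.
under eq_fun => j do rewrite riemann_sum_sum.
apply: cvg_sum0 => c; apply: riemann_sum_pd.
- by move=> x; exact: Ck_derivable (C1_cut_flux k c) _.
- by move=> x; exact: Ck_continuous (Ck_pd c (C1_cut_flux k c)) _.
- move=> x xc; rewrite cutoff_out ?mul0r//.
  exact: annulus_poly_far xc.
Qed.

End Green.

(** * Monomials in one complex coordinate *)

Lemma cvg_scale0 (R : realType) (c : R) (u : nat -> R) :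
  u j @[j --> \oo] --> (0 : R) -> c * u j @[j --> \oo] --> (0 : R).
Proof. by move=> u0; rewrite -(mulr0 c); apply: cvgMl_tmp. Qed.

Lemma cvg_add0 (R : realType) (u w : nat -> R) : u j @[j --> \oo] --> (0 : R) ->
  w j @[j --> \oo] --> (0 : R) -> u j + w j @[j --> \oo] --> (0 : R).
Proof. by move=> u0 w0; have := cvgD u0 w0; rewrite addr0; exact. Qed.

Section TestFunctions.
Variables (R : realType) (n : nat) (J : 'M[R]_n.+1).
Hypotheses (JT : J^T = - J) (JJ : J *m J = - 1%:M).
Variables (a b : R) (v : 'rV[R]_n.+1).
Hypothesis v1 : v *m v^T = 1%:M.
Implicit Types (x : 'rV[R]_n.+1).
Local Notation symbol := (principal_symbol J a b).
Local Notation op := (berger_op J a b).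

(** Real and imaginary part of the coordinate [z] of [x] in the complex line spanned
    by [v], for the complex structure [J]. *)
Definition cplx_re x : R := (x *m v^T) 0 0.
Definition cplx_im x : R := (x *m (v *m J)^T) 0 0.

Lemma has_pd_dot (w : 'rV[R]_n.+1) x c : has_pd (fun z => (z *m w^T) 0 0) x c (w 0 c).
Proof.
have E : (fun z : 'rV[R]_n.+1 => (z *m w^T) 0 0) = fun z => \sum_e w 0 e * z 0 e.
  by apply/funext => z; rewrite mxE; apply: eq_bigr => e _; rewrite mulrC [(_^T) _ _]mxE.
rewrite E; have := has_pd_sum (index_enum _) (fun e => has_pdZ (w 0 e) (has_pd_coord x e c)).
move=> /has_pd_eq; apply; rewrite (bigD1 c)//= eqxx mulr1 big1 ?addr0// => e ec.
by rewrite eq_sym (negbTE ec) mulr0.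
Qed.

Lemma Ck_dot k (w : 'rV[R]_n.+1) : Ck k setT (fun z : 'rV[R]_n.+1 => (z *m w^T) 0 0).
Proof.
have oT := @openT 'rV[R]_n.+1.
have -> : (fun z : 'rV[R]_n.+1 => (z *m w^T) 0 0) = fun z => \sum_e w 0 e * z 0 e.
  by apply/funext => z; rewrite mxE; apply: eq_bigr => e _; rewrite mulrC [(_^T) _ _]mxE.
by apply: Ck_sum => // e; apply: Ck_scale => //; exact: Ck_coord.
Qed.

(** Real and imaginary part of [z ^ i]. *)
Fixpoint pow_re (i : nat) x : R := if i is i'.+1 then cplx_re x * pow_re i' x - cplx_im x * pow_im i' x else 1
with pow_im (i : nat) x : R := if i is i'.+1 then cplx_re x * pow_im i' x + cplx_im x * pow_re i' x else 0.

(** Real and imaginary part of [z ^ i * zbar ^ j]. *)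
Definition zz_re i j x := pow_re i x * pow_re j x + pow_im i x * pow_im j x.
Definition zz_im i j x := pow_im i x * pow_re j x - pow_re i x * pow_im j x.

Lemma Ck_pow k i : Ck k setT (pow_re i) /\ Ck k setT (pow_im i).
Proof.
have oT := @openT 'rV[R]_n.+1; have C1 := Ck_dot k v; have C2 := Ck_dot k (v *m J).
elim: i => [|i [IH1 IH2]]; first by split; exact: Ck_cst.
by split; [apply: Ck_sub_fun|apply: Ck_add] => //; apply: Ck_mul.
Qed.

Lemma Ck_zz_re k i j : Ck k setT (zz_re i j).
Proof.
have oT := @openT 'rV[R]_n.+1; have [C1 C2] := Ck_pow k i; have [C3 C4] := Ck_pow k j.
by apply: Ck_add => //; apply: Ck_mul.
Qed.

Local Notation w := (v *m J).

Lemma has_pd_pow i x e :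
  has_pd (pow_re i) x e (i%:R * pow_re i.-1 x * v 0 e - i%:R * pow_im i.-1 x * w 0 e) /\
  has_pd (pow_im i) x e (i%:R * pow_im i.-1 x * v 0 e + i%:R * pow_re i.-1 x * w 0 e).
Proof.
have D1 := has_pd_dot v x e; have D2 := has_pd_dot w x e.
elim: i => [|i [IH1 IH2]].
  by rewrite !mul0r subr0 addr0; split; exact: has_pd_cst.
have H1 := has_pdB (has_pdM D1 IH1) (has_pdM D2 IH2).
have H2 := has_pdD (has_pdM D1 IH2) (has_pdM D2 IH1).
rewrite -/(cplx_re x) -/(cplx_im x) in H1 H2.
have Ere : cplx_re x * (i%:R * pow_re i.-1 x) - cplx_im x * (i%:R * pow_im i.-1 x) = i%:R * pow_re i x.
  by case: {H1 H2 IH1 IH2} i => [|i] /=; ring.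
have Eim : cplx_re x * (i%:R * pow_im i.-1 x) + cplx_im x * (i%:R * pow_re i.-1 x) = i%:R * pow_im i x.
  by case: {H1 H2 IH1 IH2 Ere} i => [|i] /=; ring.
rewrite -[i.+1%:R]natr1 /=; split.
  apply: has_pd_eq H1 _; rewrite !mulrDl mul1r -Ere -Eim; ring.
by apply: has_pd_eq H2 _; rewrite !mulrDl mul1r -Ere -Eim; ring.
Qed.

(** Derivatives of the monomials along [v] and along [v *m J], the real and imaginary
    axes of the complex line. *)
Definition zz_re_s i j x := i%:R * zz_re i.-1 j x + j%:R * zz_re i j.-1 x.
Definition zz_re_r i j x := - (i%:R * zz_im i.-1 j x) + j%:R * zz_im i j.-1 x.
Definition zz_im_s i j x := i%:R * zz_im i.-1 j x + j%:R * zz_im i j.-1 x.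
Definition zz_im_r i j x := i%:R * zz_re i.-1 j x - j%:R * zz_re i j.-1 x.

Lemma has_pd_zz i j x e :
  has_pd (zz_re i j) x e (zz_re_s i j x * v 0 e + zz_re_r i j x * w 0 e) /\
  has_pd (zz_im i j) x e (zz_im_s i j x * v 0 e + zz_im_r i j x * w 0 e).
Proof.
have [ci di] := has_pd_pow i x e; have [cj dj] := has_pd_pow j x e.
split.
  apply: has_pd_eq (has_pdD (has_pdM ci cj) (has_pdM di dj)) _.
  by rewrite /zz_re_s /zz_re_r /zz_re /zz_im; ring.
apply: has_pd_eq (has_pdB (has_pdM di cj) (has_pdM ci dj)) _.
by rewrite /zz_im_s /zz_im_r /zz_re /zz_im; ring.
Qed.

Lemma zz_pred_l i j x :
  i%:R * (cplx_re x * zz_re i.-1 j x - cplx_im x * zz_im i.-1 j x) = i%:R * zz_re i j x /\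
  i%:R * (cplx_re x * zz_im i.-1 j x + cplx_im x * zz_re i.-1 j x) = i%:R * zz_im i j x.
Proof.
by case: i => [|i]; rewrite ?mul0r//; split; congr (_ * _); rewrite /zz_re /zz_im /=; ring.
Qed.

Lemma zz_pred_r i j x :
  j%:R * (cplx_re x * zz_re i j.-1 x + cplx_im x * zz_im i j.-1 x) = j%:R * zz_re i j x /\
  j%:R * (cplx_re x * zz_im i j.-1 x - cplx_im x * zz_re i j.-1 x) = j%:R * zz_im i j x.
Proof.
by case: j => [|j]; rewrite ?mul0r//; split; congr (_ * _); rewrite /zz_re /zz_im /=; ring.
Qed.

Lemma re_zz i j x : cplx_re x * zz_re i j x = 2^-1 * (zz_re i.+1 j x + zz_re i j.+1 x).
Proof. by rewrite /zz_re /=; field. Qed.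

Lemma symbol_form (p q : 'rV[R]_n.+1) x :
  \sum_d \sum_e symbol x d e * (p 0 d * q 0 e) =
  a * (sqn x * (p *m q^T) 0 0 - (x *m p^T) 0 0 * (x *m q^T) 0 0)
  + (b - a) * ((x *m J *m p^T) 0 0 * (x *m J *m q^T) 0 0).
Proof.
have E d e : symbol x d e * (p 0 d * q 0 e) = (a * sqn x) * (p 0 d * q 0 e * (d == e)%:R)
   - a * (x 0 d * p 0 d * (x 0 e * q 0 e))
   + (b - a) * ((x *m J) 0 d * p 0 d * ((x *m J) 0 e * q 0 e)).
  by rewrite symbolE; ring.
under eq_bigr => d _.
  under eq_bigr => e _ do rewrite E.
  rewrite big_split/= sumrB -!mulr_sumr; over.
rewrite big_split/= sumrB -!mulr_sumr.
have dotE (y z : 'rV[R]_n.+1) : (y *m z^T) 0 0 = \sum_d y 0 d * z 0 d.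
  by rewrite mxE; apply: eq_bigr => d _; rewrite [(_^T) _ _]mxE.
have sq (y z : 'I_n.+1 -> R) : \sum_d \sum_e y d * z e = (\sum_d y d) * (\sum_e z e).
  by rewrite mulr_suml; apply: eq_bigr => d _; rewrite mulr_sumr.
have dg : \sum_d \sum_e p 0 d * q 0 e * (d == e)%:R = \sum_d p 0 d * q 0 d.
  apply: eq_bigr => d _; under eq_bigr => e _ do rewrite eq_sym.
  by rewrite (sum_delta d (fun e => p 0 d * q 0 e)).
under [X in _ - _ * X]eq_bigr => d _ do rewrite mulr_sumr.
rewrite dg (sq (fun d => x 0 d * p 0 d) (fun e => x 0 e * q 0 e)) -mulr_suml !dotE.
by congr (_ + _); rewrite [in RHS]mulrBr; congr (_ - _); rewrite mulrA.
Qed.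

(** [f] is a function of [z], with derivatives [fs] and [fr] along the two axes; the chain
    rule and [symbol_form] leave an operator in two real variables. *)
Lemma plane_op f fs fr fss fsr frr x :
  (forall y e, has_pd f y e (fs y * v 0 e + fr y * w 0 e)) ->
  (forall e, has_pd fs x e (fss * v 0 e + fsr * w 0 e)) ->
  (forall e, has_pd fr x e (fsr * v 0 e + frr * w 0 e)) ->
  op f x = a * (sqn x * (fss + frr)
     - (cplx_re x ^+ 2 * fss + 2 * cplx_re x * cplx_im x * fsr + cplx_im x ^+ 2 * frr))
     + (b - a) * (cplx_im x ^+ 2 * fss - 2 * cplx_re x * cplx_im x * fsr + cplx_re x ^+ 2 * frr)
     - (a * n%:R + (b - a)) * (cplx_re x * fs x + cplx_im x * fr x).
Proof.
move=> Hf Hs Hr.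
have JJT : J *m J^T = 1%:M by rewrite JT mulmxN JJ opprK.
have vv : (v *m v^T) 0 0 = 1 by rewrite v1 mxE.
have vw : (v *m w^T) 0 0 = 0.
  by rewrite -[LHS]mulr1 -[X in _ * X]vv trmx_mul mulmxA JT mulmxN mulNmx skew_quad// mxE mxE oppr0 mul0r.
have wv : (w *m v^T) 0 0 = 0 by rewrite skew_quad// mxE.
have ww : (w *m w^T) 0 0 = 1 by rewrite trmx_mul mulmxA -(mulmxA v) JJT mulmx1.
have xJv : (x *m J *m v^T) 0 0 = - cplx_im x.
  by rewrite /cplx_im trmx_mul JT mulNmx mulmxN mulmxA [in RHS]mxE opprK.
have xJw : (x *m J *m w^T) 0 0 = cplx_re x by rewrite trmx_mul mulmxA -(mulmxA x) JJT mulmx1.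
have pdf e : pd e f = fun y => fs y * v 0 e + fr y * w 0 e.
  by apply/funext => y; have [_ ->] := Hf y e.
have pddf d e : pd d (pd e f) x = fss * (v 0 d * v 0 e) + fsr * (w 0 d * v 0 e)
    + fsr * (v 0 d * w 0 e) + frr * (w 0 d * w 0 e).
  have [_] := has_pdD (has_pdM (Hs d) (has_pd_cst (v 0 e) x d)) (has_pdM (Hr d) (has_pd_cst (w 0 e) x d)).
  rewrite pdf => ->; ring.
pose Q (p q : 'rV[R]_n.+1) := \sum_d \sum_e symbol x d e * (p 0 d * q 0 e).
have key : \sum_d \sum_e symbol x d e * pd d (pd e f) x =
    fss * Q v v + fsr * Q w v + fsr * Q v w + frr * Q w w.
  rewrite !mulr_sumr -!big_split/=; apply: eq_bigr => d _.
  rewrite !mulr_sumr -!big_split/=; apply: eq_bigr => e _.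
  by rewrite pddf; move: (symbol x d e) => k; ring.
rewrite /berger_op key /Q !symbol_form.
have -> : \sum_e x 0 e * pd e f x = cplx_re x * fs x + cplx_im x * fr x.
  under eq_bigr => e _ do rewrite pdf mulrDr.
  rewrite big_split/= /cplx_re /cplx_im [in RHS]mxE [X in _ = _ + X * _]mxE !mulr_suml.
  by congr (_ + _); apply: eq_bigr => e _; rewrite [(_^T) _ _]mxE; ring.
rewrite -/(cplx_re x) -/(cplx_im x) vv vw wv ww xJv xJw; ring.
Qed.

(** The diagonal entries of the operator on the monomials [z ^ i * zbar ^ j]; the degree
    [i + j] is seen by the round part, the weight [i - j] under the Hopf action by the
    rest. *)
Definition gap_eigenvalue (i j : nat) : R :=
  a * (i + j)%:R * ((i + j)%:R - 1 + n%:R) + (b - a) * (i%:R - j%:R) ^+ 2.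

Lemma op_zz_re i j x : op (zz_re i j) x =
  4 * a * i%:R * j%:R * (sqn x * zz_re i.-1 j.-1 x) - gap_eigenvalue i j * zz_re i j x.
Proof.
have Hs e := has_pdD (has_pdZ i%:R (has_pd_zz i.-1 j x e).1) (has_pdZ j%:R (has_pd_zz i j.-1 x e).1).
have Hr e := has_pdD (has_pdZ (- i%:R) (has_pd_zz i.-1 j x e).2) (has_pdZ j%:R (has_pd_zz i j.-1 x e).2).
pose fss := i%:R * zz_re_s i.-1 j x + j%:R * zz_re_s i j.-1 x.
pose fsr := i%:R * zz_re_r i.-1 j x + j%:R * zz_re_r i j.-1 x.
pose frr := - i%:R * zz_im_r i.-1 j x + j%:R * zz_im_r i j.-1 x.
have Esr : - i%:R * zz_im_s i.-1 j x + j%:R * zz_im_s i j.-1 x = fsr.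
  by rewrite /fsr /zz_im_s /zz_re_r; ring.
rewrite (@plane_op _ (zz_re_s i j) (zz_re_r i j) fss fsr frr).
- have [li lq] := zz_pred_l i j x; have [ri rq] := zz_pred_r i j x.
  have [li' lq'] := zz_pred_l i.-1 j x; have [ri' rq'] := zz_pred_r i j.-1 x.
  have [lj lqj] := zz_pred_r i.-1 j x.
  have predE (k : nat) : k%:R * k.-1%:R = k%:R * (k%:R - 1) :> R.
    by case: k => [|k]; rewrite ?mul0r// -[k.+1%:R]natr1 addrK.
  rewrite /fss /fsr /frr /zz_re_s /zz_re_r /zz_im_r /gap_eigenvalue natrD.
  move: (cplx_re x) (cplx_im x) (sqn x) i%:R j%:R i.-1%:R j.-1%:R (predE i) (predE j)
    li lq ri rq li' lq' ri' rq' lj lqj => s r rho I J' I' JJ' EI EJ.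
  move: (zz_re i j x) (zz_im i j x) (zz_re i.-1 j x) (zz_im i.-1 j x)
    (zz_re i j.-1 x) (zz_im i j.-1 x) (zz_re i.-1.-1 j x) (zz_im i.-1.-1 j x)
    (zz_re i j.-1.-1 x) (zz_im i j.-1.-1 x) (zz_re i.-1 j.-1 x) (zz_im i.-1 j.-1 x).
  move=> p q pi qi pj qj P1 Q1 P2 Q2 P3 Q3 li lq ri rq li' lq' ri' rq' lj lqj.
  have A : I * I' * ((s ^+ 2 - r ^+ 2) * P1 - 2 * s * r * Q1) = I * (I - 1) * p.
    transitivity (I * (s * (I' * (s * P1 - r * Q1)) - r * (I' * (s * Q1 + r * P1)))); first by ring.
    rewrite li' lq' -EI (_ : _ * (_ - _) = I' * (I * (s * pi - r * qi))); last by ring.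
    by rewrite li; ring.
  have B : J' * JJ' * ((s ^+ 2 - r ^+ 2) * P2 + 2 * s * r * Q2) = J' * (J' - 1) * p.
    transitivity (J' * (s * (JJ' * (s * P2 + r * Q2)) + r * (JJ' * (s * Q2 - r * P2)))); first by ring.
    rewrite ri' rq' -EJ (_ : _ * (_ + _) = JJ' * (J' * (s * pj + r * qj))); last by ring.
    by rewrite ri; ring.
  have C : I * J' * ((s ^+ 2 + r ^+ 2) * P3) = I * J' * p.
    transitivity (I * (s * (J' * (s * P3 + r * Q3)) - r * (J' * (s * Q3 - r * P3)))); first by ring.
    rewrite lj lqj (_ : _ * (_ - _) = J' * (I * (s * pi - r * qi))); last by ring.
    by rewrite li; ring.
  transitivity (a * (rho * (4 * I * J' * P3) -
      (I * I' * ((s ^+ 2 - r ^+ 2) * P1 - 2 * s * r * Q1) +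
       J' * JJ' * ((s ^+ 2 - r ^+ 2) * P2 + 2 * s * r * Q2) +
       2 * (I * J' * ((s ^+ 2 + r ^+ 2) * P3))))
    + (b - a) * (- (I * I' * ((s ^+ 2 - r ^+ 2) * P1 - 2 * s * r * Q1)) -
       J' * JJ' * ((s ^+ 2 - r ^+ 2) * P2 + 2 * s * r * Q2) +
       2 * (I * J' * ((s ^+ 2 + r ^+ 2) * P3)))
    - (a * n%:R + (b - a)) * (I * (s * pi - r * qi) + J' * (s * pj + r * qj))).
    by ring.
  by rewrite A B C li ri; ring.
- by move=> y e; exact: (has_pd_zz i j y e).1.
- by move=> e; apply: has_pd_eq (Hs e) _; rewrite /fss /fsr; ring.
- move=> e; rewrite -Esr /zz_re_r.
  rewrite (_ : (fun _ => _) = fun z => - i%:R * zz_im i.-1 j z + j%:R * zz_im i j.-1 z).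
    by apply: has_pd_eq (Hr e) _; rewrite /frr; ring.
  by apply/funext => z; rewrite mulNr.
Qed.

(** The weight is at most the degree, and [b - a] is nonpositive, so replacing the weight
    by the degree decreases the value; the result is least in degree [1]. *)
Lemma gap_eigenvalue_ge i j : (0 < n)%N -> 0 < b -> b <= a -> (0 < i + j)%N ->
  a * n%:R + (b - a) <= gap_eigenvalue i j.
Proof.
move=> n0 b0 ba ij; rewrite /gap_eigenvalue natrD.
have k1 : 1 <= i%:R + j%:R :> R by rewrite -natrD ler1n.
have i0 : 0 <= i%:R :> R by []. have j0 : 0 <= j%:R :> R by [].
have M1 : 1 <= n%:R :> R by rewrite ler1n.
move: (i%:R : R) (j%:R : R) (n%:R : R) i0 j0 k1 M1 => I K M I0 K0 k1 M1.
have H1 : (b - a) * (I + K) ^+ 2 <= (b - a) * (I - K) ^+ 2.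
  by rewrite ler_wnM2l ?subr_le0//; nra.
have H2 : a * (I + K) * (I + K - 1 + M) + (b - a) * (I + K) ^+ 2 =
   a * (M - 1) * (I + K) + b * (I + K) ^+ 2 by ring.
have H3 : a * (M - 1) * 1 <= a * (M - 1) * (I + K).
  by rewrite ler_wpM2l// mulr_ge0 ?subr_ge0// (le_trans (ltW b0)).
have H4 : b * 1 <= b * (I + K) ^+ 2 by rewrite ler_wpM2l ?(ltW b0)//; nra.
by lra.
Qed.

Lemma sqn_shift c x : sqn (x - c *: v) = sqn x - 2 * c * cplx_re x + c ^+ 2.
Proof.
have vv : (v *m v^T) 0 0 = 1 by rewrite v1 mxE.
have vx : (v *m x^T) 0 0 = cplx_re x.
  by rewrite /cplx_re -[in RHS](trmxK (x *m v^T)) trmx_mul trmxK [in RHS]mxE.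
rewrite !sqnE linearB /= trmx_scale mulmxBl !mulmxBr -!scalemxAl -!scalemxAr.
have coordE (A B C D : 'M[R]_1) : (A - c *: B - (c *: C - c *: (c *: D))) 0 0 =
  A 0 0 - c * B 0 0 - c * C 0 0 + c ^+ 2 * D 0 0 by rewrite !mxE; ring.
by rewrite coordE vv vx /cplx_re; ring.
Qed.

Lemma re_sq_le x : cplx_re x ^+ 2 <= sqn x.
Proof.
have := sqn_ge0 (x - cplx_re x *: v); rewrite sqn_shift.
by move: (cplx_re x) (sqn x) => s q; nra.
Qed.

Lemma coord_sq_le x c : x 0 c ^+ 2 <= sqn x.
Proof. by rewrite /sqn (bigD1 c)//= lerDl sumr_ge0// => k _; exact: sqr_ge0. Qed.

Section Vanishing.
Variables (F : 'rV[R]_n.+1 -> R) (mu : R).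
Hypotheses (n0 : (0 < n)%N) (b0 : 0 < b) (ba : b <= a) (mu0 : mu != 0) (mu_lt : mu < a * n%:R + (b - a)).
Hypothesis CF : Ck 2 (@nonzero R n) F.
Hypothesis FE : forall x, x != 0 -> op F x = - mu * F x.

(** The approximate integral of [F] against [m], with the weight [cutoff k]. *)
Definition moment (k : nat) (m : 'rV[R]_n.+1 -> R) (j : nat) : R :=
  riemann_sum j (fun x => cutoff k x * (F x * m x)).

Lemma momentD k m m' j : moment k (fun x => m x + m' x) j = moment k m j + moment k m' j.
Proof.
rewrite /moment -riemann_sumD; congr riemann_sum; apply/funext => x.
by rewrite !mulrDr.
Qed.

Lemma momentZ k c m j : moment k (fun x => c * m x) j = c * moment k m j.
Proof.
rewrite /moment -riemann_sumZ; congr riemann_sum; apply/funext => x.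
by move: (cutoff k x) (F x) (m x) => u w' z; ring.
Qed.

(** In degree zero the entry is [0], which differs from [mu]; in higher degree it lies
    above [mu]. *)
Lemma gap_eigenvalue_neq i j : mu - gap_eigenvalue i j != 0.
Proof.
have [/eqP|ij] := posnP (i + j).
  rewrite addn_eq0 => /andP[/eqP -> /eqP ->].
  by rewrite /gap_eigenvalue addn0 mulr0 mul0r subrr expr0n mulr0 add0r subr0.
by rewrite lt_eqF// subr_lt0 (lt_le_trans mu_lt)// gap_eigenvalue_ge.
Qed.

(** By symmetry, [op_zz_re] gives [mu - gap_eigenvalue i j] times the moment of
    [z ^ i * zbar ^ j] in terms of that of [z ^ (i - 1) * zbar ^ (j - 1)]; the factor
    [sqn] is absorbed by the weight [cutoff k.+1]. *)
Lemma moment_zz i j k : moment k (zz_re i j) l @[l --> \oo] --> (0 : R).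
Proof.
have Cz i' j' : Ck 2 (@nonzero R n) (zz_re i' j') by exact: Ck_sub (@subsetT _ _) (Ck_zz_re 2 i' j').
have step i' j' k' l : riemann_sum l (fun x => cutoff k' x *
      (F x * op (zz_re i' j') x - zz_re i' j' x * op F x)) =
    4 * a * i'%:R * j'%:R * moment k'.+1 (zz_re i'.-1 j'.-1) l
    + (mu - gap_eigenvalue i' j') * moment k' (zz_re i' j') l.
  rewrite /moment -!riemann_sumZ -riemann_sumD; congr (riemann_sum l _).
  apply/funext => x; rewrite op_zz_re.
  have -> : cutoff k'.+1 x = sqn x * cutoff k' x by rewrite /cutoff exprS mulrA.
  have [->|x0] := eqVneq x 0.
    by rewrite cutoff_out ?ltW ?annulus_zero// !mulr0 !mul0r !mulr0 addr0.
  rewrite FE//; move: (cutoff k' x) (F x) (zz_re i' j' x) (sqn x) (zz_re _ _ x) => u f z q z'.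
  by ring.
elim: i j k => [|i IH] j k.
  have := riemann_sum_green JT JJ a b CF (Cz 0%N j) k.
  under eq_fun => l do rewrite step mulr0 !mul0r add0r.
  move=> H; have := cvg_scale0 (mu - gap_eigenvalue 0 j)^-1 H.
  by under eq_fun => l do rewrite mulKf ?gap_eigenvalue_neq//.
have := riemann_sum_green JT JJ a b CF (Cz i.+1 j) k.
under eq_fun => l do rewrite step.
move=> H.
have := cvg_scale0 (mu - gap_eigenvalue i.+1 j)^-1
  (cvg_add0 H (cvg_scale0 (- (4 * a * i.+1%:R * j%:R)) (IH j.-1 k.+1))).
apply: cvg_trans; apply: near_eq_cvg; apply: nearW => l /=.
by rewrite mulNr addrAC subrr add0r mulKf ?gap_eigenvalue_neq.
Qed.

(** Multiplication by [Re z] raises one of the two exponents. *)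
Lemma moment_pow m i j k :
  moment k (fun x => (2 + cplx_re x) ^+ m * zz_re i j x) l @[l --> \oo] --> (0 : R).
Proof.
elim: m i j k => [|m IH] i j k.
  have -> : (fun x => (2 + cplx_re x) ^+ 0 * zz_re i j x) = zz_re i j.
    by apply/funext => x; rewrite expr0 mul1r.
  exact: moment_zz.
have E l : moment k (fun x => (2 + cplx_re x) ^+ m.+1 * zz_re i j x) l =
  2 * moment k (fun x => (2 + cplx_re x) ^+ m * zz_re i j x) l +
  2^-1 * (moment k (fun x => (2 + cplx_re x) ^+ m * zz_re i.+1 j x) l +
          moment k (fun x => (2 + cplx_re x) ^+ m * zz_re i j.+1 x) l).
  rewrite -momentD -!momentZ -momentD; congr (moment k _ l).
  apply/funext => x; rewrite exprS mulrAC mulrDl re_zz; ring.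
under eq_fun => l do rewrite E.
exact: cvg_add0 (cvg_scale0 2 (IH i j k))
  (cvg_scale0 2^-1 (cvg_add0 (IH i.+1 j k) (IH i j.+1 k))).
Qed.

End Vanishing.

End TestFunctions.

(** * The spectral gap *)

Section Gap.
Variables (R : realType) (n : nat) (J : 'M[R]_n.+1).
Hypotheses (JT : J^T = - J) (JJ : J *m J = - 1%:M).
Variables (a b : R) (v : 'rV[R]_n.+1).
Hypothesis v1 : v *m v^T = 1%:M.
Variables (F : 'rV[R]_n.+1 -> R) (mu : R).
Hypotheses (n0 : (0 < n)%N) (b0 : 0 < b) (ba : b <= a) (mu0 : mu != 0)
  (mu_lt : mu < a * n%:R + (b - a)).
Hypothesis CF : Ck 2 (@nonzero R n) F.
Hypothesis FE : forall x, x != 0 -> berger_op J a b F x = - mu * F x.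
Local Notation re := (cplx_re v).
Implicit Types (x : 'rV[R]_n.+1) (d : R).

Lemma peak_moment m :
  riemann_sum j (fun x => cutoff 0 x * (F x * (2 + re x) ^+ m)) @[j --> \oo] --> (0 : R).
Proof.
have := moment_pow JT JJ v1 n0 b0 ba mu0 mu_lt CF FE m 0 0 0.
apply: cvg_trans; apply: near_eq_cvg; apply: nearW => j.
congr (riemann_sum j _); apply/funext => x.
by rewrite /zz_re /= mul1r mul0r addr0 mulr1.
Qed.

Lemma Ck0_cut : Ck 0 setT (fun x => cutoff 0 x * F x).
Proof.
have oU := @open_nonzero R n.
apply: Ck_local => x _; have [->|x0] := eqVneq x 0.
  exists [set x : 'rV[R]_n.+1 | annulus_poly x < 0]; first exact: annulus_zero.
  apply: Ck_ext (@open_annulus_out R n) _ (Ck_cst 0 _ 0) => y y0.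
  by rewrite cutoff_out ?mul0r// ltW.
exists (@nonzero R n) => //; apply: Ck_mul => //; last exact: Ck_le CF.
exact: Ck_sub (@subsetT _ _) (CkW (C1_cutoff _ _ 0)).
Qed.

Lemma cut_bounded : exists2 M : R, 0 < M &
  forall x, (forall c, `|x 0 c| <= 2) -> `|cutoff 0 x * F x| <= M.
Proof.
pose K := [set x : 'rV[R]_n.+1 | forall c, `|x 0 c| <= 2].
have cK : compact K by exact: compact_box.
have K0 : K !=set0 by exists 0 => c; rewrite mxE normr0.
have cf : {within K, continuous (fun x => `|cutoff 0 x * F x|)}.
  apply: continuous_subspaceT => x.
  have c0 : {for x, continuous (fun x => cutoff 0 x * F x)} by exact: (Ck_continuous Ck0_cut).
  exact: cvg_norm c0.
have [z _ zP] := EVT_max_rV K0 cK cf.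
exists (`|cutoff 0 z * F z| + 1); first by rewrite ltr_wpDl.
by move=> x xK; rewrite (le_trans (zP x _)) ?lerDl// inE.
Qed.

Local Notation top := ((3 / 2 : R) *: v).

Lemma re_scale (c : R) : re (c *: v) = c.
Proof. by rewrite /cplx_re -scalemxAl v1 mxE mxE eqxx mulr1. Qed.

Lemma sqn_scale (c : R) : sqn (c *: v) = c ^+ 2.
Proof. by rewrite sqnZ sqnE v1 mxE eqxx mulr1. Qed.

Lemma annulus_pos x : 0 < annulus_poly x -> 1 / 4 < sqn x /\ sqn x < 9 / 4.
Proof.
rewrite /annulus_poly; move: (sqn x) (sqn_ge0 x) => s s0 h; split; nra.
Qed.

Lemma re_annulus x : 0 < annulus_poly x -> - (3 / 2) <= re x <= 3 / 2.
Proof.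
move=> /annulus_pos[_ s2]; have := re_sq_le v1 x.
move: (re x) => s h; have : s ^+ 2 <= 9 / 4 by exact: le_trans h (ltW s2).
by move=> h2; apply/andP; split; nra.
Qed.

(** The annulus lies in the ball of radius [3 / 2], which touches the hyperplane
    [re x = 3 / 2] only at [top]. *)
Lemma close_to_top x d : 0 < annulus_poly x -> 3 / 2 - d <= re x ->
  sqn (x - top) <= 3 * d.
Proof.
move=> /annulus_pos[_ s2] rx; rewrite sqn_shift//.
by move: (sqn x) (re x) s2 rx => s r s2 rx; lra.
Qed.

Lemma norm_sq_le x (e : R) : 0 <= e -> sqn x <= e ^+ 2 -> `|x| <= e.
Proof.
move=> e0 xe; apply: norm_le_coord => // c.
rewrite -(ler_pXn2r (n := 2)) ?nnegrE// real_normK ?num_real//.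
exact: le_trans (coord_sq_le x c) xe.
Qed.

(** By continuity [F] keeps its sign near [top], hence by [close_to_top] on the part of
    the annulus where [re] is large enough. *)
Lemma top_sign : F top != 0 -> exists2 d, 0 < d <= 1 / 2 &
  forall x, 0 < annulus_poly x -> 3 / 2 - d <= re x -> F top ^+ 2 / 2 <= F top * F x.
Proof.
set f0 := F top => f0n.
have top0 : nonzero top.
  rewrite /nonzero /= -sqn_eq0 sqn_scale sqrf_eq0.
  by apply/eqP => h; lra.
have h0 : 0 < `|f0| / 2 by rewrite divr_gt0// normr_gt0.
have /cvgrPdist_lt/(_ _ h0)/nbhs_ballP[e /= e0 eP] := Ck_continuous CF top0.
pose d := Num.min (1 / 2) (e ^+ 2 / 12).
have d0 : 0 < d by rewrite lt_min divr_gt0//= divr_gt0// exprn_gt0.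
have d1 : d <= 1 / 2 by rewrite ge_min lexx.
have d2 : d <= e ^+ 2 / 12 by rewrite ge_min lexx orbT.
exists d; first by rewrite d0.
move=> x xa rx; have close := close_to_top xa rx.
have xe : `|x - top| <= e / 2.
  apply: norm_sq_le; first by rewrite divr_ge0// ltW.
  rewrite (le_trans close)// expr_div_n; lra.
have : `|f0 - F x| < `|f0| / 2.
  apply: eP; rewrite -ball_normE/= distrC (le_lt_trans xe)// ltr_pdivrMr//.
  by rewrite mulr_natr mulr2n ltrDl.
move: f0 (F x) f0n {h0 eP top0} => u w u0 uw.
have : `|u * (u - w)| <= u ^+ 2 / 2.
  by rewrite normrM -[u ^+ 2]real_normK ?num_real// expr2 -mulrA ler_wpM2l// ltW.
by rewrite ler_norml => /andP[_]; nra.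
Qed.

(** Otherwise [F * (2 + re) ^+ m] has a definite sign and size at least a constant times
    [K1 ^+ m] on a fixed cube near [top], and size at most a constant times [K2 ^+ m]
    wherever its sign is not known, with [K2 < K1].  For large [m] the cube dominates,
    in contradiction with [peak_moment]. *)
Lemma spectral_gap_point : F top = 0.
Proof.
apply/eqP; apply: contraT => f0n; set f0 := F top in f0n.
have [d /andP[d0 d1] dP] := top_sign f0n.
have [M M0 MP] := cut_bounded.
(* The largest value of [2 + re] on the annulus is [7 / 2]; [K2] bounds it from above
   outside the neighborhood [re >= 3 / 2 - d], and [K1] from below near [z]. *)
pose K1 := 7 / 2 - d / 2; pose K2 := 7 / 2 - d.
have K20 : 0 < K2 by rewrite /K2; lra.
have K12 : K2 < K1 by rewrite /K1 /K2; lra.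
have K10 : 0 < K1 by exact: lt_trans K12.
pose z := (3 / 2 - d / 4) *: v.
have rez : re z = 3 / 2 - d / 4 by exact: re_scale.
have sz : sqn z = (3 / 2 - d / 4) ^+ 2 by exact: sqn_scale.
have az : 0 < annulus_poly z by rewrite /annulus_poly sz; nra.
pose kap := cutoff 0 z.
have kap0 : 0 < kap.
  by rewrite /kap /cutoff expr0 mul1r pos_part_sq_gt ?ltW// exprn_gt0.
have k2 : 0 < kap / 2 by rewrite divr_gt0.
have d4 : 0 < d / 4 by rewrite divr_gt0.
have cre : {for z, continuous re} by exact: (Ck_continuous (Ck_dot 0 v)).
have ccut : {for z, continuous (@cutoff R n.+1 0)} by exact: (Ck_continuous (C1_cutoff _ _ 0)).
move/cvgrPdist_lt: cre => /(_ _ d4) Nre; move/cvgrPdist_lt: ccut => /(_ _ k2) Ncut.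
have : nbhs z ([set t | `|re z - re t| < d / 4] `&` [set t | `|cutoff 0 z - cutoff 0 t| < kap / 2]).
  exact: filterI Nre Ncut.
move=> /nbhs_ballP[e /= e0 eP].
pose eta := Num.min (1 / 4) (e / 2).
have eta0 : 0 < eta by rewrite lt_min !divr_gt0.
have eta1 : eta <= 1 / 4 by rewrite ge_min lexx.
have eta2 : eta < e.
  rewrite (@le_lt_trans _ _ (e / 2)) ?ge_min ?lexx ?orbT// ltr_pdivrMr//.
  by rewrite mulr_natr mulr2n ltrDl.
have zc c : -2 <= z 0 c /\ z 0 c + eta < 2.
  have : z 0 c ^+ 2 <= 9 / 4.
    by rewrite (le_trans (coord_sq_le z c))// sz; nra.
  by move: (z 0 c) => t t2; split; nra.
pose w := f0 ^+ 2 / 2 * (kap / 2).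
have w0 : 0 < w by rewrite mulr_gt0// divr_gt0// exprn_even_gt0.
have f0n' : 0 < `|f0| by rewrite normr_gt0.
pose H m x := f0 * (cutoff 0 x * (F x * (2 + re x) ^+ m)).
have lower m x : (forall c, `|x 0 c| <= 2) -> - (`|f0| * M * K2 ^+ m) <= H m x.
  move=> xb; have P0 : 0 <= `|f0| * M * K2 ^+ m.
    exact: mulr_ge0 (mulr_ge0 (normr_ge0 _) (ltW M0)) (exprn_ge0 _ (ltW K20)).
  have [xa|xa] := leP (annulus_poly x) 0.
    by rewrite /H cutoff_out// mul0r mulr0 oppr_le0.
  have /andP[r1 r2] := re_annulus xa.
  have r3 : 0 <= 2 + re x by lra.
  have [rx|rx] := leP (3 / 2 - d) (re x).
    have HP : 0 <= H m x.
      rewrite /H mulrCA mulr_ge0 ?cutoff_ge0// mulrA mulr_ge0 ?exprn_ge0//.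
      by apply: le_trans (dP x xa rx); rewrite divr_ge0// sqr_ge0.
    by rewrite (le_trans _ HP)// oppr_le0.
  have : `|H m x| <= `|f0| * M * K2 ^+ m.
    rewrite /H (mulrA (cutoff 0 x)) normrM normrM mulrA ler_pM ?mulr_ge0//.
      by rewrite ler_wpM2l// MP.
    rewrite ger0_norm ?exprn_ge0// lerXn2r ?nnegrE ?(ltW K20)//.
    by move: rx; rewrite /K2; lra.
  by rewrite ler_norml => /andP[].
have upper m x : (forall c, `|x 0 c - z 0 c| <= eta) -> w * K1 ^+ m <= H m x.
  move=> xz; have /eP[/= h1 h2] : ball z e x.
    rewrite -ball_normE/= distrC (le_lt_trans _ eta2)//.
    apply: norm_le_coord => [|c]; first exact: ltW.
    by have := xz c; rewrite [(x - z) 0 c]mxE [(- z) 0 c]mxE.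
  have cx : kap / 2 <= cutoff 0 x.
    by move: h2; rewrite -/kap ltr_norml => /andP[_]; move: (cutoff 0 x) => u; lra.
  have xa : 0 < annulus_poly x.
    rewrite ltNge; apply/negP => /(cutoff_out 0) E; move: cx; rewrite E; lra.
  have rx : 3 / 2 - d / 2 <= re x.
    by move: h1; rewrite rez ltr_norml => /andP[_]; move: (re x) => u; lra.
  have rx' : 3 / 2 - d <= re x by lra.
  have := dP x xa rx' => fx.
  have -> : H m x = (f0 * F x) * (cutoff 0 x * (2 + re x) ^+ m).
    by rewrite /H; move: (cutoff 0 x) (F x) (_ ^+ m) => p q r; ring.
  rewrite /w -mulrA ler_pM//; first by rewrite divr_ge0// sqr_ge0.
    by rewrite mulr_ge0 ?exprn_ge0 ?(ltW K10) ?(ltW k2).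
  rewrite ler_pM ?exprn_ge0 ?(ltW K10) ?(ltW k2)//.
  rewrite lerXn2r ?nnegrE ?(ltW K10)//; move: rx; rewrite /K1; lra.
pose c1 := (eta / 2) ^+ n.+1 * w; pose c2 := 4 ^+ n.+1 * (`|f0| * M).
have c10 : 0 < c1 by rewrite mulr_gt0// exprn_gt0// divr_gt0.
have main m : c1 * K1 ^+ m <= c2 * K2 ^+ m.
  apply/ler_addgt0Pr => ep ep0.
  have ef : 0 < ep / `|f0| by rewrite divr_gt0.
  have /cvgrPdist_le/(_ _ ef)[j1 _ j1P] := peak_moment m.
  pose j := (maxn 1 (maxn j1 (Num.truncn (2 / eta)).+1))%N.
  have j0 : (0 < j)%N by rewrite leq_max.
  have jj1 : (j1 <= j)%N by rewrite /j !leq_max leqnn orbT.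
  have jeta : 2 / eta <= j%:R.
    have /andP[_ h] : (Num.truncn (2 / eta))%:R <= 2 / eta < (Num.truncn (2 / eta)).+1%:R.
      by apply: truncn_itv; rewrite divr_ge0// ltW.
    by rewrite (le_trans (ltW h))// ler_nat /j !leq_max leqnn !orbT.
  have := j1P j jj1; rewrite /= sub0r normrN => small.
  pose G x := H m x + `|f0| * M * K2 ^+ m.
  have G0 x : (forall c, `|x 0 c| <= 2) -> 0 <= G x.
    by move=> /(lower m); rewrite /G -subr_ge0 opprK addrC.
  have P0 : 0 <= `|f0| * M * K2 ^+ m.
    exact: mulr_ge0 (mulr_ge0 (normr_ge0 _) (ltW M0)) (exprn_ge0 _ (ltW K20)).
  have Gk x : (forall c, `|x 0 c - z 0 c| <= eta) -> w * K1 ^+ m <= G x.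
    by move=> /(upper m) h; rewrite (le_trans h)// /G lerDl.
  have wK : 0 <= w * K1 ^+ m by rewrite mulr_ge0 ?exprn_ge0 ?(ltW w0) ?(ltW K10).
  have := riemann_sum_lower eta0 zc jeta wK G0 Gk.
  rewrite /G riemann_sumD riemann_sum_cst// /H riemann_sumZ mulrA -/c1 => h.
  rewrite (le_trans h)// addrC (mulrA _ (`|f0| * M)) -/c2 lerD2l.
  rewrite (le_trans (ler_norm _))// normrM mulrC -ler_pdivlMr//.
pose q := K2 / K1.
have q0 : 0 < q by rewrite divr_gt0.
have q1 : `|q| < 1 by rewrite gtr0_norm// ltr_pdivrMr// mul1r.
have c20 : 0 < c2 by rewrite mulr_gt0 ?exprn_gt0// mulr_gt0.
have ec : 0 < c1 / c2 by rewrite divr_gt0.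
have /cvgrPdist_lt/(_ _ ec)[m1 _ /(_ m1 (leqnn _))] := cvg_expr q1.
rewrite /= sub0r normrN ger0_norm ?exprn_ge0 ?(ltW q0)// ltr_pdivlMr// /q expr_div_n.
rewrite mulrAC ltr_pdivrMr ?exprn_gt0// mulrC ltNge.
by rewrite main.
Qed.

End Gap.

(** * The first eigenvalue of a Berger metric *)

Section FirstEigenvalue.
Variables (R : realType) (n : nat) (J : 'M[R]_n.+1).
Hypotheses (JT : J^T = - J) (JJ : J *m J = - 1%:M).
Variables (a b : R).
Hypotheses (n0 : (0 < n)%N) (b0 : 0 < b) (ba : b <= a).
Implicit Types (x : 'rV[R]_n.+1) (y : 'rV[R]_n) (i : 'I_2).
Local Notation S := (sphere R n).
Local Notation op := (berger_op J a b).
Local Notation lam := (a * n%:R + (b - a)).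

Let a0 : 0 < a. Proof. exact: lt_le_trans ba. Qed.

Lemma lam_gt0 : 0 < lam.
Proof.
have M1 : 1 <= n%:R :> R by rewrite ler1n.
have : a * 1 <= a * n%:R by rewrite ler_wpM2l// ltW.
by move: b0; lra.
Qed.

Lemma op_coord (c : 'I_n.+1) x : op (fun z => z 0 c) x = - lam * x 0 c.
Proof.
have E e : pd e (fun z : 'rV[R]_n.+1 => z 0 c) = fun=> (e == c)%:R.
  by apply/funext => z; exact: pd_coord.
rewrite /berger_op big1 => [|d _]; last first.
  by rewrite big1// => e _; rewrite E pd_cst mulr0.
rewrite sub0r mulNr; congr (- (_ * _)).
by under eq_bigr => e _ do rewrite E; rewrite sum_delta.
Qed.

Lemma lam_eigenvalue : laplace_eigenvalue (berger J a b) lam.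
Proof.
exists (fun p : S => (set_val p : 'rV[R]_n.+1) 0 0); split.
- move=> i k; apply: (@Ck_sub _ _ _ setT) => //.
  exact: Ck_stereo_inv.
- exists (param S ord0 0); rewrite set_val_param stereo_inv_head.
  have -> : sqn (0 : 'rV[R]_n) = 0 by apply/eqP; rewrite sqn_eq0.
  by rewrite sub0r add0r invr1 mulr1 mulrN1 oppr_eq0 /pole expr0 oner_eq0.
- move=> i y _.
  have -> : (fun z => (set_val (param S i z) : 'rV[R]_n.+1) 0 0) =
     fun z => stereo_inv (pole R i) z 0 0 by [].
  have := @laplacian_berger _ _ _ JT JJ _ _ a0 b0 i setT (fun x => x 0 0) y openT (Ck_coord _ _ 0) I.
  by move=> ->; rewrite op_coord mulNr addrC subrr.
Qed.

Lemma pd_homogeneous (U : set 'rV[R]_n.+1) (G : 'rV[R]_n.+1 -> R) (c k : R) x e :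
  open U -> Ck 1 U G -> U x -> U (c *: x) -> (forall z, U z -> G (c *: z) = k * G z) ->
  c * pd e G (c *: x) = k * pd e G x.
Proof.
move=> oU CG Ux Ucx GE.
have Cs f : Ck 1 setT (fun z : 'rV[R]_n.+1 => (c *: z) 0 f).
  have -> : (fun z : 'rV[R]_n.+1 => (c *: z) 0 f) = fun z => c * z 0 f.
    by apply/funext => z; rewrite mxE.
  by apply: Ck_scale; [exact: openT|exact: Ck_coord].
have [_ E] := Ck_pd_comp e oU CG Ucx Cs I.
have <- : pd e (fun z => G (c *: z)) x = c * pd e G (c *: x).
  rewrite pdE E -[RHS](sum_delta e (fun f => c * pd f G (c *: x))).
  apply: eq_bigr => f _.
  have -> : (fun z : 'rV[R]_n.+1 => (c *: z) 0 f) = fun z => c * z 0 f.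
    by apply/funext => z; rewrite mxE.
  have [_ ->] := has_pdZ c (has_pd_coord x f e).
  by rewrite eq_sym; ring.
have [_ <-] := has_pdZ k (Ck_has_pd e CG Ux).
by apply: near_eq_pd; apply: near_open_eq oU _ Ux => z Uz; rewrite GE.
Qed.

Lemma symbol_scale c x d e : principal_symbol J a b (c *: x) d e = c ^+ 2 * principal_symbol J a b x d e.
Proof.
rewrite !symbolE sqnZ -scalemxAl.
have sE (w : 'rV[R]_n.+1) f : (c *: w) 0 f = c * w 0 f by rewrite mxE.
rewrite !sE; move: (sqn x) ((x *m J) 0 d) ((x *m J) 0 e) => *; ring.
Qed.

(** The operator does not change the degree of homogeneity: its second-order
    coefficients are quadratic and its first-order ones linear. *)
Lemma op_scale (F : 'rV[R]_n.+1 -> R) c x : 0 < c -> x != 0 ->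
  Ck 2 (@nonzero R n) F -> (forall z, F (c *: z) = F z) ->
  op F (c *: x) = op F x.
Proof.
move=> c0 x0 CF FE; have oU := @open_nonzero R n.
have cn : c != 0 by rewrite gt_eqF.
have nzc (z : 'rV[R]_n.+1) : nonzero z -> nonzero (c *: z).
  by rewrite /nonzero /= scaler_eq0 negb_or cn.
have H1 z e : nonzero z -> pd e F (c *: z) = c^-1 * pd e F z.
  move=> z0; apply: (mulfI cn).
  rewrite (@pd_homogeneous (@nonzero R n) F c 1 z e oU (CkW CF) z0 (nzc _ z0)).
    by rewrite mul1r mulVKf.
  by move=> w _; rewrite mul1r.
have H2 d e : pd d (pd e F) (c *: x) = c^-1 * (c^-1 * pd d (pd e F) x).
  apply: (mulfI cn).
  rewrite (@pd_homogeneous (@nonzero R n) (pd e F) c c^-1 x d oU (Ck_pd e CF) x0 (nzc _ x0)).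
    by rewrite mulVKf.
  by move=> w w0; exact: H1.
have S1 : \sum_d \sum_e principal_symbol J a b (c *: x) d e * pd d (pd e F) (c *: x) =
    \sum_d \sum_e principal_symbol J a b x d e * pd d (pd e F) x.
  apply: eq_bigr => d _; apply: eq_bigr => e _; rewrite H2 symbol_scale.
  by move: (pd d _ _) (principal_symbol _ _ _ _ _ _) => p k; field.
have S2 : \sum_e (c *: x) 0 e * pd e F (c *: x) = \sum_e x 0 e * pd e F x.
  apply: eq_bigr => e _; rewrite (H1 x e x0) [(c *: x) 0 e]mxE.
  by move: (pd _ _ _) => p; field.
by rewrite /berger_op S1 S2.
Qed.

(** For a smaller eigenvalue the gap argument, applied with [v] any point of the sphere,
    shows that the eigenfunction vanishes there. *)
Lemma eigenvalue_ge_lam mu : 0 < mu -> laplace_eigenvalue (berger J a b) mu -> lam <= mu.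
Proof.
move=> mu0 [u [Cu [p up] uE]]; rewrite leNgt; apply/negP => mu_lt.
pose F x := u (radial x).
have CF : Ck 2 (@nonzero R n) F.
  have := @Ck_radial R n 2 setT u openT.
  move=> H; apply: Ck_sub (H _) => [x x0 //|i].
  apply: Ck_sub (Cu i 2%N) => y _; exact: target_sphere.
have FE i y : op F (stereo_inv (pole R i) y) = - mu * F (stereo_inv (pole R i) y).
  have y0 : nonzero (stereo_inv (pole R i) y) by have [] := ray_dom_sigma i y.
  have := @laplacian_berger _ _ _ JT JJ _ _ a0 b0 i _ F y (@open_nonzero R n) CF y0.
  have E : (fun z => F (stereo_inv (pole R i) z)) = fun z => u (param S i z).
    by apply/funext => z; rewrite /F radial_sigma.
  rewrite E => <-; apply/eqP; rewrite mulNr -addr_eq0 /F radial_sigma uE//.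
  exact: target_sphere.
have FE' x : x != 0 -> op F x = - mu * F x.
  move=> x0; have [i xi] := ray_dom_cover x0.
  have c0 : 0 < Num.sqrt (sqn x) by rewrite sqrtr_gt0 sqn_gt0.
  have Ex : x = Num.sqrt (sqn x) *: normalize x.
    by rewrite /normalize scalerA mulfV ?scale1r// gt_eqF.
  have nx : normalize x != 0 by rewrite -sqn_eq0 sqn_normalize// oner_eq0.
  have Fc z : F (Num.sqrt (sqn x) *: z) = F z by rewrite /F radialZ.
  by rewrite Ex op_scale// Fc -(sigma_ray_chart xi) FE.
have v1 : (set_val p : 'rV[R]_n.+1) *m (set_val p)^T = 1%:M.
  by apply/matrixP => i j; rewrite !ord1 -sqnE sqn_sphere mxE eqxx.
have mun : mu != 0 by rewrite gt_eqF.
have := spectral_gap_point JT JJ v1 n0 b0 ba mun mu_lt CF FE'.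
rewrite /F radialZ; last by rewrite divr_gt0.
by rewrite radial_set_val => /eqP; rewrite (negbTE up).
Qed.

Lemma lambda1_berger : lambda1 (berger J a b) = lam.
Proof.
have L : is_lambda1 (berger J a b) lam.
  split; [exact: lam_gt0|exact: lam_eigenvalue|exact: eigenvalue_ge_lam].
rewrite /lambda1; case: xgetP => [l _ [l0 le lm]|/(_ lam)//].
apply/eqP; rewrite eq_le; apply/andP; split; first by apply: lm; have [] := L.
by have [_ _] := L; apply.
Qed.

End FirstEigenvalue.

(** * Killing fields of flat space *)

Section FlatKilling.
Variables (R : realType) (n : nat).
Hypothesis n0 : (0 < n)%N.
Local Notation nonzero := (@nonzero R n).
Implicit Types x y z : 'rV[R]_n.+1.

(** The line through [x] and [y] avoids the origin. *)
Definition independent x y := forall s : R, x + s *: (y - x) != 0.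

Lemma eq_independent (f : 'rV[R]_n.+1 -> R) x y : Ck 1 nonzero f ->
  (forall z c, z != 0 -> pd c f z = 0) -> independent x y -> f x = f y.
Proof.
move=> Cf f0 xy; have H s := Ck_diff (@open_nonzero R n) Cf (xy s).
have dv s : 'D_(y - x) f (x + s *: (y - x)) = 0.
  have [df E] := H s.
  rewrite deriveE// E /= /gradient_form big1// => c _.
  by rewrite f0 ?mulr0//; exact: xy.
have [s _|s _] := @mvt_line R _ f x (y - x) 1.
  by have [df _] := H s; exact: diff_derivable.
by rewrite dv mulr0 scale1r [x + _]addrC subrK => /eqP; rewrite subr_eq0 => /eqP.
Qed.

(** A line avoiding the origin joins every nonzero vector to the first or to the last
    vector of the canonical basis, and another one joins these two. *)
Lemma eq_nonzero (f : 'rV[R]_n.+1 -> R) x y : Ck 1 nonzero f ->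
  (forall z c, z != 0 -> pd c f z = 0) -> x != 0 -> y != 0 -> f x = f y.
Proof.
move=> Cf f0; pose e (c : 'I_n.+1) : 'rV[R]_n.+1 := delta_mx 0 c.
have eE c d : e c 0 d = (d == c)%:R by rewrite mxE eqxx.
have n01 : ord_max != 0 :> 'I_n.+1 by rewrite -val_eqE/= -lt0n.
have lineE (u v : 'rV[R]_n.+1) s d : (u + s *: (v - u)) 0 d = u 0 d + s * (v 0 d - u 0 d).
  by rewrite !mxE.
have indep c d z : c != d -> z 0 c != 0 -> independent (e d) z.
  move=> cd zc s; apply/eqP => /rowP E.
  have := E c; rewrite lineE eE (negbTE cd) subr0 add0r mxE => /eqP.
  rewrite mulf_eq0 (negbTE zc) orbF => /eqP s0.
  by have := E d; rewrite lineE eE eqxx s0 mul0r addr0 mxE => /eqP; rewrite oner_eq0.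
have e01 : f (e 0) = f (e ord_max).
  by apply: eq_independent => //; apply: (@indep ord_max) => //; rewrite eE eqxx oner_eq0.
suff key z : z != 0 -> f z = f (e 0) by move=> /key -> /key ->.
move=> z0; have [[c [c0 zc]]|zc] := pselect (exists c, c != 0 /\ z 0 c != 0).
  by apply/esym/eq_independent => //; exact: indep zc.
rewrite e01; apply/esym/eq_independent => //; apply: (@indep 0); first by rewrite eq_sym.
apply: contra_neq z0 => z00; apply/rowP => c; rewrite [RHS]mxE.
have [->//|c0] := eqVneq c 0.
by apply/eqP; apply: contraPT zc => zc0 /(_ _); apply; exists c.
Qed.

(** The second derivatives are skew in the last two indices and symmetric in the
    first two, hence zero, so the field is affine; being orthogonal to the position
    vector, it has no constant term. *)
Lemma flat_killing (X : 'rV[R]_n.+1 -> 'rV[R]_n.+1) :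
  (forall v, Ck 2 nonzero (fun x => X x 0 v)) ->
  (forall x u v, x != 0 -> pd u (fun z => X z 0 v) x + pd v (fun z => X z 0 u) x = 0) ->
  (forall x, x != 0 -> X x *m x^T = 0) ->
  exists2 A : 'M[R]_n.+1, A^T = - A & forall x, x != 0 -> X x = x *m A.
Proof.
move=> CX K X0; have oU := @open_nonzero R n.
pose e : 'rV[R]_n.+1 := delta_mx 0 0.
have e0 : e != 0 by apply/eqP => /rowP/(_ 0); rewrite !mxE eqxx => /eqP; rewrite oner_eq0.
pose H x u v w := pd u (pd v (fun z => X z 0 w)) x.
have HC x u v w : x != 0 -> H x u v w = H x v u w.
  by move=> x0; exact: (pd_comm _ _ oU (CX w) x0).
have HS x u v w : x != 0 -> H x u v w = - H x u w v.
  move=> x0; apply/eqP; rewrite -addr_eq0; apply/eqP.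
  have d1 := Ck_has_pd u (Ck_pd v (CX w)) x0.
  have d2 := Ck_has_pd u (Ck_pd w (CX v)) x0.
  have [_ E] := has_pdD d1 d2; rewrite /H -E.
  rewrite -(pd_cst 0 x u); apply: near_eq_pd.
  by apply: near_open_eq oU _ x0 => z z0; exact: K.
have H0 x u v w : x != 0 -> H x u v w = 0.
  move=> x0; have hc a b c := HC x a b c x0; have hs a b c := HS x a b c x0.
  move: (H x) hc hs => h hc hs.
  have : h u v w = - h u v w.
    (* Three exchanges of each kind restore the order of the indices. *)
    rewrite {1}(hs u v w) (hc u w v) (hs w u v) (hc w v u) (hs v w u) (hc v u w).
    by rewrite opprK.
  by move=> /eqP; rewrite -addr_eq0 -mulr2n mulrn_eq0 => /eqP.
pose A : 'M[R]_n.+1 := \matrix_(v, w) pd v (fun z => X z 0 w) e.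
have AE x v w : x != 0 -> pd v (fun z => X z 0 w) x = A v w.
  move=> x0; rewrite mxE; apply: (eq_nonzero _ _ x0 e0); first exact: Ck_pd (CX w).
  by move=> z u z0; exact: H0.
have AT : A^T = - A.
  by apply/matrixP => v w; rewrite !mxE; apply/eqP; rewrite -addr_eq0 K.
pose b : 'rV[R]_n.+1 := X e - e *m A.
have Xb x : x != 0 -> X x = x *m A + b.
  move=> x0; apply/rowP => w; apply/eqP; rewrite mxE addrC -subr_eq; apply/eqP.
  have -> : b 0 w = X e 0 w - (e *m A) 0 w by rewrite mxE [X in _ + X]mxE.
  apply: (@eq_nonzero (fun z => X z 0 w - (z *m A) 0 w)) => // [|z u z0].
    by apply: Ck_sub_fun => //; [exact: CkW (CX w)|exact: Ck_sub (Ck_linear _ _ _)].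
  have [_ ->] := has_pdB (Ck_has_pd u (CX w) z0) (has_pd_linear A z u w).
  by rewrite AE// subrr.
have qA x : (x *m A *m x^T) 0 0 = 0.
  have : (x *m A *m x^T)^T = - (x *m A *m x^T).
    by rewrite !trmx_mul trmxK AT mulNmx mulmxN mulmxA.
  move=> /(congr1 (fun M : 'M[R]_1 => M 0 0)); rewrite [LHS]mxE [RHS]mxE.
  by move=> /eqP; rewrite -addr_eq0 -mulr2n mulrn_eq0 => /eqP.
have b0 : b = 0.
  apply/eqP; apply: contraT => b0; have := X0 _ b0.
  rewrite (Xb _ b0) mulmxDl => /(congr1 (fun M : 'M[R]_1 => M 0 0)).
  rewrite mxE qA add0r -sqnE [RHS]mxE => E.
  by have := sqn_gt0 b0; rewrite E ltxx.
by exists A => // x x0; rewrite Xb// b0 addr0.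
Qed.

End FlatKilling.

(** * Charts of the quotient, extended along rays *)

Section RadialExtension.
Variables (R : realType) (n : nat).
Local Notation S := (sphere R n).
Local Notation sigma i := (@stereo_inv R n (pole R i)).
Local Notation D i y := ('J (sigma i) y).
Local Notation q := (@conformal_factor R n).
Local Notation nonzero := (@nonzero R n).
Local Notation norm x := (Num.sqrt (sqn x)).
Implicit Types (x : 'rV[R]_n.+1) (y : 'rV[R]_n).

Lemma norm_gt0 x : x != 0 -> 0 < norm x.
Proof. by move=> x0; rewrite sqrtr_gt0 sqn_gt0. Qed.

Lemma norm_sqr x : norm x ^+ 2 = sqn x.
Proof. by rewrite sqr_sqrtr// sqn_ge0. Qed.

Lemma has_pd_normalize x u v : x != 0 ->
  has_pd (fun z => @normalize R n z 0 v) x u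
    ((norm x)^-1 * ((u == v)%:R - (sqn x)^-1 * (x 0 u * x 0 v))).
Proof.
move=> x0; have s0 := sqn_gt0 x0; have [ds Es] := has_pd_sqn u x.
have [dn En] := pd_sqrt s0 ds; have r0 := norm_gt0 x0.
have H : has_pd (fun z => norm z) x u (x 0 u / norm x).
  split => //; rewrite pdE En Es; move: (norm x) r0 => r r0; field.
  by rewrite gt_eqF.
rewrite (_ : (fun z => normalize z 0 v) = fun z => (norm z)^-1 * z 0 v); last first.
  by apply/funext => z; rewrite mxE.
apply: has_pd_eq (has_pdM (has_pdV (lt0r_neq0 r0) H) (has_pd_coord x v u)) _.
move: (norm_sqr x) r0; move: (sqn x) (x 0 u) (x 0 v) (norm x) => s a b r <- r0.
by field; rewrite gt_eqF.
Qed.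

Lemma ray_dom_nonzero i x : ray_dom i x -> x != 0.
Proof. by case. Qed.

Lemma differentiable_ray_chart i x : ray_dom i x -> differentiable (@ray_chart R n i) x.
Proof.
by move=> xi; apply: (@differentiable_Ck _ _ _ 0 (ray_dom i)) => // [|c];
  [exact: open_ray_dom|exact: Ck_ray_chart].
Qed.

Lemma ray_direction i x : ray_dom i x ->
  x = norm x *: sigma i (ray_chart i x).
Proof.
move=> xi; rewrite sigma_ray_chart// /normalize scalerA divff ?scale1r//.
by rewrite gt_eqF// norm_gt0//; exact: ray_dom_nonzero xi.
Qed.

Lemma ray_normal i x : ray_dom i x -> x *m (D i (ray_chart i x))^T = 0.
Proof.
move=> xi; rewrite [X in X *m _](ray_direction xi) -scalemxAl.
by rewrite -[X in _ *: X]trmxK trmx_mul trmxK stereo_inv_normal trmx0 scaler0.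
Qed.

(** [stereo_inv] after [ray_chart] is the normalization, whose derivative is explicit;
    conformality of [stereo_inv] then isolates the derivative of [ray_chart]. *)
Lemma jacobian_ray_chart i x : ray_dom i x ->
  'J (@ray_chart R n i) x = (q (ray_chart i x) * norm x)^-1 *: (D i (ray_chart i x))^T.
Proof.
move=> xi; have x0 := ray_dom_nonzero xi; have oU := @open_ray_dom R n i.
have dr := differentiable_ray_chart xi.
set y := ray_chart i x; have q0 : q y != 0 by rewrite gt_eqF// conformal_factor_gt0.
have dn : differentiable (@normalize R n) x.
  apply: (@differentiable_Ck _ _ _ 0 nonzero) => //; first exact: open_nonzero.
  by move=> c; exact: Ck_normalize.
have JE : 'J (@normalize R n) x = (norm x)^-1 *: (1%:M - (sqn x)^-1 *: (x^T *m x)).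
  apply/matrixP => u v; apply: etrans (jacobianE u v dn) _.
  have [_ ->] := has_pd_normalize u v x0.
  by rewrite !mxE big_ord1 !mxE.
have ND : 'J (ray_chart i) x *m D i y = 'J (@normalize R n) x.
  rewrite -(jacobian_comp dr (differentiable_stereo_inv i _)).
  apply: near_eq_jacobian => //.
    by apply: filterS (open_nbhs_nbhs (conj oU xi)) => z zi; exact: sigma_ray_chart.
  exact: differentiable_comp dr (differentiable_stereo_inv i _).
have xD := ray_normal xi; rewrite -/y in xD.
have := congr1 (mulmx^~ (D i y)^T) ND; rewrite -mulmxA stereo_inv_conformal JE.
rewrite mul_mx_scalar -scalemxAl mulmxBl mul1mx -scalemxAl -mulmxA xD mulmx0 scaler0 subr0.
by move=> E; rewrite -[LHS](scalerK q0) E scalerA -invfM.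
Qed.

Variables (N : atlas R n) (p : S -> N).
Hypotheses (N_manifold : smooth_manifold N) (p_smooth : smooth_map_on setT p).

(** The chart of the quotient, read on the punctured ambient space and constant on
    rays. *)
Definition lift_chart j x : 'rV[R]_n := chart N j (p (radial x)).

Definition lift_dom j : set 'rV[R]_n.+1 :=
  [set x | nonzero x /\ dom N j (p (radial x))].

Definition local_chart i j y : 'rV[R]_n := chart N j (p (param S i y)).

Definition local_dom i j : set 'rV[R]_n :=
  [set y | setT y /\ dom N j (p (param S i y))].

Lemma open_chart_preimage j : open [set s : S | setT s /\ dom N j (p s)].
Proof.
apply: (open_preimage openT (manifold_dom N_manifold j)) => s _.
by have [+ _] := p_smooth; apply.
Qed.

Lemma open_local_dom i j : open (local_dom i j).
Proof.
apply: (open_preimage (f := fun y => p (param S i y)) openT (manifold_dom N_manifold j)) => y _.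
apply: continuous_comp; first exact: continuous_param.
by have [+ _] := p_smooth; apply.
Qed.

Lemma open_lift_dom j : open (lift_dom j).
Proof.
apply: (open_preimage (f := fun y : 'rV[R]_n.+1 => p (radial y)) (@open_nonzero R n) (manifold_dom N_manifold j)) => y y0.
apply: continuous_comp; first exact: continuous_radial.
by have [+ _] := p_smooth; apply.
Qed.

Lemma Ck_local_chart k i j c : Ck k (local_dom i j) (fun y => local_chart i j y 0 c).
Proof.
have [_ /(_ i j c k)] := p_smooth; apply: Ck_sub => y [_ yj].
by split => //; exact: target_sphere.
Qed.

Lemma Ck_lift_chart k j c : Ck k (lift_dom j) (fun x => lift_chart j x 0 c).
Proof.
have := @Ck_radial R n k [set s : S | setT s /\ dom N j (p s)]
  (fun s => chart N j (p s) 0 c) (open_chart_preimage j).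
move=> H; apply: Ck_sub (H _) => [x [x0 xj]|i]; first by split.
by apply: Ck_sub (Ck_local_chart k i j c) => y [_ [_ yj]].
Qed.

Lemma differentiable_local_chart i j y : local_dom i j y ->
  differentiable (local_chart i j) y.
Proof.
move=> yj; apply: (@differentiable_Ck _ _ _ 0 (local_dom i j)) => // [|c].
  exact: open_local_dom.
exact: Ck_local_chart.
Qed.

Lemma differentiable_lift_chart j x : lift_dom j x ->
  differentiable (lift_chart j) x.
Proof.
move=> xj; apply: (@differentiable_Ck _ _ _ 0 (lift_dom j)) => // [|c].
  exact: open_lift_dom.
exact: Ck_lift_chart.
Qed.

Lemma lift_dom_cover x : x != 0 -> exists j, lift_dom j x.
Proof.
move=> x0; have : (\bigcup_j dom N j) (p (radial x)) by rewrite manifold_cover.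
by move=> [j _ xj]; exists j.
Qed.

Lemma lift_dom_sigma i j y : local_dom i j y -> lift_dom j (sigma i y).
Proof.
move=> [_ yj]; split; first by have [] := ray_dom_sigma i y.
by rewrite radial_sigma.
Qed.

Lemma local_dom_ray i j x : lift_dom j x -> ray_dom i x -> local_dom i j (ray_chart i x).
Proof. by move=> [x0 xj] xi; split => //; rewrite param_ray_chart. Qed.

Lemma jacobian_lift_chart i j x : lift_dom j x -> ray_dom i x ->
  'J (lift_chart j) x = (q (ray_chart i x) * norm x)^-1 *:
    ((D i (ray_chart i x))^T *m 'J (local_chart i j) (ray_chart i x)).
Proof.
move=> xj xi; have yj := local_dom_ray xj xi.
have dr := differentiable_ray_chart xi; have dl := differentiable_local_chart yj.
rewrite scalemxAl -jacobian_ray_chart// -(jacobian_comp dr dl).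
apply: near_eq_jacobian; last exact: differentiable_comp dr dl.
  apply: filterS (open_nbhs_nbhs (conj (@open_ray_dom R n i) xi)) => z zi.
  by rewrite /local_chart param_ray_chart.
exact: differentiable_lift_chart.
Qed.

Lemma jacobian_lift_sigma i j y : local_dom i j y ->
  D i y *m 'J (lift_chart j) (sigma i y) = 'J (local_chart i j) y.
Proof.
move=> yj; have xi := ray_dom_sigma i y; have x1 := sqn_stereo_inv i y.
have E : ray_chart i (sigma i y) = y by rewrite /ray_chart normalize1// stereo_invK.
have q0 : q y != 0 by rewrite gt_eqF// conformal_factor_gt0.
rewrite (jacobian_lift_chart (lift_dom_sigma yj) xi) E x1 sqrtr1 mulr1.
rewrite -scalemxAr mulmxA stereo_inv_conformal mul_scalar_mx scalerA mulVf//.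
exact: scale1r.
Qed.

Lemma radial_kernel j x : lift_dom j x -> x *m 'J (lift_chart j) x = 0.
Proof.
move=> xj; have [i xi] := ray_dom_cover (proj1 xj).
rewrite (jacobian_lift_chart xj xi) -scalemxAr mulmxA ray_normal//.
by rewrite mul0mx scaler0.
Qed.

Variable (h : tensor2 N).
Hypothesis h_induced : pullback_eq p h (round R n).

Lemma local_chart_metric i j y : local_dom i j y ->
  'J (local_chart i j) y *m h j (local_chart i j y) *m ('J (local_chart i j) y)^T
  = (q y)%:M.
Proof.
move=> [_ yj]; rewrite -(stereo_inv_conformal i y).
exact: esym (h_induced (target_sphere i y) yj).
Qed.

(** The Euclidean metric of the ambient space without its radial part, divided by the
    squared distance to the origin. *)
Lemma lift_chart_metric j x : lift_dom j x ->
  'J (lift_chart j) x *m h j (lift_chart j x) *m ('J (lift_chart j) x)^T =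
  (sqn x)^-1 *: (1%:M - (sqn x)^-1 *: (x^T *m x)).
Proof.
move=> xj; have x0 := proj1 xj; have [i xi] := ray_dom_cover x0.
have := local_chart_metric (local_dom_ray xj xi).
have -> : local_chart i j (ray_chart i x) = lift_chart j x.
  by rewrite /local_chart param_ray_chart.
rewrite (jacobian_lift_chart xj xi); set y := ray_chart i x.
set C := 'J _ _ => CE.
have q0 : q y != 0 by rewrite gt_eqF// conformal_factor_gt0.
have r0 := norm_gt0 x0.
have pE := stereo_inv_projection i y.
rewrite trmx_scale trmx_mul trmxK -!scalemxAl -scalemxAr scalerA.
rewrite -!mulmxA [C *m _]mulmxA [C *m _ *m _]mulmxA CE.
rewrite mul_scalar_mx -scalemxAr scalerA.
have -> : 1%:M - (sqn x)^-1 *: (x^T *m x) = (q y)^-1 *: ((D i y)^T *m D i y).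
  rewrite pE [X in X^T](ray_direction xi) [X in _ *m X](ray_direction xi) -/y.
  rewrite trmx_scale -scalemxAl -scalemxAr !scalerA; congr (_ - _).
  rewrite (_ : _ * _ * _ = 1) ?scale1r//.
  move: (norm_sqr x) r0; move: (sqn x) (norm x) => s r <- r0.
  by field; rewrite gt_eqF.
rewrite scalerA; congr (_ *: _).
move: (norm_sqr x) r0 q0; move: (sqn x) (q y) (norm x) => s t r <- r0 t0.
by field; rewrite t0 gt_eqF.
Qed.

(** The dual statement: the inverse metric of the quotient is the push-forward of the
    Euclidean cometric, up to the same factor. *)
Lemma lift_chart_cometric j x : lift_dom j x ->
  sqn x *: (('J (lift_chart j) x)^T *m 'J (lift_chart j) x *m h j (lift_chart j x)) = 1%:M.
Proof.
move=> xj; have x0 := proj1 xj; have [i xi] := ray_dom_cover x0.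
have := local_chart_metric (local_dom_ray xj xi).
have -> : local_chart i j (ray_chart i x) = lift_chart j x.
  by rewrite /local_chart param_ray_chart.
rewrite (jacobian_lift_chart xj xi); set y := ray_chart i x.
set C := 'J _ _ => CE.
have q0 : q y != 0 by rewrite gt_eqF// conformal_factor_gt0.
have r0 := norm_gt0 x0.
have : (q y)^-1 *: (C^T *m C *m h j (lift_chart j x)) = 1%:M.
  rewrite -mulmxA scalemxAl; apply: mulmx1C; rewrite -scalemxAr CE.
  by rewrite scale_scalar_mx mulVf.
set k := (q y * norm x)^-1.
have -> : (k *: ((D i y)^T *m C))^T *m (k *: ((D i y)^T *m C)) = (k * k * q y) *: (C^T *m C).
  rewrite trmx_scale trmx_mul trmxK -scalemxAl -scalemxAr scalerA mulmxA -[C^T *m _ *m _]mulmxA.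
  by rewrite stereo_inv_conformal mul_mx_scalar -scalemxAl scalerA.
rewrite -scalemxAl scalerA => <-; congr (_ *: _); rewrite {}/k.
move: (norm_sqr x) r0 q0; move: (sqn x) (q y) (norm x) => s t r <- r0 t0.
by field; rewrite t0 gt_eqF.
Qed.

End RadialExtension.

(** * The Levi-Civita connection of the quotient *)

Lemma christoffel_lower (R : realType) (n : nat) (g : 'rV[R]_n -> 'M[R]_n) y a b d :
  g y \in unitmx -> (g y)^T = g y ->
  \sum_c christoffel g c a b y * g y c d =
  2^-1 * (pd a (fun z => g z d b) y + pd b (fun z => g z a d) y
          - pd d (fun z => g z a b) y).
Proof.
move=> gu gT; pose t l := pd a (fun z => g z l b) y + pd b (fun z => g z a l) y
          - pd l (fun z => g z a b) y.
have CE c : christoffel g c a b y = 2^-1 * \sum_l invmx (g y) c l * t l by [].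
under eq_bigr do rewrite CE.
rewrite -/(t d); move: t {CE} => t; move: (g y) gu gT => H Hu HT.
have E l : \sum_c invmx H c l * H c d = (l == d)%:R.
  have := congr1 (fun M : 'M[R]_n => M l d) (mulVmx Hu); rewrite !mxE => <-.
  have IT : (invmx H)^T = invmx H by rewrite trmx_inv HT.
  by apply: eq_bigr => c _; rewrite -[in RHS]IT [(_^T) _ _]mxE.
under eq_bigr do rewrite -mulrA mulr_suml.
rewrite -mulr_sumr exchange_big/=; congr (_ * _).
rewrite -(sum_delta d t); apply: eq_bigr => l _.
rewrite -E mulr_sumr; apply: eq_bigr => c _.
by move: (invmx H c l) (t l) (H c d) => u v w; ring.
Qed.

Section LiftedKillingField.
Variables (R : realType) (n : nat).
Local Notation S := (sphere R n).
Local Notation nonzero := (@nonzero R n).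
Variables (N : atlas R n) (p : S -> N).
Hypotheses (N_manifold : smooth_manifold N) (p_smooth : smooth_map_on setT p).
Variable (h : tensor2 N).
Hypotheses (h_metric : riemannian_metric h) (h_induced : pullback_eq p h (round R n)).
Local Notation Q j := (lift_chart p j).
Local Notation O j := (lift_dom p j).
Implicit Types (x : 'rV[R]_n.+1).

Lemma lift_target j x : O j x -> target N j (Q j x).
Proof. by move=> [_ xj]; exists (p (radial x)). Qed.

Lemma metric_unit j z : target N j z -> h j z \in unitmx.
Proof.
move=> zj; rewrite -row_free_unit -kermx_eq0; apply/rowV0P => v /sub_kermxP vh.
apply/eqP; apply: contraT => /(metric_pos h_metric zj).
by rewrite vh mul0mx mxE ltxx.
Qed.

Definition lift_pd j x u c : R := pd u (fun z => Q j z 0 c) x.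

Definition lift_hess j x u v c : R := pd u (fun z => lift_pd j z v c) x.

Lemma jacobian_lift_pd j x u c : O j x -> 'J (Q j) x u c = lift_pd j x u c.
Proof.
by move=> xj; apply: jacobianE; exact: differentiable_lift_chart N_manifold p_smooth _ _ xj.
Qed.

Lemma Ck_lift_pd k j u c : Ck k (O j) (fun x => lift_pd j x u c).
Proof. exact: Ck_pd (Ck_lift_chart N_manifold p_smooth k.+1 j c). Qed.

Lemma lift_hessC j x u v c : O j x -> lift_hess j x u v c = lift_hess j x v u c.
Proof.
move=> xj; have oO := @open_lift_dom _ _ _ _ N_manifold p_smooth j.
exact: (pd_comm u v oO (Ck_lift_chart N_manifold p_smooth 2 j c) xj).
Qed.

Lemma has_pd_lift_pd j x u v c : O j x ->
  has_pd (fun z => lift_pd j z v c) x u (lift_hess j x u v c).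
Proof. by move=> xj; exact: (Ck_has_pd u (Ck_lift_pd 1 j v c) xj). Qed.

Lemma has_pd_lift_comp j x u (f : 'rV[R]_n -> R) : O j x -> Ck 1 (target N j) f ->
  has_pd (fun z => f (Q j z)) x u (\sum_c lift_pd j x u c * pd c f (Q j x)).
Proof.
move=> xj Cf; have CQ c := Ck_lift_chart N_manifold p_smooth 1 j c.
have [df E] := Ck_pd_comp u (@manifold_target _ _ _ N_manifold j) Cf (lift_target xj) CQ xj.
split => //; rewrite pdE E; apply: eq_bigr => c _; exact: mulrC.
Qed.

(** The pull-back of the quotient metric to the punctured ambient space, by
    [lift_chart_metric]. *)
Definition cone_metric x u v : R := (sqn x)^-1 * ((u == v)%:R - (sqn x)^-1 * (x 0 u * x 0 v)).

Lemma cone_metric_lift j x u v : O j x -> cone_metric x u v =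
  \sum_b (\sum_a lift_pd j x u a * h j (Q j x) a b) * lift_pd j x v b.
Proof.
move=> xj; have E : ((sqn x)^-1 *: (1%:M - (sqn x)^-1 *: (x^T *m x))) u v = cone_metric x u v.
  by rewrite !mxE big_ord1 !mxE.
rewrite -E -(lift_chart_metric N_manifold p_smooth h_induced xj).
rewrite mxE; apply: eq_bigr => b _; rewrite [(_^T) _ _]mxE jacobian_lift_pd//.
congr (_ * _); rewrite mxE; apply: eq_bigr => a _.
by rewrite jacobian_lift_pd.
Qed.

Lemma has_pd_cone_metric x w u v : x != 0 -> has_pd (fun z => cone_metric z u v) x w
  (- 2 * x 0 w * (sqn x)^-1 ^+ 2 * (u == v)%:R + 4 * x 0 w * (sqn x)^-1 ^+ 3 * x 0 u * x 0 v
   - (sqn x)^-1 ^+ 2 * ((w == u)%:R * x 0 v + x 0 u * (w == v)%:R)).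
Proof.
move=> x0; have s0 : sqn x != 0 by rewrite gt_eqF// sqn_gt0.
have Hs := has_pdV s0 (has_pd_sqn w x).
apply: has_pd_eq (has_pdM Hs (has_pdB (has_pd_cst (u == v)%:R x w)
  (has_pdM Hs (has_pdM (has_pd_coord x u w) (has_pd_coord x v w))))) _.
move: (sqn x) s0 (x 0 u) (x 0 v) (x 0 w) => s s0 xu xv xw.
move: (w == u)%:R (w == v)%:R (u == v)%:R => e1 e2 e3.
by field.
Qed.

Definition metric_pd j z a b c : R := pd c (fun z => h j z a b) z.

Definition hess_pairing j x u v w : R :=
  \sum_b (\sum_a lift_hess j x u v a * h j (Q j x) a b) * lift_pd j x w b.

Definition metric_pd_pairing j x u v w : R :=
  \sum_b (\sum_a lift_pd j x u a * \sum_c lift_pd j x w c * metric_pd j (Q j x) a b c)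
    * lift_pd j x v b.

Lemma metric_symC j z a b : target N j z -> h j z a b = h j z b a.
Proof. by move=> zj; rewrite -[in LHS](Defs.metric_sym h_metric zj) mxE. Qed.

Lemma pd_cone_metric_lift j x u v w : O j x ->
  pd w (fun z => cone_metric z u v) x =
  hess_pairing j x w u v + metric_pd_pairing j x u v w + hess_pairing j x w v u.
Proof.
move=> xj; have oO := @open_lift_dom _ _ _ _ N_manifold p_smooth j.
have -> : pd w (fun z => cone_metric z u v) x =
    pd w (fun z => \sum_b (\sum_a lift_pd j z u a * h j (Q j z) a b) * lift_pd j z v b) x.
  by apply: near_eq_pd; apply: near_open_eq oO _ xj => z zj; exact: cone_metric_lift.
have Hh a b := has_pd_lift_comp w xj (@metric_smooth _ _ _ _ h_metric j a b 1).
have [_ ->] := has_pd_sum (index_enum _) (fun b => has_pdM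
  (has_pd_sum (index_enum _) (fun a => has_pdM (has_pd_lift_pd w u a xj) (Hh a b)))
  (has_pd_lift_pd w v b xj)).
rewrite /hess_pairing /metric_pd_pairing big_split/=; congr (_ + _).
  rewrite -big_split/=; apply: eq_bigr => b _; rewrite -mulrDl -big_split/=.
  by [].
under eq_bigr do rewrite mulr_suml.
rewrite exchange_big/=; apply: eq_bigr => a _; rewrite mulr_suml; apply: eq_bigr => b _.
rewrite (metric_symC a b (lift_target xj)).
by move: (lift_pd _ _ _ _) (h _ _ _ _) (lift_hess _ _ _ _ _) => r s t; ring.
Qed.

(** The second covariant derivative of the map [Q], from flat space to the quotient. *)
Definition lift_connection j x u v c : R := lift_hess j x u v c +
  \sum_a \sum_b christoffel (h j) c a b (Q j x) * (lift_pd j x u a * lift_pd j x v b).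

(** Lowering its upper index turns a Christoffel symbol into derivatives of the metric
    ([christoffel_lower]). *)
Lemma lift_connection_lower j x u v w : O j x ->
  \sum_d (\sum_c lift_connection j x u v c * h j (Q j x) c d) * lift_pd j x w d =
  hess_pairing j x u v w + 2^-1 * (metric_pd_pairing j x w v u +
    metric_pd_pairing j x u w v - metric_pd_pairing j x u v w).
Proof.
move=> xj; have zj := lift_target xj.
pose T a b d := lift_pd j x u a * lift_pd j x v b * lift_pd j x w d.
have B1 : metric_pd_pairing j x w v u =
    \sum_d \sum_a \sum_b metric_pd j (Q j x) d b a * T a b d.
  rewrite /metric_pd_pairing; under eq_bigr do rewrite mulr_suml.
  rewrite exchange_big/=; apply: eq_bigr => d _.
  rewrite exchange_big/=; apply: eq_bigr => b _.
  rewrite mulr_sumr mulr_suml; apply: eq_bigr => a _; rewrite /T.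
  by move: (metric_pd _ _ _ _ _) => k; ring.
have B2 : metric_pd_pairing j x u w v =
    \sum_d \sum_a \sum_b metric_pd j (Q j x) a d b * T a b d.
  rewrite /metric_pd_pairing; apply: eq_bigr => d _.
  rewrite mulr_suml; apply: eq_bigr => a _.
  rewrite mulr_sumr mulr_suml; apply: eq_bigr => b _; rewrite /T.
  by move: (metric_pd _ _ _ _ _) => k; ring.
have B3 : metric_pd_pairing j x u v w =
    \sum_d \sum_a \sum_b metric_pd j (Q j x) a b d * T a b d.
  rewrite /metric_pd_pairing; under eq_bigr do rewrite mulr_suml.
  rewrite exchange_big/= [RHS]exchange_big/=; apply: eq_bigr => a _.
  rewrite [RHS]exchange_big/=; apply: eq_bigr => b _.
  rewrite mulr_sumr mulr_suml; apply: eq_bigr => d _; rewrite /T.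
  by move: (metric_pd _ _ _ _ _) => k; ring.
rewrite B1 B2 B3 -big_split -sumrB mulr_sumr /hess_pairing -big_split/=.
apply: eq_bigr => d _.
have -> : \sum_c lift_connection j x u v c * h j (Q j x) c d =
    \sum_c lift_hess j x u v c * h j (Q j x) c d +
    \sum_a \sum_b (\sum_c christoffel (h j) c a b (Q j x) * h j (Q j x) c d) *
      (lift_pd j x u a * lift_pd j x v b).
  rewrite /lift_connection; under eq_bigr do rewrite mulrDl.
  rewrite big_split/=; congr (_ + _).
  under eq_bigr do rewrite mulr_suml.
  rewrite exchange_big/=; apply: eq_bigr => a _.
  under eq_bigr do rewrite mulr_suml.
  rewrite exchange_big/=; apply: eq_bigr => b _.
  by rewrite mulr_suml; apply: eq_bigr => c _; rewrite mulrAC.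
rewrite mulrDl; congr (_ + _).
rewrite -big_split -sumrB mulr_sumr mulr_suml; apply: eq_bigr => a _.
rewrite -big_split -sumrB mulr_sumr mulr_suml; apply: eq_bigr => b _.
rewrite christoffel_lower; [|exact: metric_unit|exact: Defs.metric_sym].
rewrite /T /metric_pd /=.
move: (pd a _ _) (pd b _ _) (pd d _ _) (lift_pd _ _ u _) (lift_pd _ _ v _) (lift_pd _ _ w _).
by move=> t1 t2 t3 t4 t5 t6; ring.
Qed.

(** Writing [pd_cone_metric_lift] for three arrangements of the indices and comparing
    with [lift_connection_lower] gives Koszul's formula: the left side, lowered and
    pulled back, is a combination of derivatives of the explicit [cone_metric].  So is
    the right side, and a covector of the quotient is determined by its pull-back. *)
Lemma lift_connectionE j x u v c : O j x ->
  lift_connection j x u v c =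
  - (sqn x)^-1 * (x 0 u * lift_pd j x v c + x 0 v * lift_pd j x u c).
Proof.
move=> xj; have x0 := proj1 xj.
pose Z : 'rV[R]_n := \row_c (lift_connection j x u v c +
  (sqn x)^-1 * (x 0 u * lift_pd j x v c + x 0 v * lift_pd j x u c)).
have ZE a : Z 0 a = lift_connection j x u v a +
  (sqn x)^-1 * (x 0 u * lift_pd j x v a + x 0 v * lift_pd j x u a) by rewrite mxE.
suff Z0 : Z = 0.
  by have := congr1 (fun M : 'rV[R]_n => M 0 c) Z0; rewrite !mxE mulNr => /eqP; rewrite addr_eq0 => /eqP.
have ZK : Z *m h j (Q j x) *m ('J (Q j) x)^T = 0.
  apply/rowP => w; rewrite [RHS]mxE mxE.
  transitivity (\sum_d (\sum_c lift_connection j x u v c * h j (Q j x) c d) * lift_pd j x w d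
    + (sqn x)^-1 * (x 0 u * cone_metric x v w + x 0 v * cone_metric x u w)).
    rewrite !(cone_metric_lift _ _ xj) !mulr_sumr -!big_split/= mulr_sumr -big_split/=.
    apply: eq_bigr => d _; rewrite [(_^T) _ _]mxE jacobian_lift_pd//.
    have -> : (Z *m h j (Q j x)) 0 d = \sum_a lift_connection j x u v a * h j (Q j x) a d +
        \sum_a (sqn x)^-1 * (x 0 u * lift_pd j x v a + x 0 v * lift_pd j x u a) * h j (Q j x) a d.
      rewrite -big_split [LHS]mxE; apply: eq_bigr => a _.
      by rewrite ZE mulrDl.
    rewrite mulrDl; congr (_ + _).
    rewrite !mulrA -mulrDl mulrA; congr (_ * _).
    rewrite [x 0 u * \sum_(_ < _) _]mulr_sumr [x 0 v * \sum_(_ < _) _]mulr_sumr -big_split/= mulr_sumr.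
    apply: eq_bigr => a _.
    by move: (lift_pd j x v a) (lift_pd j x u a) (h _ _ _ _) (sqn x)^-1 => r1 r2 r3 s; ring.
  rewrite lift_connection_lower//.
  have E1 := pd_cone_metric_lift w v u xj; have E2 := pd_cone_metric_lift u w v xj.
  have E3 := pd_cone_metric_lift u v w xj.
  have F1 := has_pd_cone_metric u w v x0; have F2 := has_pd_cone_metric v u w x0.
  have F3 := has_pd_cone_metric w u v x0.
  rewrite (proj2 F1) in E1; rewrite (proj2 F2) in E2; rewrite (proj2 F3) in E3.
  have hC a b c' : hess_pairing j x a b c' = hess_pairing j x b a c'.
    have hE : lift_hess j x a b = lift_hess j x b a.
      by apply/funext => e; exact: (lift_hessC a b e xj).
    rewrite /hess_pairing hE; reflexivity.
  rewrite (hC v u w) in E2; rewrite (hC w u v) (hC w v u) in E3.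
  rewrite (eq_sym w v) in E1; rewrite (eq_sym v u) in E2; rewrite (eq_sym w v) (eq_sym w u) in E3.
  rewrite /cone_metric; move: E1 E2 E3.
  move: (hess_pairing j x u v w) (hess_pairing j x u w v) (hess_pairing j x v w u).
  move: (metric_pd_pairing j x w v u) (metric_pd_pairing j x u w v) (metric_pd_pairing j x u v w).
  move: (sqn x)^-1 (x 0 u) (x 0 v) (x 0 w) (u == v)%:R (u == w)%:R (v == w)%:R.
  move=> s xu xv xw d1 d2 d3 m1 m2 m3 h1 h2 h3 E1 E2 E3.
  have -> : m1 + m2 - m3 = (h2 + m1 + h1) + (h1 + m2 + h3) - (h2 + m3 + h3) - 2 * h1 by ring.
  by rewrite -E1 -E2 -E3; field.
have xK := lift_chart_cometric N_manifold p_smooth h_induced xj.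
rewrite scalemxAl in xK; have hK := mulmx1C xK.
rewrite -[Z]mulmx1 -hK mulmxA -scalemxAr mulmxA ZK mul0mx.
exact: scaler0.
Qed.

End LiftedKillingField.

(** * The lifted Killing field *)

Lemma symmetrized_pairing (R : comPzRingType) (I : finType) (k l w : I -> R)
    (f : I -> I -> R) (G : I -> I -> I -> R) :
  (forall a b, f a b + f b a = \sum_d (G d a b + G d b a) * w d) ->
  \sum_b (\sum_a k a * f a b) * l b + \sum_b (\sum_a l a * f a b) * k b =
  \sum_d w d * (\sum_a \sum_b G d a b * (k a * l b) + \sum_a \sum_b G d a b * (l a * k b)).
Proof.
move=> fG; transitivity (\sum_b \sum_a (f a b + f b a) * (k a * l b)).
  under [X in _ + X = _]eq_bigr do rewrite mulr_suml.
  rewrite [X in _ + X = _]exchange_big/= -big_split/=; apply: eq_bigr => b _.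
  by rewrite mulr_suml -big_split/=; apply: eq_bigr => a _; ring.
rewrite exchange_big/=.
under eq_bigr => a _ do under eq_bigr => b _ do rewrite fG mulr_suml.
under eq_bigr do rewrite exchange_big/=.
rewrite exchange_big/=; apply: eq_bigr => d _.
rewrite [X in _ * (_ + X)]exchange_big/= -big_split/= mulr_sumr; apply: eq_bigr => a _.
by rewrite -big_split/= mulr_sumr; apply: eq_bigr => b _; ring.
Qed.

(** Polarization. *)
Lemma sym_quad_eq0 (R : numDomainType) (n : nat) (M : 'M[R]_n) :
  M^T = M -> (forall x : 'rV[R]_n, x *m M *m x^T = 0) -> M = 0.
Proof.
move=> MT MQ; apply/matrixP => u v; rewrite [RHS]mxE.
pose e s : 'rV[R]_n := delta_mx 0 s.
have quad s t : (e s *m M *m (e t)^T) 0 0 = M s t by rewrite trmx_delta -rowE -colE !mxE.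
have := congr1 (fun B : 'M[R]_1 => B 0 0) (MQ (e u + e v)).
have -> : (e u + e v)^T = (e u)^T + (e v)^T by exact: linearD.
rewrite mulmxDr !mulmxDl !MQ addr0 add0r [LHS]mxE !quad [RHS]mxE.
have -> : M v u = M u v by rewrite -[in LHS]MT mxE.
by move=> /eqP; rewrite -mulr2n mulrn_eq0/= => /eqP.
Qed.

Section LiftedField.
Variables (R : realType) (n : nat).
Local Notation S := (sphere R n).
Local Notation nonzero := (@nonzero R n).
Variables (N : atlas R n) (p : S -> N).
Hypotheses (N_manifold : smooth_manifold N) (p_smooth : smooth_map_on setT p).
Variable (h : tensor2 N).
Hypotheses (h_metric : riemannian_metric h) (h_induced : pullback_eq p h (round R n)).
Local Notation Q j := (lift_chart p j).
Local Notation O j := (lift_dom p j).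
Variables (Y : vector_components N) (c : R).
Hypotheses (Y_field : vector_field Y) (Y_killing : killing h Y).
Hypothesis (Y_length : has_constant_length h Y c).
Implicit Types (x : 'rV[R]_n.+1).

Definition flat_form j z : 'rV[R]_n := Y j z *m h j z.

(** The field on the punctured ambient space that projects onto [Y] and is orthogonal to
    the rays. *)
Definition lift_field j x : 'rV[R]_n.+1 :=
  sqn x *: (flat_form j (Q j x) *m ('J (Q j) x)^T).

Lemma lift_fieldE j x v : O j x ->
  lift_field j x 0 v = sqn x * \sum_b flat_form j (Q j x) 0 b * lift_pd p j x v b.
Proof.
move=> xj; rewrite [LHS]mxE; congr (_ * _); rewrite mxE; apply: eq_bigr => b _.
by rewrite [(_^T) _ _]mxE (jacobian_lift_pd N_manifold p_smooth _ _ xj).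
Qed.

Lemma Ck_flat_form k j b : Ck k (target N j) (fun z => flat_form j z 0 b).
Proof.
have oT := @manifold_target _ _ _ N_manifold j.
rewrite (_ : (fun z => _) = fun z => \sum_a Y j z 0 a * h j z a b).
  apply: Ck_sum => // a; apply: Ck_mul => //; first exact: (field_smooth Y_field).
  exact: (@metric_smooth _ _ _ _ h_metric).
by apply/funext => z; rewrite mxE.
Qed.

Lemma Ck_lift_field k j v : Ck k (O j) (fun x => lift_field j x 0 v).
Proof.
have oO := @open_lift_dom _ _ _ _ N_manifold p_smooth j.
apply: (Ck_ext (f := fun x => sqn x * \sum_b flat_form j (Q j x) 0 b * lift_pd p j x v b)) => //.
  by move=> x xj; rewrite lift_fieldE.
apply: Ck_mul => //; first exact: Ck_sqn.
apply: Ck_sum => // b; apply: Ck_mul => //; last exact: (Ck_lift_pd N_manifold p_smooth).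
apply: (Ck_comp oO (@manifold_target _ _ _ N_manifold j) (Ck_flat_form k j b)).
  by move=> a; exact: (Ck_lift_chart N_manifold p_smooth).
by move=> x xj; exact: lift_target.
Qed.

Definition flat_form_pd j z a b : R := pd a (fun z => flat_form j z 0 b) z.

Lemma flat_form_killing j z a b : target N j z ->
  flat_form_pd j z a b + flat_form_pd j z b a =
  \sum_d (christoffel (h j) d a b z + christoffel (h j) d b a z) * flat_form j z 0 d.
Proof.
move=> zj; have := Y_killing a b zj; rewrite /= /covariant_derivative.
under [X in _ -> _ = X]eq_bigr do rewrite mulrDl.
rewrite big_split/= -/(flat_form_pd j z a b) -/(flat_form_pd j z b a) /flat_form.
move: (flat_form_pd _ _ _ _) (flat_form_pd _ _ _ _) (\sum_d _ * _) (\sum_d _ * _).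
by move=> s t u v E; apply/eqP; rewrite -subr_eq0 -E; apply/eqP; ring.
Qed.

Lemma has_pd_lift_field j x u v : O j x ->
  has_pd (fun z => lift_field j z 0 v) x u
    (2 * x 0 u * (\sum_b flat_form j (Q j x) 0 b * lift_pd p j x v b) +
     sqn x * (\sum_b ((\sum_a lift_pd p j x u a * flat_form_pd j (Q j x) a b) * lift_pd p j x v b
       + flat_form j (Q j x) 0 b * lift_hess p j x u v b))).
Proof.
move=> xj; have oO := @open_lift_dom _ _ _ _ N_manifold p_smooth j.
have H b := has_pd_lift_comp N_manifold p_smooth u xj (Ck_flat_form 1 j b).
have [_ E] := has_pdM (has_pd_sqn u x) (has_pd_sum (index_enum _) (fun b => has_pdM (H b)
  (has_pd_lift_pd N_manifold p_smooth u v b xj))).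
split; first exact: (Ck_has_pd u (Ck_lift_field 1 j v) xj).1.
rewrite -[RHS]E; apply: near_eq_pd; apply: near_open_eq oO _ xj => z zj.
exact: lift_fieldE.
Qed.

(** The Killing equation of [Y] supplies the symmetrized derivative of its dual form in
    terms of Christoffel symbols; together with the second derivatives of the chart
    these make up [lift_connection], whose explicit value cancels the derivative of
    the factor [sqn]. *)
Lemma lift_field_killing j x u v : O j x ->
  pd u (fun z => lift_field j z 0 v) x + pd v (fun z => lift_field j z 0 u) x = 0.
Proof.
move=> xj; have x0 := proj1 xj.
rewrite (has_pd_lift_field u v xj).2 (has_pd_lift_field v u xj).2.
have K : \sum_b (\sum_a lift_pd p j x u a * flat_form_pd j (Q j x) a b) * lift_pd p j x v b +
    \sum_b (\sum_a lift_pd p j x v a * flat_form_pd j (Q j x) a b) * lift_pd p j x u b =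
    \sum_d flat_form j (Q j x) 0 d *
      (\sum_a \sum_b christoffel (h j) d a b (Q j x) * (lift_pd p j x u a * lift_pd p j x v b) +
       \sum_a \sum_b christoffel (h j) d a b (Q j x) * (lift_pd p j x v a * lift_pd p j x u b)).
  exact: symmetrized_pairing (fun a b => flat_form_killing a b (lift_target xj)).
pose W u v d := lift_connection p h j x u v d.
have WE : \sum_d flat_form j (Q j x) 0 d * (W u v d + W v u d) =
   - 2 * (sqn x)^-1 * (x 0 u * (\sum_b flat_form j (Q j x) 0 b * lift_pd p j x v b) +
      x 0 v * (\sum_b flat_form j (Q j x) 0 b * lift_pd p j x u b)).
  rewrite !mulr_sumr -big_split/= mulr_sumr; apply: eq_bigr => d _.
  rewrite /W !(lift_connectionE N_manifold p_smooth h_metric h_induced _ _ _ xj).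
  move: (flat_form _ _ _ _) (lift_pd _ _ _ u _) (lift_pd _ _ _ v _) (sqn x)^-1.
  by move=> s t w z; ring.
have WK : \sum_d flat_form j (Q j x) 0 d * (W u v d + W v u d) =
    \sum_d flat_form j (Q j x) 0 d * lift_hess p j x u v d +
    \sum_d flat_form j (Q j x) 0 d * lift_hess p j x v u d +
    \sum_d flat_form j (Q j x) 0 d *
      (\sum_a \sum_b christoffel (h j) d a b (Q j x) * (lift_pd p j x u a * lift_pd p j x v b) +
       \sum_a \sum_b christoffel (h j) d a b (Q j x) * (lift_pd p j x v a * lift_pd p j x u b)).
  rewrite -!big_split/=; apply: eq_bigr => d _; rewrite /W /lift_connection.
  have E (s t w y z : R) : s * ((t + y) + (w + z)) = s * t + s * w + s * (y + z) by ring.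
  exact: E.
have s0 : sqn x != 0 by rewrite gt_eqF// sqn_gt0.
have E (s xu xv A A' B B' D t1 t2 : R) : s != 0 -> A + A' = D ->
    - 2 * s^-1 * (xu * t1 + xv * t2) = B + B' + D ->
    2 * xu * t1 + s * (A + B) + (2 * xv * t2 + s * (A' + B')) = 0.
  move=> z0 AD BD; have -> : 2 * xu * t1 + s * (A + B) + (2 * xv * t2 + s * (A' + B')) =
    2 * (xu * t1 + xv * t2) + s * (B + B' + (A + A')) by ring.
  by rewrite AD -BD; field.
rewrite [X in _ + _ * X + _]big_split [X in _ + (_ + _ * X)]big_split.
exact: (E _ _ _ _ _ _ _ _ _ _ s0 K (etrans (esym WE) WK)).
Qed.

Lemma open_transition_dom i j : open [set z | target N i z /\ dom N j (param N i z)].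
Proof.
apply: (open_preimage (@manifold_target _ _ _ N_manifold i) (@manifold_dom _ _ _ N_manifold j)).
exact: (@manifold_param_cont _ _ _ N_manifold i).
Qed.

Lemma transition_lift i j x : O i x -> O j x ->
  [/\ target N i (Q i x), dom N j (param N i (Q i x)) & transition N i j (Q i x) = Q j x].
Proof.
move=> xi xj; have K : param N i (Q i x) = p (radial x).
  by rewrite /lift_chart manifold_paramK//; case: xi.
split; first exact: lift_target xi.
  by rewrite K; case: xj.
by rewrite /transition K.
Qed.

(** The transformation laws of [Y], of the metric and of the Jacobian cancel. *)
Lemma lift_field_eq i j x : O i x -> O j x -> lift_field i x = lift_field j x.
Proof.
move=> xi xj; have [ti dj tE] := transition_lift xi xj.
pose T := transition N i j.
have dT : differentiable T (Q i x).
  apply: (@differentiable_Ck _ _ _ 0 _ _ _ (@open_transition_dom i j)) => // a.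
  exact: (@manifold_transition _ _ _ N_manifold).
have dQi := differentiable_lift_chart N_manifold p_smooth xi.
have dQj := differentiable_lift_chart N_manifold p_smooth xj.
have JE : 'J (Q j) x = 'J (Q i) x *m 'J T (Q i x).
  rewrite -(jacobian_comp dQi dT).
  have dTQ : differentiable (fun z => T (Q i z)) x by exact: (differentiable_comp dQi dT).
  apply: near_eq_jacobian => //.
  have oi := @open_lift_dom _ _ _ _ N_manifold p_smooth i.
  have oj := @open_lift_dom _ _ _ _ N_manifold p_smooth j.
  apply: filterS (filterI (open_nbhs_nbhs (conj oi xi)) (open_nbhs_nbhs (conj oj xj))).
  by move=> z [zi zj]; have [_ _ E] := transition_lift zi zj; exact: esym E.
have hE : h i (Q i x) = 'J T (Q i x) *m h j (Q j x) *m ('J T (Q i x))^T.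
  by rewrite -tE; exact: (metric_tensor h_metric ti dj).
have YE : Y j (Q j x) = Y i (Q i x) *m 'J T (Q i x).
  by rewrite -tE; exact: (field_tensor Y_field ti dj).
by rewrite /lift_field /flat_form JE hE YE trmx_mul !mulmxA.
Qed.

Lemma lift_field_radial j x : O j x -> lift_field j x *m x^T = 0.
Proof.
move=> xj; rewrite /lift_field -scalemxAl -mulmxA -trmx_mul.
by rewrite (radial_kernel N_manifold p_smooth xj) trmx0 mulmx0 scaler0.
Qed.

(** The length is a square root, which determines its argument because the metric is
    nonnegative. *)
Lemma constant_length_sqr j z : target N j z -> Y j z *m h j z *m (Y j z)^T = (c ^+ 2)%:M.
Proof.
move=> zj; rewrite [LHS]mx11_scalar -(Y_length zj) sqr_sqrtr//.
have [->|Y0] := eqVneq (Y j z) 0; first by rewrite !mul0mx mxE.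
exact/ltW/(metric_pos h_metric).
Qed.

Lemma lift_field_sqn j x : O j x ->
  lift_field j x *m (lift_field j x)^T = (c ^+ 2 * sqn x)%:M.
Proof.
move=> xj; have zj := lift_target xj.
have hT := Defs.metric_sym h_metric zj.
have xK := lift_chart_cometric N_manifold p_smooth h_induced xj.
rewrite /lift_field trmx_scale -scalemxAl -scalemxAr trmx_mul trmxK.
rewrite /flat_form trmx_mul hT.
move: xK (constant_length_sqr zj); move: (Y j _) (h j _) ('J _ _) => V H K xK VE.
have -> : V *m H *m K^T *m (K *m (H *m V^T)) = V *m H *m (K^T *m K *m H) *m V^T.
  by rewrite !mulmxA.
have -> : sqn x *: (V *m H *m (K^T *m K *m H) *m V^T) = (c ^+ 2)%:M.
  by rewrite scalemxAl [sqn x *: (_ *m _)]scalemxAr xK mulmx1.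
by rewrite scale_scalar_mx mulrC.
Qed.

Hypotheses (n0 : (0 < n)%N) (c0 : c != 0).

(** The lifted field is [x |-> x *m A] with [A] skew; by [lift_field_sqn] the quadratic
    form of [A *m A^T] is [c ^+ 2] times the Euclidean one, so [J = c^-1 *: A] is a
    complex structure.  The last clause says that the Hopf form of [J] is pulled back
    from the quotient. *)
Lemma killing_complex_structure : exists J : 'M[R]_n.+1,
  [/\ J^T = - J, J *m J = - 1%:M &
    forall i j y, local_dom p i j y -> hopf_form J i y =
      c^-1 *: (flat_form j (local_chart p i j y) *m ('J (local_chart p i j) y)^T)].
Proof.
pose X x := if pselect (exists j, O j x) is left H then lift_field (projT1 (cid H)) x else 0.
have XE j x : O j x -> X x = lift_field j x.
  move=> xj; rewrite /X; case: pselect => [H|]; last by case; exists j.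
  by apply: lift_field_eq => //; case: cid.
have cover x : x != 0 -> exists j, O j x by exact: lift_dom_cover.
have nearX j x v : O j x -> \near x, X x 0 v = lift_field j x 0 v.
  move=> xj; have oO := @open_lift_dom _ _ _ _ N_manifold p_smooth j.
  by apply: near_open_eq oO _ xj => z zj; rewrite (XE j).
have CX v : Ck 2 nonzero (fun x => X x 0 v).
  apply: Ck_local => x /cover[j xj]; exists (O j) => //.
  have oO := @open_lift_dom _ _ _ _ N_manifold p_smooth j.
  by apply: (Ck_ext oO) (Ck_lift_field 2 j v) => z zj; rewrite (XE j).
have KX x u v : x != 0 -> pd u (fun z => X z 0 v) x + pd v (fun z => X z 0 u) x = 0.
  move=> /cover[j xj]; rewrite -[RHS](lift_field_killing u v xj); congr (_ + _).
    exact: near_eq_pd (nearX _ _ _ xj).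
  exact: near_eq_pd (nearX _ _ _ xj).
have X0 x : x != 0 -> X x *m x^T = 0.
  by move=> /cover[j xj]; rewrite (XE j)//; exact: lift_field_radial.
have [A AT XA] := flat_killing n0 CX KX X0.
have AA : A *m A^T = (c ^+ 2)%:M.
  pose M := A *m A^T - (c ^+ 2)%:M; have MT : M^T = M.
    by rewrite /M linearB/= trmx_mul trmxK tr_scalar_mx.
  have MQ x : x *m M *m x^T = 0.
    have [->|x0] := eqVneq x 0; first by rewrite !mul0mx.
    have [j xj] := cover _ x0; have := lift_field_sqn xj.
    rewrite -(XE j)// XA// trmx_mul /M mulmxBr mulmxBl => E.
    rewrite !mulmxA in E *; rewrite E mul_mx_scalar -scalemxAl.
    by rewrite [x *m x^T]mx11_scalar -sqnE scale_scalar_mx subrr.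
  have /eqP := sym_quad_eq0 MT MQ.
  by rewrite subr_eq0 => /eqP.
exists (c^-1 *: A); split.
- by rewrite trmx_scale AT scalerN.
- rewrite -scalemxAl -scalemxAr scalerA -[in X in _ *m X](opprK A) -AT mulmxN AA.
  by rewrite scalerN scale_scalar_mx -expr2 exprVn mulVf// expf_neq0.
- move=> i j y yj; have xj := lift_dom_sigma yj.
  rewrite /hopf_form -scalemxAr -scalemxAl; congr (_ *: _).
  rewrite -XA; last exact: (proj1 xj).
  rewrite (XE j)// /lift_field sqn_stereo_inv scale1r -mulmxA -trmx_mul.
  rewrite (jacobian_lift_sigma N_manifold p_smooth yj).
  by rewrite /lift_chart radial_sigma.
Qed.

End LiftedField.

(** * Invariance under the group *)

Lemma open_sphere_dom (R : realType) (n : nat) k : open (dom (sphere R n) k).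
Proof.
exists [set x : 'rV[R]_n.+1 | setT x /\ [set r : R | r != pole R k] (x 0 0)].
  apply: (open_preimage (f := fun x : 'rV[R]_n.+1 => x 0 0) openT); first exact: open_neq.
  by move=> x _; exact: coord_continuous.
by apply/seteqP; split => s; [case|split].
Qed.

Section BergerInvariance.
Variables (R : realType) (n : nat).
Local Notation S := (sphere R n).
Variables (N : atlas R n) (p : S -> N).
Hypotheses (N_manifold : smooth_manifold N) (p_smooth : smooth_map_on setT p).
Variables (J : 'M[R]_n.+1) (w : 'I_(nchart N) -> 'rV[R]_n -> 'rV[R]_n).
Hypothesis hopf_descends : forall i j y, local_dom p i j y ->
  hopf_form J i y = w j (local_chart p i j y) *m ('J (local_chart p i j) y)^T.

(** [F] covers the identity of the quotient, so it preserves forms pulled back from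
    there, such as the Hopf form. *)
Lemma pullback_berger a b (F : S -> S) : smooth_map_on setT F ->
  (forall s, p (F s) = p s) -> pullback_eq F (round R n) (round R n) ->
  pullback_eq F (berger J a b) (berger J a b).
Proof.
move=> F_smooth pF F_round i k y ty dy Fik.
have [cF CF] := F_smooth.
pose U : set 'rV[R]_n := [set z | [/\ target S i z, setT (param S i z) & dom S k (F (param S i z))]].
have oU : open U.
  rewrite (_ : U = [set z | setT z /\ F (param S i z) \in dom S k]).
    apply: (open_preimage (f := fun z => F (param S i z)) (B := [set s | s \in dom S k]) openT).
      rewrite (_ : (fun s => _) = dom S k); first exact: open_sphere_dom.
      by apply/funext => s; rewrite inE.
    move=> z _; apply: continuous_comp; first exact: continuous_param.
    exact: cF.
  apply/seteqP; split => z /=; rewrite inE; first by move=> [].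
  by move=> [_ dz]; split => //; exact: target_sphere.
have Uy : U y by [].
have dF : differentiable Fik y by apply: (@differentiable_Ck _ _ _ 0 U) => // c; exact: CF.
have rE := F_round i k y ty dy; rewrite -/Fik in rE.
have [j yj] : exists j, dom N j (p (param S i y)).
  have : (\bigcup_j dom N j) (p (param S i y)) by rewrite manifold_cover.
  by move=> [j _ H]; exists j.
have li : local_dom p i j y by [].
have FE z : U z -> p (param S k (Fik z)) = p (param S i z).
  by move=> [_ _ dz]; rewrite /Fik param_chart.
have lk : local_dom p k j (Fik y) by split => //; rewrite FE.
have dli := differentiable_local_chart N_manifold p_smooth li.
have dlk := differentiable_local_chart N_manifold p_smooth lk.
have JE : 'J (local_chart p i j) y = 'J Fik y *m 'J (local_chart p k j) (Fik y).
  rewrite -(jacobian_comp dF dlk).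
  have dc : differentiable (fun z => local_chart p k j (Fik z)) y by exact: differentiable_comp dF dlk.
  apply: near_eq_jacobian => //; apply: filterS (open_nbhs_nbhs (conj oU Uy)) => z Uz.
  by rewrite /local_chart FE.
have lE : local_chart p i j y = local_chart p k j (Fik y) by rewrite /local_chart FE.
have wE : hopf_form J i y = hopf_form J k (Fik y) *m ('J Fik y)^T.
  by rewrite (hopf_descends li) (hopf_descends lk) JE lE trmx_mul mulmxA.
have bE l z : berger J a b l z = a^-1 *: round R n l z +
    (b^-1 - a^-1) *: ((hopf_form J l z)^T *m hopf_form J l z) by [].
rewrite !bE rE wE; move: (round R n k _) (hopf_form J k _) ('J Fik y) => r f T.
rewrite mulmxDr mulmxDl -!scalemxAr -!scalemxAl; congr (_ + _ *: _).
by rewrite trmx_mul trmxK !mulmxA.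
Qed.

Hypotheses (JT : J^T = - J) (JJ : J *m J = - 1%:M).

Lemma berger_pos a b i y (v : 'rV[R]_n) : 0 < b -> b <= a -> v != 0 ->
  0 < (v *m berger J a b i y *m v^T) 0 0.
Proof.
move=> b0 ba v0; have a0 : 0 < a by exact: lt_le_trans ba.
have q0 := conformal_factor_gt0 y.
rewrite bergerE mulmxDr mulmxDl mul_mx_scalar -scalemxAl -scalemxAr -scalemxAl.
move: (hopf_form J i y) => f.
have -> : v *m (f^T *m f) *m v^T = (v *m f^T) *m (v *m f^T)^T.
  by rewrite trmx_mul trmxK !mulmxA.
rewrite [X in 0 < X]mxE [X in 0 < X + _]mxE [X in 0 < _ + X]mxE -!sqnE.
apply: ltr_pwDl; first by rewrite mulr_gt0// ?sqn_gt0// divr_gt0.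
by rewrite mulr_ge0// ?sqn_ge0// subr_ge0 lef_pV2.
Qed.

End BergerInvariance.

(** * Volume *)

Lemma row_mx_head (R : Type) (n : nat) (x : 'M[R]_1) (v : 'rV[R]_n) :
  (row_mx x v : 'rV[R]_n.+1) 0 ord0 = x 0 0.
Proof. by rewrite -[RHS](row_mxEl x v); congr (row_mx _ _ _ _); exact: val_inj. Qed.

Lemma row_mx_tail (R : Type) (n : nat) (x : 'M[R]_1) (v : 'rV[R]_n) (k : 'I_n) :
  (row_mx x v : 'rV[R]_n.+1) 0 (lift ord0 k) = v 0 k.
Proof. by rewrite -[RHS](row_mxEr x v); congr (row_mx _ _ _ _); exact: val_inj. Qed.

Section IteratedIntegral.
Variable R : realType.
Local Open Scope ereal_scope.

(** The integral of a nonnegative function is a supremum over the simple functions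
    below it, hence monotone without any measurability. *)
Lemma le_integral_pointwise (f g : R -> \bar R) :
  (forall t, 0 <= f t) -> (forall t, f t <= g t) ->
  \int[@lebesgue_measure R]_t f t <= \int[@lebesgue_measure R]_t g t.
Proof.
move=> f0 fg; have g0 t : 0 <= g t by exact: le_trans (fg t).
rewrite !ge0_integralTE//; apply: le_ereal_sup => _ [h hf <-]; exists h => //.
by move=> t; exact: le_trans (hf t) (fg t).
Qed.

Lemma le_lebesgue_int n (f g : 'rV[R]_n -> \bar R) :
  (forall y, 0 <= f y) -> (forall y, f y <= g y) ->
  0 <= lebesgue_int f /\ lebesgue_int f <= lebesgue_int g.
Proof.
elim: n f g => [|n IH] f g f0 fg /=; first by split.
have f1 t := IH (fun v => f (row_mx t%:M v)) _ (fun v => f0 _) (fun v => fg _).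
split; first by apply: integral_ge0 => t _; case: (f1 t).
by apply: le_integral_pointwise => t; case: (f1 t).
Qed.

(** The iterated integral of a product function splits off one factor at a time. *)
Lemma lebesgue_int_prod n (phi : R -> R) (I c : R) :
  measurable_fun setT phi -> (forall t, 0 <= phi t)%R ->
  \int[@lebesgue_measure R]_t (phi t)%:E = I%:E -> (0 <= c)%R ->
  lebesgue_int (fun y : 'rV[R]_n => (c * \prod_k phi (y 0 k))%:E) = (c * I ^+ n)%:E.
Proof.
move=> mphi phi0 phiI; have I0 : (0 <= I)%R.
  by rewrite -lee_fin -phiI; apply: integral_ge0 => t _; rewrite lee_fin.
elim: n c => [|n IH] c c0 /=; first by rewrite big_ord0 expr0.
under eq_integral => t _.
  rewrite (_ : (fun v => _) =
      (fun v : 'rV[R]_n => ((c * phi t) * \prod_k phi (v 0 k))%:E)); last first.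
    apply/funext => v; congr _%:E; rewrite big_ord_recl -mulrA; congr (_ * (_ * _))%R.
      by rewrite row_mx_head mxE eqxx mulr1n.
    by apply: eq_bigr => k _; rewrite row_mx_tail.
  rewrite IH ?mulr_ge0// (_ : (_ * _ * _)%:E = (c * I ^+ n)%:E * (phi t)%:E); last first.
    by rewrite -EFinM mulrAC.
  over.
rewrite ge0_integralZl//; last 2 first.
- by move=> t _; rewrite lee_fin.
- by rewrite lee_fin mulr_ge0// exprn_ge0.
- by rewrite phiI -EFinM -mulrA -exprSr.
exact/measurable_EFinP.
Qed.

Lemma integral_cauchy_density :
  exists I : R, \int[@lebesgue_measure R]_t (2 * (oneDsqr t)^-1)%:E = I%:E.
Proof.
exists (2 * pi)%R; have d0 (t : R) : (0 <= (oneDsqr t)^-1)%R.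
  by rewrite invr_ge0 (le_trans _ (oneDsqr_ge1 t)).
under eq_integral do rewrite EFinM.
rewrite ge0_integralZl//.
- rewrite (@ge0_symfun_integralT R (fun t => (oneDsqr t)^-1)%R)//; last 2 first.
  + exact: continuous_oneDsqrV.
  + by move=> t /=; rewrite /oneDsqr sqrrN.
  rewrite (_ : [set x | (0 <= x)%R] = `[0%R, +oo[%classic); last first.
    by apply/seteqP; split => t /=; rewrite in_itv/= andbT.
  by rewrite integral0y_oneDsqr -!EFinM; congr _%:E; field.
apply/measurable_EFinP; apply: continuous_measurable_fun.
exact: continuous_oneDsqrV.
Qed.

End IteratedIntegral.

Section BergerVolume.
Variables (R : realType) (n : nat).
Local Notation q := (@conformal_factor R n).
Local Notation S := (sphere R n).

(** Sylvester's identity, from two triangular factorizations of one block matrix.  The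
    factor [al] is kept on the left to avoid the exponent [n - 1]. *)
Lemma det_rank_one (al be : R) (w : 'rV[R]_n) : al != 0 ->
  \det (al%:M + be *: (w^T *m w)) * al = (al + be * sqn w) * al ^+ n.
Proof.
move=> al0; pose B : 'M[R]_(1 + n) := block_mx 1%:M w (- be *: w^T) al%:M.
have BL : B = block_mx 1%:M 0 (- be *: w^T) 1%:M *m block_mx 1%:M w 0 (al%:M + be *: (w^T *m w)).
  rewrite mulmx_block !mul1mx !mul0mx ?mulmx1 ?mulmx0 ?addr0 ?add0r.
  by congr block_mx; rewrite -scalemxAl scaleNr addrCA addNr addr0.
have BU : B *m block_mx al%:M 0 (be *: w^T) 1%:M = block_mx ((al + be * sqn w)%:M) w 0 al%:M.
  rewrite mulmx_block !mul1mx ?mulmx0 ?mulmx1 ?add0r; congr block_mx.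
    by rewrite -scalemxAr [w *m w^T]mx11_scalar -sqnE scale_scalar_mx -raddfD.
  by rewrite mul_mx_scalar scalerA mul_scalar_mx scalerA mulrN scaleNr addNr.
have dB : \det B = \det (al%:M + be *: (w^T *m w)).
  by rewrite BL det_mulmx det_lblock det_ublock !det1 !mul1r.
have := congr1 determinant BU.
by rewrite det_mulmx det_lblock det_ublock det1 !det_scalar mulr1 expr1 dB.
Qed.

Variables (J : 'M[R]_n.+1).
Hypotheses (JT : J^T = - J) (JJ : J *m J = - 1%:M).

(** The eigenvalues are [q / a], with multiplicity [n - 1], and [q / b] along the Hopf
    form; this choice of [b] makes their product independent of [a]. *)
Lemma det_berger a i y : 0 < a -> \det (berger J a (a / a ^+ n) i y) = q y ^+ n.
Proof.
move=> a0; have q0 := conformal_factor_gt0 y.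
have al0 : q y / a != 0 by rewrite gt_eqF// divr_gt0.
apply: (mulIf al0); rewrite bergerE det_rank_one//.
rewrite (_ : sqn (hopf_form J i y) = q y); last first.
  by rewrite sqnE (hopf_form_sqn JT JJ) mxE eqxx mulr1n.
rewrite exprMn exprVn; move: (q y) q0 (q y ^+ n) => s s0 t.
have : a ^+ n != 0 by rewrite expf_neq0// gt_eqF.
by move: (a ^+ n) => b b0; field; rewrite b0 gt_eqF.
Qed.

(** The contribution of one chart to the volume of the Berger metrics, which is also its
    contribution to the round volume. *)
Definition round_piece (i : 'I_2) : \bar R := lebesgue_int (fun y : 'rV[R]_n =>
  if y \in chart S i @` (dom S i `\` \bigcup_(j in [set j : 'I_(nchart S) | (j < i)%N]) dom S j)
  then (Num.sqrt (q y ^+ n))%:E else 0%E).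

Lemma volume_berger a : 0 < a ->
  volume (berger J a (a / a ^+ n)) = (round_piece 0%R + round_piece 1%R)%E.
Proof.
move=> a0; rewrite /volume /= big_ord_recl big_ord1 /round_piece.
have -> : lift ord0 ord0 = 1 :> 'I_2 by exact: val_inj.
by congr (_ + _)%E; congr lebesgue_int; apply/funext => y; rewrite det_berger.
Qed.

Lemma sqrt_conformal_factor y : Num.sqrt (q y ^+ n) = (2 / (sqn y + 1)) ^+ n.
Proof.
have s0 : 0 < 2 / (sqn y + 1) by rewrite divr_gt0// ltr_wpDl// sqn_ge0.
rewrite (_ : q y = (2 / (sqn y + 1)) ^+ 2); last first.
  by rewrite /conformal_factor exprMn exprVn; congr (_ / _); ring.
by rewrite exprAC sqrtr_sqr ger0_norm// exprn_ge0// ltW.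
Qed.

(** The density [(2 / (1 + |y|^2)) ^+ n] is at most the product of the functions
    [2 / (1 + y_k^2)], each of finite integral. *)
Lemma round_piece_bounded i : (0 <= round_piece i)%E /\ (round_piece i < +oo)%E.
Proof.
have [I IE] := @integral_cauchy_density R.
have mphi : measurable_fun setT (fun t : R => 2 * (oneDsqr t)^-1).
  apply: measurable_funM; first exact: measurable_cst.
  by apply: continuous_measurable_fun; exact: continuous_oneDsqrV.
have d0 (t : R) : (0 <= (oneDsqr t)^-1)%R.
  by rewrite invr_ge0 (le_trans _ (oneDsqr_ge1 t)).
have phi0 (t : R) : 0 <= 2 * (oneDsqr t)^-1 by rewrite mulr_ge0.
have PE := @lebesgue_int_prod R n _ I 1 mphi phi0 IE ler01.
pose f y := if y \in chart S i @` (dom S i `\` \bigcup_(j in [set j : 'I_(nchart S) | (j < i)%N]) dom S j)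
  then (Num.sqrt (q y ^+ n))%:E else 0%E.
have [] := @le_lebesgue_int R n f (fun y => (1 * \prod_k (2 * (oneDsqr (y 0 k))^-1))%:E).
- by move=> y; rewrite /f; case: ifP => // _; rewrite lee_fin sqrtr_ge0.
- move=> y; apply: (@le_trans _ _ (Num.sqrt (q y ^+ n))%:E).
    by rewrite /f; case: ifP => // _; rewrite lee_fin sqrtr_ge0.
  rewrite lee_fin mul1r sqrt_conformal_factor.
  have -> : (2 / (sqn y + 1)) ^+ n = \prod_(k < n) (2 / (sqn y + 1)) by rewrite prodr_const card_ord.
  apply: ler_prod => k _; apply/andP; split.
    by rewrite divr_ge0// addr_ge0// sqn_ge0.
  rewrite ler_pM2l// lef_pV2 ?posrE//.
  - rewrite /oneDsqr addrC lerD2r /sqn (bigD1 k)//= lerDl sumr_ge0// => l _.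
    exact: sqr_ge0.
  - by rewrite ltr_wpDl// sqn_ge0.
rewrite PE => f0 fI; split => //.
by rewrite (le_lt_trans fI)// ltry.
Qed.

(** The first chart comes before all others, so its piece is the whole coordinate space,
    and the density is bounded below on the unit cube. *)
Lemma round_piece0_gt0 : (0 < round_piece 0%R)%E.
Proof.
pose c : R := (2 / (n%:R + 1)) ^+ n.
have c0 : 0 < c by rewrite exprn_gt0// divr_gt0// ltr_wpDl.
have m1 : measurable_fun setT (\1_(`[0, 1]%classic) : R -> R).
  exact: measurable_indic.
have phi0 (t : R) : 0 <= (\1_(`[0, 1]%classic) t : R) by rewrite indicE.
have I1 : (\int[@lebesgue_measure R]_t (\1_(`[0, 1]%classic) t : R)%:E = 1%:E)%E.
  rewrite integral_indic// setIT; apply: etrans (lebesgue_measure_itv `[0, 1]) _.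
  rewrite /= lte_fin ltr01.
  by rewrite oppr0 adde0.
have PE := @lebesgue_int_prod R n _ 1 c m1 phi0 I1 (ltW c0).
rewrite expr1n mulr1 in PE.
apply: (@lt_le_trans _ _ c%:E); first by rewrite lte_fin.
rewrite -PE; apply: (le_lebesgue_int _ _).2 => y.
  by rewrite lee_fin; apply: mulr_ge0; [exact: ltW|exact: prodr_ge0].
rewrite ifT; last first.
  rewrite inE; exists (param S 0 y); last exact: chart_param.
  by split; [exact: dom_param|case].
rewrite lee_fin sqrt_conformal_factor.
have [yI|yI] := pselect (forall k, y 0 k \in `[0, 1]%R); last first.
  have [k yk] : exists k, y 0 k \notin `[0, 1]%R.
    apply: contrapT => H; apply: yI => k; apply: contraT => yk; exfalso.
    by apply: H; exists k.
  rewrite (bigD1 k)//= indicE mem_setE (negbTE yk) mul0r mulr0.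
  by rewrite exprn_ge0// divr_ge0// addr_ge0// sqn_ge0.
rewrite big1 ?mulr1; last by move=> k _; rewrite indicE mem_setE yI.
rewrite lerXn2r ?nnegrE ?divr_ge0 ?addr_ge0 ?sqn_ge0//.
rewrite ler_pM2l// lef_pV2 ?posrE; last 2 first.
- by rewrite ltr_wpDl.
- by rewrite ltr_wpDl// sqn_ge0.
rewrite lerD2r /sqn (_ : n%:R = \sum_(k < n) 1); last by rewrite sumr_const card_ord.
apply: ler_sum => k _.
have := yI k; rewrite in_itv/= => /andP[y0 y1].
by rewrite expr_le1.
Qed.

End BergerVolume.

(** * Metrics with a large first eigenvalue *)

Lemma invariant_berger (R : realType) (n : nat) (G : groupType)
    (act : G -> sphere R n -> sphere R n) (J : 'M[R]_n.+1) (a b : R) :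
  is_action act ->
  (forall g, riemannian_isometry (round R n) (act g)) ->
  (forall g, pullback_eq (act g) (berger J a b) (berger J a b)) ->
  J^T = - J -> J *m J = - 1%:M -> 0 < b -> b <= a ->
  invariant_metric act (berger J a b).
Proof.
move=> [act1 _] act_isom act_berger JT JJ b0 ba; split; last first.
  by move=> g; have [Fs Fi _] := act_isom g; split.
split.
(* The law of change of charts is the invariance under the identity. *)
- have -> : @idfun (sphere R n) = act 1%g by apply/funext => s; rewrite act1.
  exact: act_berger.
- move=> i c d k; apply: Ck_sub (Ck_berger J a b k i c d); exact: subsetT.
- by move=> i y _; exact: berger_sym.
- by move=> i y v _ v0; exact: berger_pos.
Qed.

Theorem mainTheorem1 (R : realType) (n : nat) (hn : (2 < n)%N)
  (G : groupType) (act : G -> sphere R n -> sphere R n)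
  (act_action : is_action act) (act_free : free_action act)
  (act_isom : forall a, riemannian_isometry (round R n) (act a))
  (N : atlas R n) (N_manifold : smooth_manifold N)
  (p : sphere R n -> N) (p_quotient : orbit_space act p)
  (p_covering : smooth_covering p)
  (h : tensor2 N) (h_metric : riemannian_metric h)
  (h_induced : pullback_eq p h (round R n))
  (h_killing : exists Y : vector_components N,
     [/\ vector_field Y, killing h Y &
         exists2 c : R, c != 0 & has_constant_length h Y c]) :
  forall C : R, 0 < C ->
    exists2 g : tensor2 (sphere R n), invariant_metric act g & C < Lambda1 g.
Proof.
move=> C C0; have [Y [Yf Yk [c c0 Yc]]] := h_killing; have [p_smooth _ _] := p_covering.
have n0 : (0 < n)%N by apply: leq_trans hn.
have [J [JT JJ hopf]] := killing_complex_structure N_manifold p_smooth h_metric h_induced Yf Yk Yc n0 c0.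
have act_p g s : p (act g s) = p s.
  by apply/esym; apply: (p_quotient.2 s (act g s)).2; exists g.
have act_berger a b g : pullback_eq (act g) (berger J a b) (berger J a b).
  have [Fs _ Fr] := act_isom g.
  apply: (pullback_berger N_manifold p_smooth (w := fun j z => c^-1 *: flat_form h Y j z)) => //.
  by move=> i j y yj; rewrite (hopf _ _ _ yj) scalemxAl.
pose V := fine (@round_piece R n 0%R + @round_piece R n 1%R)%E.
have V0 : 0 < V.
  have [p0 p0y] := @round_piece_bounded R n 0; have [p1 p1y] := @round_piece_bounded R n 1.
  apply: fine_gt0; apply/andP; split; last exact: lte_add_pinfty.
  by apply: (lt_le_trans (round_piece0_gt0 R n)); exact: leeDl.
pose W := V `^ (2 / n%:R); have W0 : 0 < W by exact: powR_gt0.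
(* Since [n - 1 >= 1], the first eigenvalue is at least [t], and [t * W = W + C]. *)
pose t := 1 + C / W; have t1 : 1 <= t by rewrite lerDl divr_ge0// ltW.
have t0 : 0 < t by exact: lt_le_trans t1.
have tn : 0 < t ^+ n by exact: exprn_gt0.
exists (berger J t (t / t ^+ n)).
  apply: invariant_berger => //; first exact: divr_gt0.
  by rewrite ler_pdivrMr// ler_peMr ?exprn_ege1// ltW.
have b0 : 0 < t / t ^+ n by exact: divr_gt0.
have bt : t / t ^+ n <= t by rewrite ler_pdivrMr// ler_peMr ?exprn_ege1// ltW.
rewrite /Lambda1 (lambda1_berger JT JJ n0 b0 bt) (volume_berger JT JJ t0) -/V -/W.
apply: (@lt_le_trans _ _ (t * W)).
  by rewrite mulrDl mul1r divfK ?gt_eqF// ltrDr.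
rewrite ler_pM2r//.
have n2 : 2 <= n%:R :> R by rewrite ler_nat ltnW.
have : t * 2 <= t * n%:R by rewrite ler_pM2l.
move: (t * n%:R) (t / t ^+ n) b0 => x y y0 H; lra.
Qed.
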